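(* Let $M$ be a symmetric positive semidefinite $2\times 2$ integer matrix (the Gram matrix of an integral lattice $L=\mathbb{Z}^2$ of rank two). Every weak Jacobi form $f(\tau,z,w)$ of index $M$ (of any weight) can be expressed as a rational function, with complex coefficients, in the functions $$\vartheta^{(j)}(\tau,\lambda_1 z+\lambda_2 w),\qquad (\lambda_1,\lambda_2)\in\mathbb{Z}^2,\quad 0\le j\le 5,$$ where $\vartheta^{(j)}$ denotes the $j$-th derivative of $\vartheta(\tau,x)$ with respect to $x$.
   Context: Notation: $\mathbb{H}$ is the upper half-plane, $\tau\in\mathbb{H}$, $q=e^{2\pi i\tau}$, $\zeta=e^{2\pi i z}$. Let $M$ be a symmetric positive semidefinite $n\times n$ integer matrix (diagonal entries may be odd, $M$ may be singular) and $Q(\mathfrak z)=\tfrac12\mathfrak z^TM\mathfrak z$ for $\mathfrak z\in\mathbb{C}^n$. A weak Jacobi form of weight $k\in\mathbb{Z}$ and index $M$ is a holomorphic $f:\mathbb{H}\times\mathbb{C}^n\to\mathbb{C}$ such that (i) $f\big(\frac{a\tau+b}{c\tau+d},\frac{\mathfrak z}{c\tau+d}\big)=(c\tau+d)^k\exp\big(\frac{2\pi i c\,Q(\mathfrak z)}{c\tau+d}\big)f(\tau,\mathfrak z)$ for all $\begin{pmatrix}a&b\\c&d\end{pmatrix}\in\mathrm{SL}_2(\mathbb{Z})$; (ii) $f(\tau,\mathfrak z+\lambda\tau+\mu)=(-1)^{2Q(\lambda)+2Q(\mu)}\exp\big(-2\pi i\tau Q(\lambda)-2\pi i\lambda^TM\mathfrak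 z\big)f(\tau,\mathfrak z)$ for all $\lambda,\mu\in\mathbb{Z}^n$; (iii) its Fourier expansion in $\tau$ has the form $\sum_{m\ge 0}c(m,\mathfrak z)q^m$. For $n=2$ we write $f(\tau,z,w)$. The Jacobi theta function is $\vartheta(\tau,z)=q^{1/8}\zeta^{1/2}\sum_{n\in\mathbb{Z}}q^{n(n+1)/2}(-\zeta)^n$. *)

(* Defs.v *)
From HB Require Import structures.
From mathcomp Require Import all_boot all_order all_algebra.
From mathcomp Require Import all_classical all_reals all_analysis.
From mathcomp Require Import complex.
(* Not imported: its notations clash with those of the analysis library. *)
From mathcomp Require mpoly.

Set Implicit Arguments.
Unset Strict Implicit.
Unset Printing Implicit Defensive.

Import Order.TTheory GRing.Theory Num.Theory.
Import numFieldNormedType.Exports.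

Local Open Scope classical_set_scope.
Local Open Scope ring_scope.
Local Open Scope complex_scope.

(* Equips R[i] with its norm topology, as a normed space over itself, so that
   [differentiable] and [derive1n] below mean complex differentiability. *)
HB.instance Definition _ (R : realType) := NormedModule.copy R[i] R[i]^o.

Section ComplexFunctions.
Variable R : realType.
Local Notation C := R[i].

Definition cexp (z : C) : C :=
  (expR (complex.Re z))%:C * (cos (complex.Im z) +i* sin (complex.Im z)).

(* exp(2 pi i x), so that q ^ r = ee (r * tau) and zeta ^ r = ee (r * z). *)
Definition ee (x : C) : C := cexp (2 * (pi : R)%:C * 'i * x).

Definition upper_half_plane : set C := [set tau | 0 < complex.Im tau].

Definition theta_term (tau z : C) (n : int) : C :=
  ee ((n * (n + 1))%:~R / 2 * tau) * (- ee z) ^ n.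

(* The bilateral sum is split into n >= 0 and n < 0, as Negz n = - n.+1. *)
Definition theta (tau z : C) : C :=
  ee (tau / 8) * ee (z / 2) *
  (limn (series (fun n : nat => theta_term tau z (Posz n))) +
   limn (series (fun n : nat => theta_term tau z (Negz n)))).

Definition theta_pullback (j : nat) (l1 l2 : int) (tau : C) (v : 'cV[C]_2) : C :=
  derive1n j (theta tau) (l1%:~R * v 0 0 + l2%:~R * v 1 0).

Definition theta_generators : set (C -> 'cV[C]_2 -> C) :=
  [set g | exists j l1 l2, (j <= 5)%N /\ g = theta_pullback j l1 l2].

(* f = P(g_1, .., g_N) / D(g_1, .., g_N) as meromorphic functions on H x C^n.
   For holomorphic g_i, as H x C^n is connected, D(g_1, .., g_N) is nonzero as
   a meromorphic function as soon as it is nonzero at one point. *)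
Definition rational_function_in n (G : set (C -> 'cV[C]_n -> C))
    (f : C -> 'cV[C]_n -> C) : Prop :=
  exists (N : nat) (g : 'I_N -> C -> 'cV[C]_n -> C) (P D : mpoly.mpoly N C),
  [/\ forall i, G (g i),
      exists tau v, upper_half_plane tau /\
        mpoly.meval (fun i => g i tau v) D != 0
    & forall tau v, upper_half_plane tau ->
        mpoly.meval (fun i => g i tau v) D != 0 ->
        f tau v = mpoly.meval (fun i => g i tau v) P /
                  mpoly.meval (fun i => g i tau v) D].

End ComplexFunctions.

Definition bform (A : comNzRingType) n (M : 'M[int]_n) (x y : 'cV[A]_n) : A :=
  (x^T *m map_mx intr M *m y) 0 0.

Definition possemidef (R : realType) n (M : 'M[int]_n) : Prop :=
  forall x : 'cV[R]_n, 0 <= bform M x x.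

Definition quad (R : realType) n (M : 'M[int]_n) (z : 'cV[R[i]]_n) : R[i] :=
  bform M z z / 2.

(* In [jacobi_elliptic], the integer 2 Q(lambda) is [bform M lam lam : int]. *)
Record weak_jacobi_form (R : realType) n (M : 'M[int]_n) (k : int)
    (f : R[i] -> 'cV[R[i]]_n -> R[i]) : Prop := {
  jacobi_holomorphic : forall (tau : R[i]) (z : 'cV[R[i]]_n),
    upper_half_plane tau ->
    differentiable (fun p : R[i] * 'cV[R[i]]_n => f p.1 p.2) (tau, z);
  jacobi_modular : forall (a b c d : int) (tau : R[i]) (z : 'cV[R[i]]_n),
    a * d - b * c = 1 -> upper_half_plane tau ->
    let j := c%:~R * tau + d%:~R in
    f ((a%:~R * tau + b%:~R) / j) (j^-1 *: z) =
      j ^ k * ee (c%:~R * quad M z / j) * f tau z;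
  jacobi_elliptic : forall (lam mu : 'cV[int]_n) (tau : R[i]) (z : 'cV[R[i]]_n),
    upper_half_plane tau ->
    let l : 'cV[R[i]]_n := map_mx intr lam in
    f tau (z + tau *: l + map_mx intr mu) =
      (-1) ^ (bform M lam lam + bform M mu mu) *
      ee (- tau * quad M l - bform M l z) * f tau z;
  jacobi_fourier : exists c : nat -> 'cV[R[i]]_n -> R[i],
    forall tau z, upper_half_plane tau ->
    series (fun m : nat => c m z * ee (m%:R * tau)) @ \oo --> f tau z
}.

(* Main.v *)
(* Write phi = theta / theta'(0), x = phi^2 wp and y = phi^3 wp'.  For fixed tau the
   entire functions of index a >= 1 form a space of dimension a, with basis
   phi^(a - e) P_e, where P_e is x^(e/2) or x^((e-3)/2) y and e = 0, 2, 3, .., a.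
   Multiplying f by phi(z) phi(w) and a power of phi(z + w) or phi(z - w) makes its
   index diagonal and positive definite, so it becomes
     sum_(i, j) g_ij(tau) psi_i(tau, z) psi_j(tau, w),
   whose coefficients g_ij are level one modular forms, by uniqueness and Cramer's
   rule.  Applied to y^2 the same expansion gives the Weierstrass equation; it yields
   modular forms E4, E6 that do not vanish at the cusp and a discriminant which is
   nonzero on the half-plane and vanishes to order one at the cusp.  Multiplying by
   powers of E4 and E6 and dividing by the discriminant, every level one form is a
   rational function in the coefficients of the Weierstrass equation, and these are
   recovered from phi, x, y at the three points z, w and z + w.  All denominators are
   nonzero at a common point (tau0, eps, 2 eps). *)
Require Import Defs.
From HB Require Import structures.
From mathcomp Require Import all_boot all_order all_algebra.
From mathcomp Require Import all_classical all_reals all_analysis.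
From mathcomp Require Import complex.
From mathcomp Require Import ring lra zify.

Set Implicit Arguments.
Unset Strict Implicit.
Unset Printing Implicit Defensive.
Import Order.TTheory GRing.Theory Num.Theory.
Import numFieldNormedType.Exports.
Local Open Scope classical_set_scope.
Local Open Scope ring_scope.
Local Open Scope complex_scope.


(** All function theory is drawn from one source, the Fourier expansion of 1-periodic holomorphic
    functions on a half-plane: Goursat's theorem makes the coefficients independent of the height,
    and Dini's criterion recovers the function. This bounds the dimension of the spaces of given
    index (quasi-periodicity is a recursion of step [a] on the coefficients; the lower bound comes
    from vanishing orders at 0), it gives the inversion law of theta (index 1 is a line), and it
    controls modular forms at the cusp. Statements about the whole half-plane, such as theta'(0)
    being nonzero, are checked for Im tau >= 1/2 on the first terms of the q-series and carried over
    by the two generators of the modular group; the same reduction makes the constancy of weight 0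
    forms a contraction argument. The power of phi(z + w) or phi(z - w) is |M_01|, with the sign
    that cancels the off-diagonal entry, and phi(z) phi(w) keeps both diagonal indices at least 1
    when M is singular. Every denominator is tested at one fixed point, so products of denominators
    stay nonzero. *)

(** * Modulus, real part and imaginary part *)

Section ComplexNorm.
Variable R : realType.
Local Notation C := R[i].
Implicit Types (z w : C).

Definition cnorm z : R := ComplexField.Normc.normc z.

Lemma normcE' z : `|z| = (cnorm z)%:C. Proof. by []. Qed.

Lemma cnorm0 : cnorm 0 = 0. Proof. exact: ComplexField.Normc.normc0. Qed.
Lemma cnorm1 : cnorm 1 = 1. Proof. exact: ComplexField.Normc.normc1. Qed.
Lemma cnormM z w : cnorm (z * w) = cnorm z * cnorm w.
Proof. exact: ComplexField.Normc.normcM. Qed.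
Lemma cnormV z : cnorm z^-1 = (cnorm z)^-1.
Proof. exact: ComplexField.Normc.normcV. Qed.
Lemma cnormD z w : cnorm (z + w) <= cnorm z + cnorm w.
Proof. exact: le_normcD. Qed.
Lemma cnormN z : cnorm (- z) = cnorm z. Proof. exact: normcN. Qed.
Lemma cnormB z w : cnorm (z - w) <= cnorm z + cnorm w.
Proof. by rewrite -(cnormN w); exact: cnormD. Qed.
Lemma cdistC z w : cnorm (z - w) = cnorm (w - z).
Proof. by rewrite -cnormN opprB. Qed.
Lemma cnorm_ge0 z : 0 <= cnorm z.
Proof. by case: z => a b; exact: sqrtr_ge0. Qed.
Lemma cnorm_eq0 z : (cnorm z == 0) = (z == 0).
Proof.
by apply/eqP/eqP => [/ComplexField.Normc.eq0_normc|->]; rewrite ?cnorm0.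
Qed.
Lemma cnorm_gt0 z : (0 < cnorm z) = (z != 0).
Proof. by rewrite lt_def cnorm_ge0 andbT cnorm_eq0. Qed.
Lemma cnormX z n : cnorm (z ^+ n) = cnorm z ^+ n.
Proof. by elim: n => [|n IH]; rewrite ?expr0 ?cnorm1// !exprS cnormM IH. Qed.
Lemma cnorm_real (x : R) : cnorm x%:C = `|x|.
Proof. by rewrite /cnorm/= expr0n/= addr0 sqrtr_sqr. Qed.
Lemma ler_cnorm z w : cnorm z - cnorm w <= cnorm (z - w).
Proof. by rewrite lerBlDr (le_trans _ (cnormD _ _))// subrK. Qed.
Lemma cnorm_Re z : `|complex.Re z| <= cnorm z.
Proof.
by case: z => a b; rewrite /cnorm/= -sqrtr_sqr ler_wsqrtr// lerDl sqr_ge0.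
Qed.
Lemma cnorm_Im z : `|complex.Im z| <= cnorm z.
Proof.
by case: z => a b; rewrite /cnorm/= -sqrtr_sqr ler_wsqrtr// lerDr sqr_ge0.
Qed.
Lemma cnorm_le z : cnorm z <= `|complex.Re z| + `|complex.Im z|.
Proof.
case: z => a b; rewrite /cnorm/= -[leRHS]ger0_norm ?addr_ge0// -sqrtr_sqr.
rewrite ler_wsqrtr// sqrrD !real_normK ?num_real//.
by have := mulr_ge0 (normr_ge0 a) (normr_ge0 b); lra.
Qed.
Lemma cnorm_sum (I : Type) (r : seq I) (P : pred I) (F : I -> C) :
  cnorm (\sum_(i <- r | P i) F i) <= \sum_(i <- r | P i) cnorm (F i).
Proof.
elim/big_ind2 : _ => [|x y x' y' h h'|//]; first by rewrite cnorm0.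
by rewrite (le_trans (cnormD _ _))// lerD.
Qed.
Lemma cnorm_i : cnorm 'i = 1.
Proof. by rewrite /cnorm/= expr0n/= add0r expr1n sqrtr1. Qed.

Lemma cReD z w : complex.Re (z + w) = complex.Re z + complex.Re w.
Proof. by case: z; case: w. Qed.
Lemma cImD z w : complex.Im (z + w) = complex.Im z + complex.Im w.
Proof. by case: z; case: w. Qed.
Lemma cReN z : complex.Re (- z) = - complex.Re z. Proof. by case: z. Qed.
Lemma cImN z : complex.Im (- z) = - complex.Im z. Proof. by case: z. Qed.
Lemma cReM z w : complex.Re (z * w) =
  complex.Re z * complex.Re w - complex.Im z * complex.Im w.
Proof. by case: z; case: w. Qed.
Lemma cImM z w : complex.Im (z * w) =
  complex.Re z * complex.Im w + complex.Im z * complex.Re w.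
Proof. by case: z; case: w. Qed.
Lemma complexP z w :
  complex.Re z = complex.Re w -> complex.Im z = complex.Im w -> z = w.
Proof. by case: z; case: w => a b c d /= -> ->. Qed.

End ComplexNorm.

Arguments cnorm : simpl never.

(** * Limits and boundedness along filters *)

Section Limits.
Variable R : realType.
Local Notation C := R[i].

(** The tolerance [e] and [cnorm] are real, so estimates stay in a totally ordered field; [cvg_clim]
    is the bridge to topological convergence. *)
Definition clim T (F : set_system T) (u : T -> C) (l : C) : Prop :=
  forall e : R, 0 < e -> F [set t | cnorm (u t - l) < e].

Definition bounded_along T (F : set_system T) (u : T -> C) : Prop :=
  exists M : R, F [set t | cnorm (u t) <= M].

Section ClimTheory.
Context {T : Type} {F : set_system T} {FF : Filter F}.
Implicit Types (u v : T -> C) (l m : C).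

Lemma clim_ext u v l : F [set t | u t = v t] -> clim F u l -> clim F v l.
Proof. by move=> E H e /H; apply: filterS2 E => t /= ->. Qed.

Lemma clim_cst l : clim F (fun=> l) l.
Proof. by move=> e e0; apply: filterE => t /=; rewrite subrr cnorm0. Qed.

Lemma climD u v l m : clim F u l -> clim F v m ->
  clim F (fun t => u t + v t) (l + m).
Proof.
move=> Hu Hv e e0; have e2 : 0 < e / 2 by rewrite divr_gt0.
apply: filterS2 (Hu _ e2) (Hv _ e2) => t /= h1 h2.
rewrite [e]splitr (_ : _ - _ = (u t - l) + (v t - m)); last by ring.
exact: le_lt_trans (cnormD _ _) (ltrD h1 h2).
Qed.

Lemma clim_bounded u l : clim F u l -> bounded_along F u.
Proof.
move=> /(_ 1 ltr01) H; exists (cnorm l + 1); apply: filterS H => t /= h.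
rewrite -[u t](subrK l) addrC (le_trans (cnormD _ _))// lerD2l.
exact: ltW.
Qed.

Lemma clim0M u v : clim F u 0 -> bounded_along F v ->
  clim F (fun t => u t * v t) 0.
Proof.
move=> Hu [M HM] e e0.
have M1 : 0 < `|M| + 1 by rewrite ltr_wpDl.
have e1 : 0 < e / (`|M| + 1) by rewrite divr_gt0.
apply: filterS2 (Hu _ e1) HM => t /=; rewrite !subr0 => h1 h2.
rewrite cnormM (@le_lt_trans _ _ (cnorm (u t) * (`|M| + 1)))//.
  by rewrite ler_wpM2l ?cnorm_ge0// (le_trans h2)// (le_trans (ler_norm _))// lerDl.
by rewrite -ltr_pdivlMr.
Qed.

Lemma clim_sub0 u l : clim F u l <-> clim F (fun t => u t - l) 0.
Proof. by split=> H e /H; apply: filterS => t /=; rewrite subr0. Qed.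

Lemma climM u v l m : clim F u l -> clim F v m ->
  clim F (fun t => u t * v t) (l * m).
Proof.
move=> Hu Hv; apply/clim_sub0.
have -> : 0 = 0 + 0 :> C by rewrite addr0.
apply: (@clim_ext (fun t => (u t - l) * v t + (v t - m) * l)).
  by apply: filterE => t /=; ring.
apply: climD.
  exact: clim0M ((clim_sub0 _ _).1 Hu) (clim_bounded Hv).
exact: clim0M ((clim_sub0 _ _).1 Hv) (clim_bounded (clim_cst l)).
Qed.

Lemma climN u l : clim F u l -> clim F (fun t => - u t) (- l).
Proof.
move=> H; rewrite -mulN1r; apply: clim_ext (climM (clim_cst (-1)) H).
by apply: filterE => t /=; rewrite mulN1r.
Qed.

Lemma climB u v l m : clim F u l -> clim F v m ->
  clim F (fun t => u t - v t) (l - m).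
Proof. by move=> Hu Hv; apply: climD => //; exact: climN. Qed.

Lemma climX u l n : clim F u l -> clim F (fun t => u t ^+ n) (l ^+ n).
Proof.
move=> H; elim: n => [|n IH]; first exact: clim_cst.
by rewrite exprS; apply: clim_ext (climM H IH); apply: filterE => t /=; rewrite exprS.
Qed.

Lemma clim_sum (I : Type) (r : seq I) (u : I -> T -> C) (l : I -> C) :
  (forall i, clim F (u i) (l i)) ->
  clim F (fun t => \sum_(i <- r) u i t) (\sum_(i <- r) l i).
Proof.
move=> H; elim: r => [|i r IH].
  rewrite big_nil; apply: clim_ext (clim_cst 0).
  by apply: filterE => t /=; rewrite big_nil.
rewrite big_cons; apply: clim_ext (climD (H i) IH).
by apply: filterE => t /=; rewrite big_cons.
Qed.

Lemma clim_prod (I : Type) (r : seq I) (u : I -> T -> C) (l : I -> C) :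
  (forall i, clim F (u i) (l i)) ->
  clim F (fun t => \prod_(i <- r) u i t) (\prod_(i <- r) l i).
Proof.
move=> H; elim: r => [|i r IH].
  rewrite big_nil; apply: clim_ext (clim_cst 1).
  by apply: filterE => t /=; rewrite big_nil.
rewrite big_cons; apply: clim_ext (climM (H i) IH).
by apply: filterE => t /=; rewrite big_cons.
Qed.

Lemma clim_away u l : clim F u l -> l != 0 ->
  F [set t | cnorm l / 2 < cnorm (u t)].
Proof.
move=> Hu l0; have nl : 0 < cnorm l by rewrite cnorm_gt0.
have l2 : 0 < cnorm l / 2 by rewrite divr_gt0.
apply: filterS (Hu _ l2) => t /= h.
have := ler_cnorm l (u t); rewrite cdistC; lra.
Qed.

Lemma clim_neq0 u l : clim F u l -> l != 0 -> F [set t | u t != 0].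
Proof.
move=> Hu l0; apply: filterS (clim_away Hu l0) => t /= h.
by rewrite -cnorm_gt0 (le_lt_trans _ h)// divr_ge0// cnorm_ge0.
Qed.

Lemma climV u l : clim F u l -> l != 0 -> clim F (fun t => (u t)^-1) l^-1.
Proof.
move=> Hu l0; have nl : 0 < cnorm l by rewrite cnorm_gt0.
apply/clim_sub0.
apply: (@clim_ext (fun t => (u t - l) * - (l^-1 * (u t)^-1))).
  apply: filterS (clim_neq0 Hu l0) => t /= ut0; field.
  by rewrite ut0 l0.
apply: clim0M; first exact: (clim_sub0 _ _).1.
exists ((cnorm l)^-1 * (cnorm l / 2)^-1).
apply: filterS (clim_away Hu l0) => t /= h.
rewrite cnormN cnormM !cnormV ler_wpM2l ?invr_ge0 ?cnorm_ge0// lef_pV2 ?posrE.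
- exact: ltW.
- by rewrite (lt_trans _ h)// divr_gt0.
- by rewrite divr_gt0.
Qed.

Lemma bounded_ext u v : F [set t | u t = v t] ->
  bounded_along F u -> bounded_along F v.
Proof. by move=> E [M H]; exists M; apply: filterS2 E H => t /= ->. Qed.

Lemma boundedD u v : bounded_along F u -> bounded_along F v ->
  bounded_along F (fun t => u t + v t).
Proof.
move=> [M HM] [L HL]; exists (M + L); apply: filterS2 HM HL => t /= h1 h2.
by rewrite (le_trans (cnormD _ _))// lerD.
Qed.

Lemma boundedM u v : bounded_along F u -> bounded_along F v ->
  bounded_along F (fun t => u t * v t).
Proof.
move=> [M HM] [L HL]; exists (M * L); apply: filterS2 HM HL => t /= h1 h2.
by rewrite cnormM ler_pM ?cnorm_ge0.
Qed.

Lemma bounded_sum (I : Type) (r : seq I) (u : I -> T -> C) :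
  (forall i, bounded_along F (u i)) ->
  bounded_along F (fun t => \sum_(i <- r) u i t).
Proof.
move=> H; elim: r => [|i r IH].
  apply: bounded_ext (clim_bounded (clim_cst 0)).
  by apply: filterE => t /=; rewrite big_nil.
apply: bounded_ext (boundedD (H i) IH).
by apply: filterE => t /=; rewrite big_cons.
Qed.

Lemma clim_unique {PF : ProperFilter F} u l m : clim F u l -> clim F u m -> l = m.
Proof.
move=> Hl Hm; apply/eqP; rewrite -subr_eq0 -cnorm_eq0 eq_le cnorm_ge0 andbT.
rewrite leNgt; apply/negP => d0.
have e0 : 0 < cnorm (l - m) / 2 by rewrite divr_gt0.
have [t [/= h1 h2]] := filter_ex (filterI (Hl _ e0) (Hm _ e0)).
have := cnormB (u t - m) (u t - l); rewrite (_ : _ - _ = l - m); last by ring.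
lra.
Qed.

End ClimTheory.

Lemma clim_comp T U (F : set_system T) (G : set_system U) (g : T -> U)
    (u : U -> C) l :
  (forall A, G A -> F [set t | A (g t)]) -> clim G u l -> clim F (u \o g) l.
Proof. by move=> H Hu e /Hu /H. Qed.

Definition cnear (z : C) : set_system C :=
  [set A | exists2 d : R, 0 < d & forall w, cnorm (w - z) < d -> A w].

#[global] Instance cnear_filter z : ProperFilter (cnear z).
Proof.
split.
  by move=> [d d0] /(_ z); rewrite subrr cnorm0 => /(_ d0).
split.
- by exists 1.
- move=> A B [d d0 hA] [e e0 hB]; exists (Num.min d e).
    by rewrite lt_min d0 e0.
  by move=> w; rewrite lt_min => /andP[/hA ? /hB].
- by move=> A B AB [d d0 h]; exists d => // w /h /AB.
Qed.

(** Punctured neighbourhoods, whereas [cnear] contains the centre. They serve where one divides by a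
    function vanishing at [z]. *)
Definition cdnear (z : C) : set_system C :=
  [set A | exists2 d : R, 0 < d & forall w, w != z -> cnorm (w - z) < d -> A w].

#[global] Instance cdnear_filter z : ProperFilter (cdnear z).
Proof.
split.
  move=> [d d0] /(_ (z + (d / 2)%:C)); rewrite [z + _]addrC addrK -subr_eq0 addrK.
  rewrite cnorm_real ger0_norm ?divr_ge0 ?ltW// gtr_pMr// invf_lt1 ?ltr1n//; apply=> //.
  by rewrite -cnorm_eq0 cnorm_real normr_eq0 mulf_neq0 ?gt_eqF// invr_eq0 pnatr_eq0.
split.
- by exists 1.
- move=> A B [d d0 hA] [e e0 hB]; exists (Num.min d e).
    by rewrite lt_min d0 e0.
  by move=> w wz; rewrite lt_min => /andP[/(hA _ wz) ? /(hB _ wz)].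
- by move=> A B AB [d d0 h]; exists d => // w wz /(h _ wz) /AB.
Qed.

Lemma cnear_cdnear z A : cnear z A -> cdnear z A.
Proof. by move=> [d d0 H]; exists d => // w _ /H. Qed.

Definition rnear (x : R) : set_system R :=
  [set A | exists2 d : R, 0 < d & forall y, `|y - x| < d -> A y].

#[global] Instance rnear_filter x : ProperFilter (rnear x).
Proof.
split.
  by move=> [d d0] /(_ x); rewrite subrr normr0 => /(_ d0).
split.
- by exists 1.
- move=> A B [d d0 hA] [e e0 hB]; exists (Num.min d e).
    by rewrite lt_min d0 e0.
  by move=> w; rewrite lt_min => /andP[/hA ? /hB].
- by move=> A B AB [d d0 h]; exists d => // w /h /AB.
Qed.

(* Neighbourhoods of the cusp i oo. *)
Definition icusp : set_system C :=
  [set A | exists Y : R, forall tau, Y < complex.Im tau -> A tau].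

#[global] Instance icusp_filter : ProperFilter icusp.
Proof.
split.
  by move=> [Y] /(_ (0 +i* (Y + 1))); apply => /=; rewrite ltrDl.
split.
- by exists 0.
- move=> A B [d hA] [e hB]; exists (Num.max d e).
  by move=> w; rewrite gt_max => /andP[/hA ? /hB].
- by move=> A B AB [d h]; exists d => w /h /AB.
Qed.

Definition ccont (h : C -> C) z := clim (cnear z) h (h z).
Definition rcont (p : R -> C) x := clim (rnear x) p (p x).

Lemma ccont_id z : ccont id z.
Proof. by move=> e e0; exists e. Qed.

Lemma ccont_comp (g h : C -> C) z : ccont g (h z) -> ccont h z -> ccont (g \o h) z.
Proof.
move=> Hg Hh; apply: (clim_comp _ Hg) => A [d d0 H].
by have [e e0 He] := Hh _ d0; exists e => // w /He /= /H.
Qed.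

End Limits.

(** * Complex derivatives *)

Section ComplexDerivative.
Variable R : realType.
Local Notation C := R[i].
Implicit Types (g h u : C -> C) (z w d : C).

(* Caratheodory's form of complex differentiability. *)
Definition cderiv h z d : Prop :=
  exists2 u, clim (cnear z) u d & cnear z [set w | h w = h z + u w * (w - z)].

Definition cdiff h z : Prop := exists d, cderiv h z d.

Lemma climBid z : clim (cnear z) (fun w => w - z) 0.
Proof. by move=> e e0; exists e => // w; rewrite /= subr0. Qed.

Lemma cderiv_cont h z d : cderiv h z d -> ccont h z.
Proof.
move=> [u Hu Hh]; rewrite /ccont -[h z]addr0 -(mulr0 d).
apply: clim_ext (climD (clim_cst (h z)) (climM Hu (climBid z))).
by apply: filterS Hh => w /= ->.
Qed.

Lemma cderiv_ext g h z d : cnear z [set w | g w = h w] -> cderiv g z d -> cderiv h z d.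
Proof.
move=> [r r0 E] [u Hu Hg]; exists u => //.
have Ez : g z = h z by apply: E; rewrite subrr cnorm0.
by rewrite -Ez; apply: filterS2 Hg (ex_intro2 _ _ r r0 E) => w /= -> <-.
Qed.

Lemma cderiv_eq h z d d' : cderiv h z d -> d = d' -> cderiv h z d'.
Proof. by move=> H <-. Qed.

Lemma cderiv_cst d z : cderiv (fun=> d) z 0.
Proof.
exists (fun=> 0); first exact: clim_cst.
by apply: filterE => w /=; rewrite mul0r addr0.
Qed.

Lemma cderiv_id z : cderiv id z 1.
Proof.
exists (fun=> 1); first exact: clim_cst.
by apply: filterE => w /=; rewrite mul1r addrC subrK.
Qed.

Lemma cderivD g h z d d' : cderiv g z d -> cderiv h z d' ->
  cderiv (fun w => g w + h w) z (d + d').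
Proof.
move=> [u Hu Hg] [v Hv Hh]; exists (fun w => u w + v w); first exact: climD.
by apply: filterS2 Hg Hh => w /= -> ->; ring.
Qed.

Lemma cderivM g h z d d' : cderiv g z d -> cderiv h z d' ->
  cderiv (fun w => g w * h w) z (d * h z + g z * d').
Proof.
move=> [u Hu Hg] Dh; have ch := cderiv_cont Dh; move: Dh => [v Hv Hh].
exists (fun w => u w * h w + g z * v w).
  apply: climD; apply: climM => //; exact: clim_cst.
by apply: filterS2 Hg Hh => w /= -> ->; ring.
Qed.

Lemma cderivZ k h z d : cderiv h z d -> cderiv (fun w => k * h w) z (k * d).
Proof.
by move=> H; apply: cderiv_eq (cderivM (cderiv_cst k z) H) _; rewrite mul0r add0r.
Qed.

Lemma cderivN h z d : cderiv h z d -> cderiv (fun w => - h w) z (- d).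
Proof.
move=> H; rewrite -mulN1r; apply: cderiv_ext (cderivZ (-1) H).
by apply: filterE => w /=; rewrite mulN1r.
Qed.

Lemma cderivB g h z d d' : cderiv g z d -> cderiv h z d' ->
  cderiv (fun w => g w - h w) z (d - d').
Proof. by move=> Hg Hh; apply: cderivD => //; exact: cderivN. Qed.

Lemma cderiv_comp g h z d d' : cderiv g (h z) d -> cderiv h z d' ->
  cderiv (g \o h) z (d * d').
Proof.
move=> [u Hu Hg] Dh; have ch := cderiv_cont Dh; move: Dh => [v Hv Hh].
have near_h A : cnear (h z) A -> cnear z [set w | A (h w)].
  move=> [e e0 H]; apply: filterS (ch _ e0) => w /=; exact: H.
exists (fun w => u (h w) * v w).
  by apply: climM => //; exact: (clim_comp near_h Hu).
by apply: filterS2 (near_h _ Hg) Hh => w /= -> hw; rewrite {2}hw; ring.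
Qed.

Lemma cderivV h z d : cderiv h z d -> h z != 0 ->
  cderiv (fun w => (h w)^-1) z (- d / h z ^+ 2).
Proof.
move=> Dh h0; have ch := cderiv_cont Dh; move: Dh => [u Hu Hh].
exists (fun w => - u w * ((h w)^-1 * (h z)^-1)).
  apply: climM; first exact: climN.
  rewrite expr2 invfM; apply: climM (clim_cst _); exact: climV.
apply: filterS2 Hh (clim_neq0 ch h0) => w /= hw w0.
have -> : - u w * ((h w)^-1 * (h z)^-1) * (w - z) =
    - (h w - h z) * ((h w)^-1 * (h z)^-1) by rewrite {2}hw; ring.
by field; rewrite w0 h0.
Qed.

Lemma cderivX h z d n : cderiv h z d ->
  cderiv (fun w => h w ^+ n) z (n%:R * h z ^+ n.-1 * d).
Proof.
move=> H; elim: n => [|n IH].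
  apply: cderiv_eq (cderiv_ext _ (cderiv_cst 1 z)) _; first by apply: filterE.
  by rewrite mul0r mul0r.
apply: cderiv_eq (cderiv_ext _ (cderivM H IH)) _.
  by apply: filterE => w /=; rewrite exprS.
case: n {IH} => [|n] /=; first by rewrite expr0; ring.
by rewrite -[n.+2%:R]natr1 exprS; ring.
Qed.

Lemma cderivP h z d : cderiv h z d <->
  forall e : R, 0 < e ->
    cnear z [set w | cnorm (h w - h z - d * (w - z)) <= e * cnorm (w - z)].
Proof.
split=> [[u Hu Hh] e e0|H].
  apply: filterS2 (Hu _ e0) Hh => w /= h1 ->.
  rewrite (_ : _ - _ - _ = (u w - d) * (w - z)); last by ring.
  by rewrite cnormM ler_wpM2r ?cnorm_ge0// ltW.
exists (fun w => if w == z then d else (h w - h z) / (w - z)).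
  move=> e e0; have e2 : 0 < e / 2 by rewrite divr_gt0.
  apply: filterS (H _ e2) => w /=; case: eqP => [_ _|/eqP wz h1].
    by rewrite subrr cnorm0.
  have wz0 : w - z != 0 by rewrite subr_eq0.
  have nwz : 0 < cnorm (w - z) by rewrite cnorm_gt0.
  rewrite -(ltr_pM2r nwz) -cnormM mulrBl divfK//.
  by rewrite (le_lt_trans h1)// ltr_pM2r// gtr_pMr// invf_lt1 ?ltr1n.
apply: filterE => w /=; case: eqP => [->|/eqP wz]; first by ring.
by field; rewrite subr_eq0.
Qed.

Lemma cderiv_unique h z d d' : cderiv h z d -> cderiv h z d' -> d = d'.
Proof.
move=> [u Hu Hh] [v Hv Hh']; apply: (@clim_unique _ _ (cdnear z) _ _ u).
  by move=> e /Hu /cnear_cdnear.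
have Hv' : clim (cdnear z) v d' by move=> e /Hv /cnear_cdnear.
apply: clim_ext Hv'.
have := cnear_cdnear (filterI Hh Hh'); case=> r r0 H; exists r => // w wz wr.
have [/= -> E] := H _ wz wr; have wz0 : w - z != 0 by rewrite subr_eq0.
by apply: (mulIf wz0); apply: (addrI (h z)).
Qed.

Lemma cderiv_affine (a b : C) z : cderiv (fun w => a * w + b) z a.
Proof.
apply: cderiv_eq (cderivD (cderivZ a (cderiv_id z)) (cderiv_cst b z)) _.
by rewrite mulr1 addr0.
Qed.

Lemma cdiff_cont h z : cdiff h z -> ccont h z.
Proof. by case=> d /cderiv_cont. Qed.
Lemma cdiff_ext g h z : cnear z [set w | g w = h w] -> cdiff g z -> cdiff h z.
Proof. by move=> E [d H]; exists d; exact: cderiv_ext H. Qed.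
Lemma cdiff_cst d z : cdiff (fun=> d) z.
Proof. by exists 0; exact: cderiv_cst. Qed.
Lemma cdiff_id z : cdiff id z. Proof. by exists 1; exact: cderiv_id. Qed.
Lemma cdiffD g h z : cdiff g z -> cdiff h z -> cdiff (fun w => g w + h w) z.
Proof. by move=> [d Hd] [e He]; eexists; exact: cderivD Hd He. Qed.
Lemma cdiffN h z : cdiff h z -> cdiff (fun w => - h w) z.
Proof. by move=> [d Hd]; eexists; exact: cderivN Hd. Qed.
Lemma cdiffB g h z : cdiff g z -> cdiff h z -> cdiff (fun w => g w - h w) z.
Proof. by move=> [d Hd] [e He]; eexists; exact: cderivB Hd He. Qed.
Lemma cdiffM g h z : cdiff g z -> cdiff h z -> cdiff (fun w => g w * h w) z.
Proof. by move=> [d Hd] [e He]; eexists; exact: cderivM Hd He. Qed.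
Lemma cdiffV h z : cdiff h z -> h z != 0 -> cdiff (fun w => (h w)^-1) z.
Proof. by move=> [d Hd] h0; eexists; exact: cderivV Hd h0. Qed.
Lemma cdiffX h z n : cdiff h z -> cdiff (fun w => h w ^+ n) z.
Proof. by move=> [d Hd]; eexists; exact: cderivX Hd. Qed.
Lemma cdiff_comp g h z : cdiff g (h z) -> cdiff h z -> cdiff (fun w => g (h w)) z.
Proof. by move=> [d Hd] [e He]; eexists; exact: cderiv_comp Hd He. Qed.
Lemma cdiff_sum (I : Type) (r : seq I) (F : I -> C -> C) z :
  (forall i, cdiff (F i) z) -> cdiff (fun w => \sum_(i <- r) F i w) z.
Proof.
move=> H; elim: r => [|i r IH].
  by apply: cdiff_ext (cdiff_cst 0 z); apply: filterE => w /=; rewrite big_nil.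
by apply: cdiff_ext (cdiffD (H i) IH); apply: filterE => w /=; rewrite big_cons.
Qed.

Lemma cdiff_prod (I : Type) (r : seq I) (F : I -> C -> C) z :
  (forall i, cdiff (F i) z) -> cdiff (fun w => \prod_(i <- r) F i w) z.
Proof.
move=> H; elim: r => [|i r IH].
  by apply: cdiff_ext (cdiff_cst 1 z); apply: filterE => w /=; rewrite big_nil.
by apply: cdiff_ext (cdiffM (H i) IH); apply: filterE => w /=; rewrite big_cons.
Qed.

End ComplexDerivative.

(** * Comparison with topological convergence and derivatives *)

Section Bridge.
Variable R : realType.
Local Notation C := R[i].

Lemma cpos_real (e : C) : 0 < e -> exists2 r : R, 0 < r & e = r%:C.
Proof.
by case: e => a b; rewrite ltcE /= => /andP[/eqP -> a0]; exists a.
Qed.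

Lemma cvg_clim (u : nat -> C) (l : C) : (u @ \oo --> l) <-> clim \oo u l.
Proof.
split=> [/cvgrPdist_lt H e e0|H].
  have /H : 0 < e%:C :> C by rewrite ltcR.
  by apply: filterS => n /=; rewrite normcE' ltcR cdistC.
apply/(@cvgrPdist_lt C C) => e /cpos_real[r r0 ->].
by apply: filterS (H _ r0) => n /=; rewrite normcE' ltcR cdistC.
Qed.

Lemma dnbhs_cdnear (A : set C) : (0 : C)^' A <-> cdnear 0 A.
Proof.
split.
  case=> e /= /cpos_real[r r0 ->] H; exists r => // w w0; rewrite subr0 => h.
  by apply: H => //=; rewrite sub0r normrN normcE' ltcR.
case=> r r0 H; exists r%:C; first by rewrite /= ltcR.
move=> w /= h w0; apply: H => //; move: h.
by rewrite sub0r normrN normcE' ltcR subr0.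
Qed.

(** Restriction to the complex line through [a] in direction [v]; this extracts the three partial
    derivatives of a Jacobi form. *)
Lemma derivable_cderiv (V : normedModType C) (F : V -> C) (a v : V) :
  derivable F a v -> cdiff (fun t => F (t *: v + a)) 0.
Proof.
move=> /cvg_ex[l /= /(@cvgrPdist_lt C C) H]; exists l; apply/cderivP => e e0.
have e0C : 0 < e%:C :> C by rewrite ltcR.
have [r r0 Hr] := (dnbhs_cdnear _).1 (H _ e0C).
exists r => // w h /=; rewrite scale0r add0r.
have [->|w0] := eqVneq w 0.
  by rewrite scale0r add0r !subrr mulr0 subr0 cnorm0 mulr0.
have := Hr _ w0 h; rewrite /= normcE' ltcR (cdistC l) => /ltW.
rewrite !subr0 => h1.
have nw : 0 < cnorm w by rewrite cnorm_gt0.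
apply: le_trans (ler_wpM2r (ltW nw) h1); rewrite -cnormM.
rewrite mulrBl /GRing.scale/= -mulrA mulrCA mulVf// mulr1 //.
Qed.

Lemma cderiv_derive1 (h : C -> C) (z d : C) : cderiv h z d -> derive1 h z = d.
Proof.
move=> /cderivP H; rewrite derive1E /derive.
apply/cvg_lim; first exact: norm_hausdorff.
apply/(@cvgrPdist_lt C C) => e /cpos_real[r r0 ->].
have r2 : 0 < r / 2 by rewrite divr_gt0.
have [s s0 Hs] := H _ r2.
apply/dnbhs_cdnear; exists s => // w w0; rewrite subr0 => hw.
have := Hs (w + z); rewrite /= addrK => /(_ hw) h1.
rewrite normcE' ltcR cdistC /shift/= /GRing.scale/= mulr1.
have nw : 0 < cnorm w by rewrite cnorm_gt0.
rewrite -(ltr_pM2r nw) -cnormM mulrBl -mulrA mulrCA mulVf// mulr1.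
by rewrite (le_lt_trans h1)// ltr_pM2r// gtr_pMr// invf_lt1 ?ltr1n.
Qed.

End Bridge.

(** * The complex exponential *)

Section ComplexExponential.
Variable R : realType.
Local Notation C := R[i].
Local Notation Re := complex.Re.
Local Notation Im := complex.Im.

Lemma cexp0 : cexp (0 : C) = 1.
Proof. by rewrite /cexp /= expR0 cos0 sin0 mul1r. Qed.

Lemma cexpD (z w : C) : cexp (z + w) = cexp z * cexp w.
Proof.
case: z w => [a b] [c d]; rewrite /cexp/= expRD cosD sinD.
by apply: complexP; rewrite !(cReM, cImM) /=; ring.
Qed.

Lemma cnorm_cexp (z : C) : cnorm (cexp z) = expR (Re z).
Proof.
rewrite /cexp cnormM cnorm_real ger0_norm ?expR_ge0//.
by rewrite /cnorm/= cos2Dsin2 sqrtr1 mulr1.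
Qed.

Lemma cexp_neq0 (z : C) : cexp z != 0.
Proof. by rewrite -cnorm_gt0 cnorm_cexp expR_gt0. Qed.

Lemma cexpN (z : C) : cexp (- z) = (cexp z)^-1.
Proof.
apply: (mulfI (cexp_neq0 z)); rewrite -cexpD subrr cexp0 mulfV//.
exact: cexp_neq0.
Qed.

Lemma sin_le_norm (y : R) : `|sin y| <= `|y|.
Proof.
wlog y0 : y / 0 <= y.
  move=> H; have [/H//|/ltW y0] := leP 0 y.
  by rewrite -normrN -sinN -[leRHS]normrN H// oppr_ge0.
have [c _] := @MVT_segment R sin cos 0 y y0
  (fun x _ => is_derive_sin x) (continuous_subspaceT (@continuous_sin R)).
rewrite sin0 !subr0 => ->; rewrite normrM ler_piMl//.
exact: cos_max.
Qed.

Lemma onem_cos_le (y : R) : `|1 - cos y| <= 2 * `|sin (y / 2)| ^+ 2.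
Proof.
have E : y = (y / 2) *+ 2 by rewrite -mulr_natr divfK ?pnatr_eq0.
rewrite {1}E cos_mulr2n -mulr_natr cos2sin2 real_normK ?num_real//.
rewrite (_ : 1 - _ = 2 * sin (y / 2) ^+ 2); last by ring.
by rewrite ger0_norm// mulr_ge0 ?sqr_ge0.
Qed.

Lemma sin_sub_le (y : R) : `|sin y - y| <= `|y| ^+ 2.
Proof.
wlog y0 : y / 0 <= y.
  move=> H; have [/H//|/ltW y0] := leP 0 y.
  by rewrite -normrN opprD -sinN -[X in _ <= X ^+ 2]normrN H// oppr_ge0.
have D x : x \in `]0, y[ -> is_derive x 1 (fun x => sin x - x) (cos x - 1).
  by move=> _; apply: is_deriveB.
have cont : {within `[0, y], continuous (fun x : R => sin x - x)}.
  apply: continuous_subspaceT => x; apply: cvgB; [exact: continuous_sin|exact: cvg_id].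
have [c] := MVT_segment y0 D cont.
rewrite sin0 !subr0 in_itv/= => /andP[c0 cy] ->; rewrite normrM expr2 ler_wpM2r//.
rewrite distrC (le_trans (onem_cos_le _))// (ger0_norm y0).
have h1 : `|sin (c / 2)| <= 1 := sin_max _.
have h2 := sin_le_norm (c / 2); rewrite [leRHS]ger0_norm ?divr_ge0// in h2.
have h3 : `|sin (c / 2)| ^+ 2 <= `|sin (c / 2)| by rewrite expr2 ler_piMl.
by apply: le_trans cy; lra.
Qed.

Lemma expR_sub1_le (x : R) : `|expR x - 1| <= `|x| * expR `|x|.
Proof.
have h1 := expR_ge1Dx x; have h2 := expR_ge1Dx (- x).
have h3 := expR_gt0 x; have := expRxMexpNx_1 x; set e := expR (- x) in h2 *.
have [x0|x0] := leP 0 x => h4.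
  rewrite !ger0_norm//; nra.
rewrite !ltr0_norm// -/e; nra.
Qed.

Lemma expR_sub1D_le (x : R) : `|expR x - 1 - x| <= `|x| ^+ 2 * expR `|x|.
Proof.
have h1 := expR_ge1Dx x; have h2 := expR_ge1Dx (- x).
have h3 := expR_gt0 x; have := expRxMexpNx_1 x; set e := expR (- x) in h2 *.
rewrite ger0_norm; last by lra.
have [x0|x0] := leP 0 x => h4; have A : expR x - 1 <= x * expR x by nra.
  by rewrite !ger0_norm// expr2; have := ler_wpM2l x0 A; lra.
rewrite !ltr0_norm// -/e sqrrN.
have B : (- x) * (1 - expR x) <= (- x) * (- x) by apply: ler_wpM2l; lra.
have D : x ^+ 2 * 1 <= x ^+ 2 * e by apply: ler_wpM2l; [exact: sqr_ge0|lra].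
by move: D; rewrite expr2; lra.
Qed.

(** Separating real and imaginary parts leaves four error terms, each at most [r ^+ 2 * expR r]
    where [r] is the modulus of [w]; the constant 5 has some slack. The bound is global in [w], so
    it also controls termwise differentiation of exponential series. *)
Lemma cexp_sub1D_le (w : C) :
  cnorm (cexp w - 1 - w) <= 5 * cnorm w ^+ 2 * expR (cnorm w).
Proof.
have hx := cnorm_Re w; have hy := cnorm_Im w.
move: (cnorm w) hx hy => r; case: w => x y /= hx hy.
have r0 : 0 <= r by apply: le_trans hx.
have er : expR `|x| <= expR r by rewrite ler_expR.
have ex : expR x <= expR r by rewrite ler_expR (le_trans (ler_norm _)).
have ex0 := expR_gt0 x; have er0 := expR_gt0 r.
have y2 : `|y| ^+ 2 <= r ^+ 2 by rewrite lerXn2r ?nnegrE.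
have x2 : `|x| ^+ 2 <= r ^+ 2 by rewrite lerXn2r ?nnegrE.
apply: le_trans (cnorm_le _) _; rewrite /cexp/=.
have -> : expR x * cos y - 0 * sin y - 1 - x =
  expR x * (cos y - 1) + (expR x - 1 - x) by ring.
have -> : expR x * sin y + 0 * cos y - 0 - y =
  expR x * (sin y - y) + (expR x - 1) * y by ring.
have A1 : `|expR x * (cos y - 1)| <= expR r * r ^+ 2.
  rewrite normrM (ger0_norm (ltW ex0)) ler_pM ?(ltW ex0)//.
  rewrite distrC (le_trans (onem_cos_le _))//.
  have s1 := sin_le_norm (y / 2); rewrite normrM (ger0_norm (_ : 0 <= 2^-1)) in s1; last by [].
  have s0 := normr_ge0 (sin (y / 2)); have n0 := normr_ge0 y; nra.
have A2 : `|expR x - 1 - x| <= r ^+ 2 * expR r.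
  rewrite (le_trans (expR_sub1D_le _))// ler_pM ?sqr_ge0// expR_ge0//.
have A3 : `|expR x * (sin y - y)| <= expR r * r ^+ 2.
  by rewrite normrM (ger0_norm (ltW ex0)) ler_pM ?(ltW ex0)// (le_trans (sin_sub_le _)).
have A4 : `|(expR x - 1) * y| <= r * expR r * r.
  by rewrite normrM ler_pM// (le_trans (expR_sub1_le _))// ler_pM// expR_ge0.
have := ler_normD (expR x * (cos y - 1)) (expR x - 1 - x).
have := ler_normD (expR x * (sin y - y)) ((expR x - 1) * y).
have : 0 <= r ^+ 2 * expR r by rewrite mulr_ge0 ?sqr_ge0// ltW.
move: A1 A2 A3 A4; set E := expR r.
have -> : r * E * r = r ^+ 2 * E by ring.
have -> : E * r ^+ 2 = r ^+ 2 * E by ring.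
have -> : 5 * r ^+ 2 * E = 5 * (r ^+ 2 * E) by ring.
lra.
Qed.

Lemma cderiv_cexp (z : C) : cderiv (@cexp R) z (cexp z).
Proof.
apply/cderivP => e e0.
have K0 : 0 < cnorm (cexp z) * (5 * expR 1).
  by rewrite mulr_gt0 ?mulr_gt0 ?expR_gt0// cnorm_cexp expR_gt0.
exists (Num.min 1 (e / (cnorm (cexp z) * (5 * expR 1)))).
  by rewrite lt_min ltr01 divr_gt0.
move=> w; rewrite lt_min => /andP[/ltW k1 /ltW]; rewrite ler_pdivlMr//= => k2.
set k := w - z in k1 k2 *; have -> : w = z + k by rewrite /k addrC subrK.
rewrite cexpD (_ : _ - _ - _ = cexp z * (cexp k - 1 - k)); last by ring.
rewrite cnormM.
have h1 := cexp_sub1D_le k.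
have h2 : expR (cnorm k) <= expR 1 by rewrite ler_expR.
have h3 := cnorm_ge0 k; have h4 := cnorm_ge0 (cexp z).
apply: le_trans (ler_wpM2l h4 h1) _.
apply: le_trans (ler_wpM2r h3 k2).
have : 5 * cnorm k ^+ 2 * expR (cnorm k) <= 5 * cnorm k ^+ 2 * expR 1.
  by rewrite ler_wpM2l// mulr_ge0// sqr_ge0.
move=> /(ler_wpM2l h4) h5; apply: le_trans h5 _.
by rewrite le_eqVlt; apply/orP; left; apply/eqP; ring.
Qed.

Definition tpi : C := 2 * (pi : R)%:C * 'i.

Lemma eeE (x : C) : ee x = cexp (tpi * x). Proof. by []. Qed.
Lemma eeD (x y : C) : ee (x + y) = ee x * ee y.
Proof. by rewrite !eeE mulrDr cexpD. Qed.
Lemma ee0 : ee (0 : C) = 1. Proof. by rewrite eeE mulr0 cexp0. Qed.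
Lemma ee_neq0 (x : C) : ee x != 0. Proof. exact: cexp_neq0. Qed.
Lemma eeN (x : C) : ee (- x) = (ee x)^-1. Proof. by rewrite !eeE mulrN cexpN. Qed.
Lemma eeB (x y : C) : ee (x - y) = ee x / ee y. Proof. by rewrite eeD eeN. Qed.
Lemma eeMn (x : C) n : ee (n%:R * x) = ee x ^+ n.
Proof.
elim: n => [|n IH]; first by rewrite mul0r ee0.
by rewrite -natr1 mulrDl mul1r eeD IH exprSr.
Qed.
Lemma eeMz (x : C) (n : int) : ee (n%:~R * x) = ee x ^ n.
Proof.
case: n => n; first exact: eeMn.
by rewrite NegzE mulrNz mulNr eeN -exprnN eeMn.
Qed.
Lemma tpiE : tpi = 0 +i* (2 * pi).
Proof. by apply: complexP; rewrite /tpi !(cReM, cImM)/=; ring. Qed.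
Lemma ee1 : ee (1 : C) = 1.
Proof.
rewrite eeE mulr1 tpiE /cexp /= expR0 mul1r.
by rewrite -[2 * pi]mulrC mulr_natr cos2pi sin2pi.
Qed.
Lemma ee_half : ee (2^-1 : C) = -1.
Proof.
rewrite eeE tpiE; have -> : (0 +i* (2 * pi)) * 2^-1 = 0 +i* (pi : R) :> C.
  apply: (mulIf (_ : 2 != 0 :> C)); first by rewrite pnatr_eq0.
  by rewrite divfK ?pnatr_eq0//; apply: complexP; rewrite !(cReM, cImM)/=; ring.
by rewrite /cexp /= expR0 mul1r cospi sinpi; apply: complexP => /=; rewrite ?oppr0.
Qed.
Lemma ee_nat n : ee (n%:R : C) = 1.
Proof. by rewrite -[n%:R]mulr1 eeMn ee1 expr1n. Qed.
Lemma ee_int (n : int) : ee (n%:~R : C) = 1.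
Proof. by rewrite -[n%:~R]mulr1 eeMz ee1 exp1rz. Qed.
Lemma tpi_neq0 : tpi != 0.
Proof. by rewrite tpiE eq_complex/= negb_and mulf_neq0 ?orbT ?pnatr_eq0// gt_eqF ?pi_gt0. Qed.
Lemma cnorm_tpi : cnorm tpi = 2 * pi.
Proof. by rewrite tpiE /cnorm/= expr0n/= add0r sqrtr_sqr ger0_norm// mulr_ge0// pi_ge0. Qed.
Lemma cnorm_ee (x : C) : cnorm (ee x) = expR (- (2 * pi * Im x)).
Proof. by rewrite eeE cnorm_cexp tpiE cReM/= mul0r sub0r. Qed.

Lemma cderiv_ee_affine (a b z : C) :
  cderiv (fun w => ee (a * w + b)) z (tpi * a * ee (a * z + b)).
Proof.
apply: cderiv_eq.
  apply: cderiv_ext (cderiv_comp (cderiv_cexp _) (cderiv_affine (tpi * a) (tpi * b) z)).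
  by apply: filterE => w /=; rewrite eeE; congr cexp; ring.
by rewrite eeE mulrC; congr (_ * cexp _); ring.
Qed.

Lemma cdiff_ee (z : C) : cdiff (@ee R) z.
Proof.
apply: cdiff_ext (ex_intro _ _ (cderiv_ee_affine 1 0 z)).
by apply: filterE => w /=; rewrite mul1r addr0.
Qed.

End ComplexExponential.

(** * Complex-valued functions of a real variable and their integrals *)

Section RealVariable.
Variable R : realType.
Local Notation C := R[i].
Local Notation Re := complex.Re.
Local Notation Im := complex.Im.
Implicit Types (p F : R -> C) (x y : R).

Definition rderiv F x (d : C) : Prop := forall e : R, 0 < e ->
  rnear x [set y | cnorm (F y - F x - d * (y - x)%:C) <= e * `|y - x|].

Lemma dnbhs_rnear (A : set R) : (0 : R)^' A <-> rnear 0 [set y | y != 0 -> A y].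
Proof.
split.
  case=> e /= e0 H; exists e => // w; rewrite subr0 => h w0.
  by apply: H => //=; rewrite sub0r normrN.
case=> r r0 H; exists r => //= w /=; rewrite sub0r normrN => h w0.
by apply: H => //; rewrite subr0.
Qed.

Lemma is_derive_rderiv (G : R -> R) x (g : R) :
  is_derive x 1 G g -> rderiv (fun t => (G t)%:C) x g%:C.
Proof.
case=> dG <- e e0; move/cvgrPdist_lt : dG => /(_ _ e0) /dnbhs_rnear [d d0 H].
exists d => // y yx /=; rewrite -!rmorphB -rmorphM -rmorphB cnorm_real.
have [->|h0] := eqVneq y x; first by rewrite !subrr mulr0 subr0 normr0 mulr0.
have yx0 : y - x != 0 by rewrite subr_eq0.
have := H (y - x); rewrite /= subr0 => /(_ yx yx0) /ltW h.
have {}h : `|'D_1 G x - (y - x)^-1 * (G y - G x)| <= e.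
  by move: h; rewrite /shift/= /GRing.scale/= mulr1 subrK.
rewrite (_ : G y - G x - _ = - (('D_1 G x - (y - x)^-1 * (G y - G x)) * (y - x))).
  by rewrite normrN normrM ler_wpM2r.
by move: ('D_1 G x) => D; field.
Qed.

Lemma rderiv_is_derive F x (d c : C) :
  rderiv F x d -> is_derive x 1 (fun t => Re (c * F t)) (Re (c * d)).
Proof.
move=> H.
suff lim : h^-1 *: (((fun t => Re (c * F t)) \o shift x) (h *: (1 : R)) - Re (c * F x))
    @[h --> (0 : R)^'] --> Re (c * d).
  apply: DeriveDef; first by apply/cvg_ex; exists (Re (c * d)).
  by apply/cvg_lim => //; exact: Rhausdorff.
apply/cvgrPdist_le => e e0.
have c0 : 0 < cnorm c + 1 by rewrite ltr_wpDl ?cnorm_ge0.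
have e1 : 0 < e / (cnorm c + 1) by rewrite divr_gt0.
have [r r0 Hr] := H _ e1.
apply/dnbhs_rnear; exists r => // h hr h0 /=; rewrite subr0 in hr.
have := Hr (h + x); rewrite addrK => /(_ hr) /= {}Hr.
rewrite /shift/= /GRing.scale/= mulr1.
have h0' : 0 < `|h| by rewrite normr_gt0.
rewrite -(ler_pM2r h0') -normrM mulrBl mulrAC mulVf// mul1r distrC.
have -> : Re (c * F (h + x)) - Re (c * F x) - Re (c * d) * h =
    Re (c * (F (h + x) - F x - d * h%:C)).
  by rewrite !(cReM, cReD, cImM, cImD, cReN, cImN)/=; ring.
rewrite addrK in Hr; apply: (le_trans (cnorm_Re _)); rewrite cnormM.
apply: (le_trans (ler_wpM2l (cnorm_ge0 _) Hr)).
rewrite mulrA ler_wpM2r// mulrCA ger_pMr// ler_pdivrMr// mul1r.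
by rewrite lerDl.
Qed.

Lemma rderiv_MVI F p (a b M : R) : a <= b ->
  (forall x, a <= x <= b -> rderiv F x (p x)) ->
  (forall x, a <= x <= b -> cnorm (p x) <= M) ->
  cnorm (F b - F a) <= M * (b - a).
Proof.
move=> ab DF pM; set w := F b - F a.
have [w0|w0] := eqVneq w 0.
  rewrite w0 cnorm0 mulr_ge0 ?subr_ge0// (le_trans (cnorm_ge0 (p a)))// pM//.
  by rewrite lexx.
pose c : C := (cnorm w)%:C / w.
have cw : c * w = (cnorm w)%:C by rewrite /c divfK.
have nw : 0 < cnorm w by rewrite cnorm_gt0.
have c1 : cnorm c = 1.
  by rewrite cnormM cnormV cnorm_real ger0_norm ?(ltW nw)// mulfV ?gt_eqF.
have D x : a <= x <= b -> is_derive x 1 (fun t => Re (c * F t)) (Re (c * p x)).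
  by move=> /DF; exact: rderiv_is_derive.
have cont : {within `[a, b], continuous (fun t => Re (c * F t))}.
  apply: derivable_within_continuous => x; by rewrite in_itv/= => /D[].
have [xi] := @MVT_segment _ _ (fun x => Re (c * p x)) _ _ ab
  (fun x xab => D x (subset_itv_oo_cc xab)) cont.
rewrite in_itv/= => xiab.
have -> : Re (c * F b) - Re (c * F a) = cnorm w.
  rewrite -cReN -cReD -mulrBr -/w cw //.
move=> ->; rewrite ler_wpM2r ?subr_ge0// (le_trans (ler_norm _))//.
by rewrite (le_trans (cnorm_Re _))// cnormM c1 mul1r pM.
Qed.

Lemma rderiv0_cst F x y : (forall t, rderiv F t 0) -> F x = F y.
Proof.
wlog xy : x y / x <= y.
  by move=> H D; have [/H->//|/ltW/H->] := leP x y.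
move=> D; have := @rderiv_MVI F (fun=> 0) x y 0 xy (fun t _ => D t).
rewrite cnorm0 mul0r => /(_ (fun _ _ => lexx 0)) h.
have : cnorm (F y - F x) == 0 by rewrite eq_le h cnorm_ge0.
by rewrite cnorm_eq0 subr_eq0 => /eqP.
Qed.

Lemma rderivD F G x d d' : rderiv F x d -> rderiv G x d' ->
  rderiv (fun t => F t + G t) x (d + d').
Proof.
move=> HF HG e e0; have e2 : 0 < e / 2 by rewrite divr_gt0.
apply: filterS2 (HF _ e2) (HG _ e2) => y /= h1 h2.
rewrite (_ : _ - _ - _ = (F y - F x - d * (y - x)%:C) +
  (G y - G x - d' * (y - x)%:C)); last by ring.
by rewrite (le_trans (cnormD _ _))// [e]splitr mulrDl lerD.
Qed.

Lemma rderivZ F x d (c : C) : rderiv F x d -> rderiv (fun t => c * F t) x (c * d).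
Proof.
move=> HF e e0; have c0 : 0 < cnorm c + 1 by rewrite ltr_wpDl ?cnorm_ge0.
have e1 : 0 < e / (cnorm c + 1) by rewrite divr_gt0.
apply: filterS (HF _ e1) => y /= h1.
rewrite (_ : _ - _ - _ = c * (F y - F x - d * (y - x)%:C)); last by ring.
rewrite cnormM (le_trans (ler_wpM2l (cnorm_ge0 _) h1))//.
rewrite mulrA ler_wpM2r// mulrCA ger_pMr// ler_pdivrMr// mul1r.
by rewrite lerDl.
Qed.

Lemma rderiv_ext F G x d : rnear x [set y | F y = G y] -> rderiv F x d -> rderiv G x d.
Proof.
move=> [r r0 E] H e /H; have Ex : F x = G x by apply: E; rewrite subrr normr0.
rewrite -Ex; move: (ex_intro2 _ _ r r0 E : rnear _ _); apply: filterS2.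
by move=> y /= ->.
Qed.

Lemma rcont_real p x : rcont p x -> {for x, continuous (fun t => Re (p t))} /\
  {for x, continuous (fun t => Im (p t))}.
Proof.
move=> H; split; apply/cvgrPdist_lt => e e0; have [d d0 Hd] := H _ e0;
  exists d => //= y /=; rewrite distrC => /Hd /= h; rewrite distrC.
  by rewrite -cReN -cReD (le_lt_trans (cnorm_Re _)).
by rewrite -cImN -cImD (le_lt_trans (cnorm_Im _)).
Qed.

Lemma local_primitive (G : R -> R) (B : R) : continuous G ->
  exists F : R -> R, forall x, `|x| < B -> is_derive x 1 F (G x).
Proof.
move=> cG.
exists (fun x => \int[lebesgue_measure]_(t in [set` `[(- B), x]]) (G t)) => x.
rewrite ltr_norml => /andP[Bx xB].
have int : lebesgue_measure.-integrable `[(- B), B] (EFin \o G).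
  apply: continuous_compact_integrable; first exact: segment_compact.
  exact: continuous_subspaceT.
have [D1 D2] := continuous_FTC1_closed xB int Bx (cG x).
by split; [exact: D1|rewrite -D2 derive1E].
Qed.

Definition primitive p F := forall x, rderiv F x (p x).

(** Primitives on the intervals [|x| < n + 1] differ by constants; normalised to vanish at 0 they
    agree on overlaps and glue to a primitive on the line. *)
Lemma exists_primitive p : (forall x, rcont p x) -> exists F, primitive p F.
Proof.
move=> cp.
have loc (n : nat) : exists F : R -> C, forall x, `|x| < n.+1%:R -> rderiv F x (p x).
  have [F1 H1] := local_primitive n.+1%:R (fun x => (rcont_real (cp x)).1).
  have [F2 H2] := local_primitive n.+1%:R (fun x => (rcont_real (cp x)).2).
  exists (fun x => (F1 x)%:C + 'i * (F2 x)%:C) => x xn.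
  have -> : p x = (Re (p x))%:C + 'i * (Im (p x))%:C.
    by case: (p x) => a b; apply: complexP; rewrite !(cReM, cImM, cReD, cImD)/=; ring.
  apply: rderivD; first exact: is_derive_rderiv (H1 _ xn).
  by apply: rderivZ; exact: is_derive_rderiv (H2 _ xn).
pose G n := sval (cid (loc n)).
have HG n x : `|x| < n.+1%:R -> rderiv (G n) x (p x) by exact: (svalP (cid (loc n))).
have agree m n x : `|x| < m.+1%:R -> `|x| < n.+1%:R -> G m x - G m 0 = G n x - G n 0.
  move=> xm xn; pose D t := G m t + (-1) * G n t.
  have DD t : `|t| <= `|x| -> rderiv D t 0.
    move=> tx; rewrite (_ : 0 = p t + (-1) * p t); last by ring.
    by apply: rderivD; [|apply: rderivZ]; apply: HG; exact: le_lt_trans tx _.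
  have D0 a b : a <= b -> `|a| <= `|x| -> `|b| <= `|x| -> D a = D b.
    move=> ab ax bx; have := @rderiv_MVI D (fun=> 0) a b 0 ab.
    rewrite cnorm0 mul0r => h.
    have : cnorm (D b - D a) <= 0.
      apply: h => // t /andP[at' tb]; apply: DD.
      by move: ax bx; rewrite !ler_norml => /andP[? _] /andP[_ ?]; lra.
    by rewrite le_eqVlt ltNge cnorm_ge0 orbF cnorm_eq0 subr_eq0 => /eqP.
  have E : D x = D 0.
    have [x0|/ltW x0] := leP 0 x; first by rewrite (D0 0 x)// normr0.
    by rewrite (D0 x 0)// normr0.
  apply/eqP; rewrite -subr_eq0; apply/eqP.
  rewrite (_ : _ - _ = D x - D 0); last by rewrite /D; ring.
  by rewrite E subrr.
pose nn x := Num.truncn `|x|.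
have nnP x : `|x| < (nn x).+1%:R by rewrite /nn truncnS_gt.
exists (fun x => G (nn x) x - G (nn x) 0) => x.
(* One unit of room puts a whole neighbourhood of [x] inside a single interval. *)
have [n xn] : exists n : nat, `|x| + 1 < n.+1%:R.
  by exists (Num.truncn (`|x| + 1)); rewrite truncnS_gt.
have xn' : `|x| < n.+1%:R by rewrite (le_lt_trans _ xn)// lerDl.
apply: (@rderiv_ext (fun y => G n y + (-1) * G n 0)).
  exists 1 => // y yx /=; rewrite mulN1r; apply: agree (nnP _).
  rewrite (le_lt_trans _ xn)// -[y](subrK x) addrC (le_trans (ler_normD _ _))// lerD2l.
  exact: ltW.
rewrite -[p x]addr0; apply: rderivD; first exact: HG.
by move=> e e0; apply: filterE => y /=; rewrite subrr mul0r subr0 cnorm0 mulr_ge0// ltW.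
Qed.

(** The integral is the increment of a primitive, with default value 0 if there is none. Linearity,
    translation and estimates then reduce to rules for derivatives. *)
Definition cint p (a b : R) : C :=
  match pselect (exists F, primitive p F) with
  | left h => sval (cid h) b - sval (cid h) a
  | right _ => 0
  end.

Lemma primitive_diff p F G x y : primitive p F -> primitive p G ->
  F y - F x = G y - G x.
Proof.
move=> HF HG; have := @rderiv0_cst (fun t => F t + (-1) * G t) x y.
have D t : rderiv (fun t => F t + -1 * G t) t 0.
  rewrite (_ : 0 = p t + (-1) * p t); last by ring.
  by apply: rderivD; [|apply: rderivZ].
move=> /(_ D) E; apply/eqP; rewrite -subr_eq0; apply/eqP.
transitivity ((F y + -1 * G y) - (F x + -1 * G x)); first by ring.
by rewrite E subrr.
Qed.

Lemma cintE p F a b : primitive p F -> cint p a b = F b - F a.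
Proof.
move=> H; rewrite /cint; case: pselect => [h|]; last by case; exists F.
exact: primitive_diff (svalP (cid h)) H.
Qed.

Lemma cint_cat p a b c : cint p a b + cint p b c = cint p a c.
Proof. by rewrite /cint; case: pselect => [h|_]; rewrite ?addr0//; ring. Qed.

Lemma cintD p1 p2 a b : (forall x, rcont p1 x) -> (forall x, rcont p2 x) ->
  cint (fun x => p1 x + p2 x) a b = cint p1 a b + cint p2 a b.
Proof.
move=> /exists_primitive[F HF] /exists_primitive[G HG].
rewrite (cintE _ _ HF) (cintE _ _ HG) (@cintE _ (fun x => F x + G x)); first by ring.
by move=> x; apply: rderivD.
Qed.

Lemma cintZ p c a b : (forall x, rcont p x) ->
  cint (fun x => c * p x) a b = c * cint p a b.
Proof.
move=> /exists_primitive[F HF].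
rewrite (cintE _ _ HF) (@cintE _ (fun x => c * F x)); first by ring.
by move=> x; apply: rderivZ.
Qed.

Lemma cint_shift p (s a b : R) : (forall x, rcont p x) ->
  cint (fun x => p (x + s)) a b = cint p (a + s) (b + s).
Proof.
move=> /exists_primitive[F HF].
rewrite (cintE _ _ HF) (@cintE _ (fun x => F (x + s)))// => x e /(HF (x + s)).
case=> d d0 H; exists d => // y yx /=; have E : y + s - (x + s) = y - x by ring.
by have := H (y + s); rewrite /= E; apply.
Qed.

Lemma cint_le p (a b M : R) : a <= b -> (forall x, rcont p x) ->
  (forall x, a <= x <= b -> cnorm (p x) <= M) -> cnorm (cint p a b) <= M * (b - a).
Proof.
move=> ab /exists_primitive[F HF] pM; rewrite (cintE _ _ HF).
exact: rderiv_MVI (fun x _ => HF x) pM.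
Qed.

Lemma cint_sum (I : Type) (r : seq I) (p : I -> R -> C) a b :
  (forall i x, rcont (p i) x) ->
  cint (fun x => \sum_(i <- r) p i x) a b = \sum_(i <- r) cint (p i) a b.
Proof.
move=> H; have cs s x : rcont (fun x => \sum_(i <- s) p i x) x.
  by apply: clim_sum => i; exact: H.
elim: r => [|i r IH].
  rewrite big_nil (@cintE _ (fun=> 0)) ?subrr// => x e e0; apply: filterE => y /=.
  by rewrite big_nil mul0r !subr0 cnorm0 mulr_ge0// ltW.
rewrite big_cons -IH -cintD//; congr cint; apply/funext => x.
by rewrite big_cons.
Qed.

Lemma cint_per p s : (forall x, rcont p x) -> (forall x, p (x + 1) = p x) ->
  cint (fun x => p (x + s)) 0 1 = cint p 0 1.
Proof.
move=> cp pp; rewrite cint_shift// add0r.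
have E : cint p 1 (1 + s) = cint p 0 s.
  have := cint_shift 1 0 s cp; rewrite add0r [s + 1]addrC => <-.
  by congr cint; apply/funext => x; rewrite pp.
have := cint_cat p 0 s (1 + s); rewrite -(cint_cat p 0 1 (1 + s)) E addrC.
by move=> /addIr.
Qed.

End RealVariable.

(** * Bisection of intervals and rectangles *)

Section Bisection.
Variable R : realType.

Lemma nested_segments (x : nat -> R) (s : R) :
  (forall n, x n <= x n.+1) ->
  (forall n, x n.+1 + s / 2 ^+ n.+1 <= x n + s / 2 ^+ n) -> 0 <= s ->
  exists l, forall n, x n <= l <= x n + s / 2 ^+ n.
Proof.
move=> inc dec s0.
have mono m n : (m <= n)%N -> x m <= x n.
  move=> /subnK <-; elim: (n - m)%N => [//|k IH].
  by rewrite addSn (le_trans IH).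
have mono' m n : (m <= n)%N -> x n + s / 2 ^+ n <= x m + s / 2 ^+ m.
  move=> /subnK <-; elim: (n - m)%N => [//|k IH].
  by rewrite addSn (le_trans _ IH).
have bd m n : x m <= x n + s / 2 ^+ n.
  have [mn|/ltnW nm] := leqP m n.
    by rewrite (le_trans (mono _ _ mn))// lerDl divr_ge0// exprn_ge0.
  by rewrite (le_trans _ (mono' _ _ nm))// lerDl divr_ge0// exprn_ge0.
exists (sup (range x)) => n; apply/andP; split.
  apply: ub_le_sup; last by exists n.
  by exists (x 0%N + s / 2 ^+ 0) => _ [m _ <-].
by apply: ge_sup; [exists (x 0%N); exists 0%N|move=> _ [m _ <-]].
Qed.

Lemma exists_small_half (s d : R) : 0 < d -> exists n, s / 2 ^+ n < d.
Proof.
move=> d0; exists (Num.truncn (s / d)).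
rewrite ltr_pdivrMr ?exprn_gt0// mulrC -ltr_pdivrMr//.
apply: (lt_le_trans (truncnS_gt _)).
by rewrite -natrX ler_nat ltn_expl.
Qed.

(** [P a c s t] is read as a property of the rectangle with lower left corner (a, c) and sides s, t.
    If it failed, some quarter would fail at every stage, and the nested bad rectangles would shrink
    to a point around which small rectangles satisfy [P]. *)
Lemma bisection (P : R -> R -> R -> R -> Prop) :
  (forall a c s t, P a c (s / 2) (t / 2) -> P (a + s / 2) c (s / 2) (t / 2) ->
     P a (c + t / 2) (s / 2) (t / 2) ->
     P (a + s / 2) (c + t / 2) (s / 2) (t / 2) -> P a c s t) ->
  (forall x y, exists2 d : R, 0 < d & forall a c s t,
     a <= x <= a + s -> c <= y <= c + t -> s < d -> t < d -> P a c s t) ->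
  forall a c s t, 0 <= s -> 0 <= t -> P a c s t.
Proof.
move=> H1 H2 A C S T S0 T0; apply: contrapT => NP.
(* The two booleans select one of the four quarters by its corner. *)
pose q n (p : R * R) (e : bool * bool) : R * R :=
  (p.1 + e.1%:R * (S / 2 ^+ n / 2), p.2 + e.2%:R * (T / 2 ^+ n / 2)).
pose bad n (p : R * R) := ~ P p.1 p.2 (S / 2 ^+ n) (T / 2 ^+ n).
have step n p : exists e, bad n p -> bad n.+1 (q n p e).
  have [b|] := pselect (bad n p); last by exists (false, false).
  have E U : U / 2 ^+ n.+1 = U / 2 ^+ n / 2 :> R by rewrite exprSr invfM mulrA.
  apply: contrapT => /forallNP H; apply: b.
  have K e : P (q n p e).1 (q n p e).2 (S / 2 ^+ n / 2) (T / 2 ^+ n / 2).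
    by apply: contrapT => h; apply: (H e) => _; rewrite /bad !E.
  have := K (false, false); have := K (true, false); have := K (false, true).
  have := K (true, true); rewrite /q/= !mul1r !mul0r !addr0 => k1 k2 k3 k4.
  exact: H1.
pose e n p := sval (cid (step n p)).
pose u := fix u n := if n is m.+1 then q m (u m) (e m (u m)) else (A, C).
have ub n : bad n (u n).
  elim: n => [|n IH]; first by rewrite /bad/= !expr0 !divr1.
  exact: (svalP (cid (step n (u n)))).
have half n U (b : bool) x : 0 <= U -> x <= x + b%:R * (U / 2 ^+ n / 2) :> R.
  by move=> U0; rewrite lerDl mulr_ge0// !divr_ge0// exprn_ge0.
have half' n U (b : bool) x : 0 <= U ->
    x + b%:R * (U / 2 ^+ n / 2) + U / 2 ^+ n.+1 <= x + U / 2 ^+ n :> R.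
  move=> U0; have -> : U / 2 ^+ n.+1 = U / 2 ^+ n / 2 by rewrite exprSr invfM mulrA.
  set h := U / 2 ^+ n.
  have : 0 <= h by rewrite divr_ge0// exprn_ge0.
  by case: b; rewrite /= ?mul1r ?mul0r ?mulr1n ?mulr0n; lra.
have [x Hx] := @nested_segments (fun n => (u n).1) S
  (fun n => half n S _ _ S0) (fun n => half' n S _ _ S0) S0.
have [y Hy] := @nested_segments (fun n => (u n).2) T
  (fun n => half n T _ _ T0) (fun n => half' n T _ _ T0) T0.
have [d d0 Hd] := H2 x y.
have [m hm] := exists_small_half (S + T) d0.
have [Sm Tm] : S / 2 ^+ m < d /\ T / 2 ^+ m < d.
  by split; apply: le_lt_trans hm; rewrite ler_wpM2r ?invr_ge0 ?exprn_ge0// ?lerDl ?lerDr.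
by apply: (ub m); apply: Hd.
Qed.

Lemma bisection1 (P : R -> R -> Prop) :
  (forall a s, P a (s / 2) -> P (a + s / 2) (s / 2) -> P a s) ->
  (forall x, exists2 d : R, 0 < d & forall a s, a <= x <= a + s -> s < d -> P a s) ->
  forall a s, 0 <= s -> P a s.
Proof.
move=> H1 H2 a s s0; apply: (@bisection (fun a _ s _ => P a s) _ _ a 0 s 0) => //.
  by move=> a' _ s' _ h1 h2 _ _; exact: H1.
by move=> x y; have [d d0 Hd] := H2 x; exists d => // a' c' s' t' h _ h' _; exact: Hd.
Qed.

End Bisection.

(** * Goursat's theorem on rectangles *)

Section Goursat.
Variable R : realType.
Local Notation C := R[i].
Local Notation Re := complex.Re.
Local Notation Im := complex.Im.
Implicit Types (h : C -> C) (z : C).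

Lemma rcont_line h (x y : R) : ccont h (x +i* y) ->
  rcont (fun t => h (t +i* y)) x /\ rcont (fun t => h (x +i* t)) y.
Proof.
move=> H; split => e /H[d d0 Hd]; exists d => // t tx; apply: Hd.
  by rewrite (_ : _ - _ = (t - x)%:C) ?cnorm_real//; apply: complexP => /=; rewrite ?subrr.
rewrite (_ : _ - _ = 'i * (t - y)%:C) ?cnormM ?cnorm_i ?mul1r ?cnorm_real//.
by apply: complexP; rewrite !(cReM, cImM)/=; ring.
Qed.

Lemma cderiv_line h (x y : R) (d : C) : cderiv h (x +i* y) d ->
  rderiv (fun t => h (t +i* y)) x d /\ rderiv (fun t => h (x +i* t)) y ('i * d).
Proof.
move=> /cderivP H; split => e /H[r r0 Hr]; exists r => // t tx.
  have E : (t +i* y) - (x +i* y) = (t - x)%:C by apply: complexP => /=; rewrite ?subrr.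
  by have := Hr (t +i* y); rewrite /= E cnorm_real; apply.
have E : (x +i* t) - (x +i* y) = 'i * (t - y)%:C.
  by apply: complexP; rewrite !(cReM, cImM)/=; ring.
have := Hr (x +i* t); rewrite /= E cnormM cnorm_i mul1r cnorm_real => /(_ tx).
by rewrite mulrCA mulrA.
Qed.

(** The counterclockwise contour integral of h dz; the factor ['i] is dz = i dy on the vertical
    sides. *)
Definition bdint h (a c s t : R) : C :=
  cint (fun x => h (x +i* c)) a (a + s) - cint (fun x => h (x +i* (c + t))) a (a + s)
  + 'i * (cint (fun y => h ((a + s) +i* y)) c (c + t)
          - cint (fun y => h (a +i* y)) c (c + t)).

Lemma bdint_exact h H (a c s t : R) :
  (forall z, cderiv H z (h z)) -> bdint h a c s t = 0.
Proof.
move=> D.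
have hor y : primitive (fun x => h (x +i* y)) (fun x => H (x +i* y)).
  by move=> x; case: (cderiv_line (D (x +i* y))).
have ver x : primitive (fun y => h (x +i* y)) (fun y => - 'i * H (x +i* y)).
  move=> y; have [_ /(rderivZ (- 'i))] := cderiv_line (D (x +i* y)).
  by rewrite mulrA mulNr -expr2 sqr_i opprK mul1r.
rewrite /bdint !(cintE _ _ (hor _)) !(cintE _ _ (ver _)).
rewrite -!mulrBr !mulrA mulrN -expr2 sqr_i opprK !mul1r; ring.
Qed.

Lemma bdintD h1 h2 (a c s t : R) : (forall z, ccont h1 z) -> (forall z, ccont h2 z) ->
  bdint (fun z => h1 z + h2 z) a c s t = bdint h1 a c s t + bdint h2 a c s t.
Proof.
move=> c1 c2; rewrite /bdint !cintD; try (by move=> x;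
  first [exact: (rcont_line (c1 _)).1|exact: (rcont_line (c1 _)).2
        |exact: (rcont_line (c2 _)).1|exact: (rcont_line (c2 _)).2]).
ring.
Qed.

Lemma bdint_le h (a c s t M : R) : 0 <= s -> 0 <= t -> (forall z, ccont h z) ->
  (forall x y, a <= x <= a + s -> c <= y <= c + t -> cnorm (h (x +i* y)) <= M) ->
  cnorm (bdint h a c s t) <= 2 * M * (s + t).
Proof.
move=> s0 t0 ch hM.
have hor y : c <= y <= c + t -> cnorm (cint (fun x => h (x +i* y)) a (a + s)) <= M * s.
  move=> yt; have := @cint_le _ (fun x => h (x +i* y)) a (a + s) M.
  rewrite addrAC subrr add0r; apply; first by rewrite lerDl.
    by move=> x; exact: (rcont_line (ch _)).1.
  by move=> x ?; apply: hM.
have ver x : a <= x <= a + s -> cnorm (cint (fun y => h (x +i* y)) c (c + t)) <= M * t.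
  move=> xs; have := @cint_le _ (fun y => h (x +i* y)) c (c + t) M.
  rewrite addrAC subrr add0r; apply; first by rewrite lerDl.
    by move=> y; exact: (rcont_line (ch _)).2.
  by move=> y ?; apply: hM.
have h1 := hor c; have h2 := hor (c + t); have v1 := ver a; have v2 := ver (a + s).
rewrite lexx lerDl t0 in h1; rewrite lexx lerDl t0 in h2.
rewrite lexx lerDl s0 in v1; rewrite lexx lerDl s0 in v2.
rewrite /bdint; apply: le_trans (cnormD _ _) _; rewrite cnormM cnorm_i mul1r.
have := cnormB (cint (fun x => h (x +i* c)) a (a + s))
  (cint (fun x => h (x +i* (c + t))) a (a + s)).
have := cnormB (cint (fun y => h ((a + s) +i* y)) c (c + t))
  (cint (fun y => h (a +i* y)) c (c + t)).
have := h1 isT; have := h2 isT; have := v1 isT; have := v2 isT.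
lra.
Qed.

Lemma bdint_split h (a c s t : R) : bdint h a c s t =
  bdint h a c (s / 2) (t / 2) + bdint h (a + s / 2) c (s / 2) (t / 2) +
  bdint h a (c + t / 2) (s / 2) (t / 2) +
  bdint h (a + s / 2) (c + t / 2) (s / 2) (t / 2).
Proof.
have E (u v : R) : u + v / 2 + v / 2 = u + v by field.
rewrite /bdint !E.
rewrite -(cint_cat (fun x => h (x +i* c)) a (a + s / 2) (a + s)).
rewrite -(cint_cat (fun x => h (x +i* (c + t))) a (a + s / 2) (a + s)).
rewrite -(cint_cat (fun y => h ((a + s) +i* y)) c (c + t / 2) (c + t)).
rewrite -(cint_cat (fun y => h (a +i* y)) c (c + t / 2) (c + t)).
ring.
Qed.

(** Continuity is global but differentiability is relative to the closed rectangle; this form fits a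
    function holomorphic on a half-plane and extended continuously from a strip. The bound
    [e * (s + t) ^+ 2] is additive over quarters, and on a small rectangle it follows by subtracting
    the affine part of [h], whose contour integral vanishes because it has a polynomial
    primitive. *)
Theorem goursat h (A B S T : R) : 0 <= S -> 0 <= T -> (forall z, ccont h z) ->
  (forall x y, A <= x <= A + S -> B <= y <= B + T -> exists D, forall e : R, 0 < e ->
    exists2 d : R, 0 < d & forall x' y', A <= x' <= A + S -> B <= y' <= B + T ->
    let k := (x' +i* y') - (x +i* y) in
    cnorm k < d -> cnorm (h (x' +i* y') - h (x +i* y) - D * k) <= e * cnorm k) ->
  bdint h A B S T = 0.
Proof.
move=> S0 T0 ch dh; apply/eqP; rewrite -cnorm_eq0 eq_le cnorm_ge0 andbT.
suff H (e : R) : 0 < e -> cnorm (bdint h A B S T) <= e * (S + T) ^+ 2.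
  apply/ler_addgt0Pr => e e0; rewrite add0r.
  have k0 : 0 < (S + T) ^+ 2 + 1 by rewrite ltr_wpDl// sqr_ge0.
  have e1 : 0 < e / ((S + T) ^+ 2 + 1) by rewrite divr_gt0.
  apply: le_trans (H _ e1) _; rewrite mulrAC ler_pdivrMr// ler_pM2l//.
  by rewrite lerDl.
move=> e0.
pose P a c s t := A <= a -> a + s <= A + S -> B <= c -> c + t <= B + T ->
  0 <= s -> 0 <= t -> cnorm (bdint h a c s t) <= e * (s + t) ^+ 2.
suff : P A B S T by apply.
apply: bisection => // [a c s t H1 H2 H3 H4 Aa aA Bc cB s0 t0|x y].
  have Q1 : e * (s / 2 + t / 2) ^+ 2 = e * (s + t) ^+ 2 / 4 by field.
  rewrite bdint_split.
  have k1 : cnorm (bdint h a c (s / 2) (t / 2)) <= e * (s + t) ^+ 2 / 4.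
    by rewrite -Q1; apply: H1; lra.
  have k2 : cnorm (bdint h (a + s / 2) c (s / 2) (t / 2)) <= e * (s + t) ^+ 2 / 4.
    by rewrite -Q1; apply: H2; lra.
  have k3 : cnorm (bdint h a (c + t / 2) (s / 2) (t / 2)) <= e * (s + t) ^+ 2 / 4.
    by rewrite -Q1; apply: H3; lra.
  have k4 : cnorm (bdint h (a + s / 2) (c + t / 2) (s / 2) (t / 2)) <=
      e * (s + t) ^+ 2 / 4 by rewrite -Q1; apply: H4; lra.
  move: k1 k2 k3 k4.
  set b1 := bdint _ _ _ _ _; set b2 := bdint _ _ _ _ _.
  set b3 := bdint _ _ _ _ _; set b4 := bdint _ _ _ _ _ => k1 k2 k3 k4.
  have := cnormD (b1 + b2 + b3) b4; have := cnormD (b1 + b2) b3.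
  by have := cnormD b1 b2; lra.
have [xy|xy] := boolP [&& A <= x, x <= A + S, B <= y & y <= B + T]; last first.
  exists 1 => // a c s t /andP[ax xa] /andP[cy yc] _ _ Aa aA Bc cB _ _.
  by case/negP: xy; apply/and4P; split; lra.
case/and4P: xy => Ax xA By yB.
have [D HD] := dh x y (introT andP (conj Ax xA)) (introT andP (conj By yB)).
have e2 : 0 < e / 2 by rewrite divr_gt0.
have [d d0 Hd] := HD _ e2.
exists (d / 2); first by rewrite divr_gt0.
move=> a c s t axs cyt sd td Aa aA Bc cB s0 t0.
pose z0 := x +i* y.
pose aff z := h z0 + D * (z - z0).
have Daff z : cderiv (fun z => h z0 * z + D * ((z - z0) ^+ 2 / 2)) z (aff z).
  have D2 := cderivX 2 (cderivB (cderiv_id z) (cderiv_cst z0 z)).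
  have := cderivD (cderivZ (h z0) (cderiv_id z)) (cderivZ D (cderivZ 2^-1 D2)).
  move=> /cderiv_ext H; apply: cderiv_eq (H _ _) _.
    by apply: filterE => w /=; ring.
  by rewrite /aff; field.
have caff z : ccont aff z.
  apply: climD (clim_cst _) _; apply: climM (clim_cst _) _.
  exact: climB (ccont_id z) (clim_cst _).
have cr z : ccont (fun z => h z - aff z) z by exact: (climB (ch z) (caff z)).
have -> : bdint h a c s t = bdint aff a c s t + bdint (fun z => h z - aff z) a c s t.
  by rewrite -(bdintD _ _ _ _ caff cr); congr (bdint _ a c s t); apply/funext => z; rewrite addrC subrK.
rewrite (bdint_exact _ _ _ _ Daff) add0r.
have E : e * (s + t) ^+ 2 = 2 * (e / 2 * (s + t)) * (s + t) by field.
rewrite E; apply: bdint_le => // x' y' x'as y'ct.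
set k := (x' +i* y') - z0.
have kst : cnorm k <= s + t.
  apply: le_trans (cnorm_le _) _; rewrite /k /z0 !(cReD, cImD, cReN, cImN)/=.
  by apply: lerD; rewrite ler_norml; apply/andP; split; lra.
have kd : cnorm k < d by lra.
have -> : h (x' +i* y') - aff (x' +i* y') = h (x' +i* y') - h z0 - D * k.
  by rewrite /aff /k; ring.
apply: le_trans (Hd x' y' _ _ kd) _; [by apply/andP; split; lra|by apply/andP; split; lra|].
by rewrite ler_wpM2l// ltW.
Qed.

(** In the contour integral over a rectangle of width 1 the vertical sides cancel by periodicity,
    which leaves the difference of the two horizontal integrals. *)
Lemma cint_line_indep h (y0 y1 y2 : R) :
  (forall z, y0 < Im z -> cdiff h z) -> (forall z, h (z + 1) = h z) ->
  y0 < y1 -> y0 < y2 ->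
  cint (fun x => h (x +i* y1)) 0 1 = cint (fun x => h (x +i* y2)) 0 1.
Proof.
wlog y12 : y1 y2 / y1 <= y2.
  move=> H D per a b; have [/H->//|/ltW/H->//] := leP y1 y2.
move=> D per h1 h2.
(* Clamping the height to the strip extends [h] continuously to the plane without changing it on the
   rectangle. *)
pose cl t := Num.min (Num.max t y1) y2.
have clin t : y1 <= t <= y2 -> cl t = t.
  by move=> /andP[? ?]; rewrite /cl max_l// min_l.
have clb t : y1 <= cl t <= y2.
  by apply/andP; split; [rewrite le_min le_max lexx orbT y12|rewrite ge_min lexx orbT].
have cl_lip t t' : `|cl t - cl t'| <= `|t - t'|.
  have E u : cl u = if u <= y1 then y1 else if u <= y2 then u else y2.
    rewrite /cl; case: (leP u y1) => hu; first by rewrite min_l.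
    by case: (leP u y2).
  have n1 := ler_norm (t - t'); have n2 := ler_norm (- (t - t')); rewrite normrN in n2.
  have n3 := normr_ge0 (t - t'); rewrite ler_norml !E.
  by case: (leP t y1) => ?; case: (leP t' y1) => ?; case: (leP t y2) => ?;
    case: (leP t' y2) => ?; apply/andP; split; lra.
pose g z := h (Re z +i* cl (Im z)).
have cg z : ccont g z.
  have clP : y0 < Im (Re z +i* cl (Im z)) by have /andP[? _] := clb (Im z) => /=; lra.
  apply: (@ccont_comp _ h (fun z => Re z +i* cl (Im z))); first exact: cdiff_cont (D _ clP).
  move=> e e0; exists (e / 2); first by rewrite divr_gt0.
  move=> w wz /=; apply: le_lt_trans (cnorm_le _) _; rewrite /=.
  have := cnorm_Re (w - z); have := cnorm_Im (w - z).
  by rewrite cImD cImN cReD cReN; have := cl_lip (Im w) (Im z); lra.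
have gE x y : y1 <= y <= y2 -> g (x +i* y) = h (x +i* y).
  by move=> /clin E; rewrite /g/= E.
have gper z : g (z + 1) = g z.
  by rewrite /g -[RHS]per; congr h; apply: complexP; rewrite !(cReD, cImD)/= ?addr0.
have y12E : y1 + (y2 - y1) = y2 by rewrite addrC subrK.
have := @goursat g 0 y1 1 (y2 - y1) ler01 _ cg _; rewrite /bdint add0r y12E.
rewrite subr_ge0 => /(_ y12) H.
have {}H : cint (fun x : R => g (x +i* y1)) 0 1 - cint (fun x : R => g (x +i* y2)) 0 1 = 0.
  have E : (fun y => g (1 +i* y)) = (fun y => g (0 +i* y)).
    apply/funext => y; rewrite -(gper (0 +i* y)); congr g.
    by apply: complexP => /=; rewrite ?add0r ?addr0.
  rewrite E subrr mulr0 addr0 in H; apply: H => x y _ yy.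
  have xyP : y0 < Im (x +i* y) by move: yy => /andP[? _] /=; lra.
  have [d /cderivP Hd] := D _ xyP; exists d => e /Hd[r r0 Hr]; exists r => //.
  move=> x' y' _ yy' kr; rewrite !gE//; exact: Hr kr.
apply/eqP; rewrite -subr_eq0; apply/eqP; rewrite -[RHS]H.
by congr (cint _ 0 1 - cint _ 0 1); apply/funext => x; rewrite gE// lexx y12.
Qed.

End Goursat.

(** * Fourier expansion of periodic holomorphic functions *)

Section Fourier.
Variable R : realType.
Local Notation C := R[i].
Local Notation Re := complex.Re.
Local Notation Im := complex.Im.
Implicit Types (p k : R -> C) (h : C -> C) (r : int).

Lemma rcont_real_line h (x : R) : ccont h x%:C -> rcont (fun t : R => h t%:C) x.
Proof. by move=> H; exact: (rcont_line H).1. Qed.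

Lemma ccont_ee_affine (a b z : C) : ccont (fun w => ee (a * w + b)) z.
Proof. exact: cderiv_cont (cderiv_ee_affine a b z). Qed.

Lemma rcont_ee (a : C) (x : R) : rcont (fun t : R => ee (a * t%:C)) x.
Proof.
have := rcont_real_line (ccont_ee_affine a 0 x%:C).
rewrite /rcont addr0; apply: clim_ext.
by apply: filterE => t /=; rewrite addr0.
Qed.

Lemma rcontM p k x : rcont p x -> rcont k x -> rcont (fun t => p t * k t) x.
Proof. exact: climM. Qed.
Lemma rcontD p k x : rcont p x -> rcont k x -> rcont (fun t => p t + k t) x.
Proof. exact: climD. Qed.
Lemma rcont_cst (c : C) (x : R) : rcont (fun=> c) x.
Proof. exact: clim_cst. Qed.

Lemma rcont_shift p (s x : R) : rcont p (x + s) -> rcont (fun t => p (t + s)) x.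
Proof.
move=> H e /H[d d0 Hd]; exists d => // t tx; apply: Hd.
by rewrite (_ : _ - _ = t - x)//; ring.
Qed.

Definition fcoef p r : C := cint (fun x => p x * ee (- r%:~R * x%:C)) 0 1.

Lemma cnorm_ee_real (a x : R) : cnorm (ee (a%:C * x%:C)) = 1.
Proof. by rewrite cnorm_ee -rmorphM /= mulr0 oppr0 expR0. Qed.

Lemma intr_real r : r%:~R = (r%:~R : R)%:C.
Proof. by rewrite rmorph_int. Qed.

Lemma fcoef_cst (c : C) r : fcoef (fun=> c) r = c * (r == 0)%:R.
Proof.
rewrite /fcoef cintZ; last by move=> x; exact: rcont_ee.
congr (_ * _); have [->|r0] := eqVneq r 0.
  rewrite (@cintE _ _ (fun x => x%:C)) /= ?subr0// => x e e0.
  apply: filterE => y /=; rewrite oppr0 mul0r ee0 mul1r -!rmorphB subrr cnorm0.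
  by rewrite mulr_ge0// ltW.
have rC : r%:~R != 0 :> C by rewrite intr_eq0.
rewrite (@cintE _ _ (fun x => (tpi R * - r%:~R)^-1 * ee (- r%:~R * x%:C))) /=.
  by rewrite !(rmorph1, rmorph0) mulr1 mulr0 ee0 -mulrNz ee_int subrr.
move=> x; have [+ _] := cderiv_line (cderiv_ee_affine (- r%:~R) 0 (x +i* 0)).
move=> /(rderivZ (tpi R * - r%:~R)^-1); rewrite mulrA mulVf ?mul1r; last first.
  by rewrite mulf_neq0 ?tpi_neq0// oppr_eq0.
rewrite addr0; apply: rderiv_ext; apply: filterE => t /=.
by rewrite addr0.
Qed.

Lemma fcoefD p k r : (forall x, rcont p x) -> (forall x, rcont k x) ->
  fcoef (fun x => p x + k x) r = fcoef p r + fcoef k r.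
Proof.
move=> cp ck; rewrite /fcoef -cintD.
- by congr (cint _ 0 1); apply/funext => x; rewrite mulrDl.
- by move=> x; apply: rcontM; [exact: cp|exact: rcont_ee].
- by move=> x; apply: rcontM; [exact: ck|exact: rcont_ee].
Qed.

Lemma fcoefZ p (c : C) r : (forall x, rcont p x) ->
  fcoef (fun x => c * p x) r = c * fcoef p r.
Proof.
move=> cp; rewrite /fcoef -cintZ.
  by congr (cint _ 0 1); apply/funext => x; rewrite mulrA.
by move=> x; apply: rcontM; [exact: cp|exact: rcont_ee].
Qed.

Lemma fcoef_ee p r : fcoef (fun x => p x * ee x%:C) r = fcoef p (r - 1).
Proof.
rewrite /fcoef; congr (cint _ 0 1); apply/funext => x.
by rewrite -mulrA -eeD; congr (_ * ee _); rewrite rmorphB /=; ring.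
Qed.

Lemma uniformly_continuous p (e : R) : (forall x, rcont p x) -> 0 < e ->
  exists2 d : R, 0 < d & forall x y, 0 <= x <= 1 -> `|y - x| < d -> cnorm (p y - p x) <= e.
Proof.
move=> cp e0; have e2 : 0 < e / 2 by rewrite divr_gt0.
pose P a s := exists2 d : R, 0 < d &
  forall x y, a <= x <= a + s -> `|y - x| < d -> cnorm (p y - p x) <= e.
suff [d d0 Hd] : P 0 1 by exists d => // x y x01; apply: Hd; rewrite add0r.
apply: bisection1 => // [a s [d1 d10 H1] [d2 d20 H2]|x].
  exists (Num.min d1 d2); first by rewrite lt_min d10.
  move=> x y /andP[ax xs]; rewrite lt_min => /andP[yd1 yd2].
  have [xh|xh] := leP x (a + s / 2); first by apply: H1 => //; rewrite ax.
  by apply: H2 => //; rewrite (ltW xh)/=; lra.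
have [d d0 Hd] := cp x _ e2; exists (d / 2); first by rewrite divr_gt0.
move=> a s axs sd; exists (d / 2); first by rewrite divr_gt0.
move=> u v uas vu.
have ux : `|u - x| < d / 2 by rewrite ltr_norml; apply/andP; split; lra.
have h1 : cnorm (p u - p x) < e / 2 by apply: Hd; lra.
have h2 : cnorm (p v - p x) < e / 2.
  apply: Hd; rewrite (_ : v - x = (v - u) + (u - x)); last by ring.
  by apply: le_lt_trans (ler_normD _ _) _; lra.
rewrite (_ : p v - p u = (p v - p x) - (p u - p x)); last by ring.
by apply: le_trans (cnormB _ _) _; lra.
Qed.

Lemma bounded_segment p : (forall x, rcont p x) ->
  exists M : R, forall x, 0 <= x <= 1 -> cnorm (p x) <= M.
Proof.
move=> cp.
pose P a s := exists M : R, forall x, a <= x <= a + s -> cnorm (p x) <= M.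
suff [M HM] : P 0 1 by exists M => x x01; apply: HM; rewrite add0r.
apply: bisection1 => // [a s [d1 H1] [d2 H2]|x].
  exists (Num.max d1 d2) => x /andP[ax xs]; rewrite le_max.
  have [xh|xh] := leP x (a + s / 2); first by rewrite H1// ax.
  by rewrite H2 ?orbT// (ltW xh)/=; lra.
have [M [d d0 Hd]] := clim_bounded (cp x).
exists d => // a s axs sd; exists M => u uas; apply: Hd.
by rewrite ltr_norml; apply/andP; split; lra.
Qed.

(** Translation by s = 1/(2r) changes the sign of e(- r x). Hence twice the coefficient is the
    integral of [p x - p (x + s)] against that exponential, small by uniform continuity once |r| is
    large. *)
Lemma riemann_lebesgue p (e : R) : (forall x, rcont p x) ->
  (forall x, p (x + 1) = p x) -> 0 < e ->
  exists N : nat, forall r, (N < `|r|)%N -> cnorm (fcoef p r) <= e.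
Proof.
move=> cp pp e0; have [d d0 Hd] := uniformly_continuous cp e0.
exists (Num.truncn d^-1) => r Nr.
have r1 : d^-1 < `|r|%N%:R by apply: (lt_le_trans (truncnS_gt _)); rewrite ler_nat.
have absr : `|r|%N%:R = `|r%:~R| :> R by rewrite -intr_norm -abszE.
have rn0 : 0 < `|r%:~R : R| by rewrite -absr (lt_trans _ r1)// invr_gt0.
have rR0 : (r%:~R : R) != 0 by rewrite -normr_gt0.
have rC0 : (r%:~R : C) != 0.
  by apply: contraNneq rR0; rewrite intr_real => /complexI ->.
pose s : R := (2 * r%:~R)^-1.
have sd : `|s| < d.
  rewrite normfV normrM ger0_norm// invf_plt ?posrE ?mulr_gt0//.
  by rewrite (lt_trans r1)// absr ltr_pMl// ltr1n.
have er x : ee (- r%:~R * (x + s)%:C) = - ee (- r%:~R * x%:C).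
  rewrite rmorphD mulrDr eeD (_ : - r%:~R * s%:C = - 2^-1) ?eeN ?ee_half.
    by rewrite invrN1 mulrN1.
  by rewrite /s fmorphV rmorphM /= -intr_real rmorph_nat; field.
have cq x : rcont (fun x => p x * ee (- r%:~R * x%:C)) x.
  by apply: rcontM; [exact: cp|exact: rcont_ee].
have E1 : fcoef p r = - cint (fun x => p (x + s) * ee (- r%:~R * x%:C)) 0 1.
  rewrite /fcoef -(cint_per s cq) => [|x].
    rewrite -[RHS]mulN1r -cintZ; last first.
      move=> x; apply: rcontM; [apply: rcont_shift; exact: cp|exact: rcont_ee].
    by congr (cint _ 0 1); apply/funext => x; rewrite er; ring.
  rewrite pp rmorphD /= mulrDr eeD mulr1 -[- r%:~R]mulrNz.
  by rewrite ee_int mulr1.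
have E2 : 2 * fcoef p r = cint (fun x => (p x - p (x + s)) * ee (- r%:~R * x%:C)) 0 1.
  rewrite (_ : 2 * _ = fcoef p r + fcoef p r); last by ring.
  rewrite {2}E1 -[- cint _ _ _]mulN1r -cintZ; last first.
    by move=> x; apply: rcontM; [apply: rcont_shift; exact: cp|exact: rcont_ee].
  rewrite -cintD; first by congr (cint _ 0 1); apply/funext => x; ring.
    exact: cq.
  move=> x; apply: rcontM (rcont_cst _ _) _.
  by apply: rcontM; [apply: rcont_shift; exact: cp|exact: rcont_ee].
have : cnorm (2 * fcoef p r) <= e * (1 - 0).
  rewrite E2; apply: cint_le => // x.
    apply: rcontM; last exact: rcont_ee.
    by apply: climB; [exact: cp|apply: rcont_shift; exact: cp].
  move=> x01; rewrite cnormM intr_real -rmorphN cnorm_ee_real mulr1 cdistC.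
  by apply: Hd => //; rewrite addrAC subrr add0r.
rewrite cnormM subr0 mulr1 (_ : cnorm 2 = 2); last first.
  by rewrite -(rmorph_nat (real_complex R) 2) cnorm_real ger0_norm.
by have := cnorm_ge0 (fcoef p r); lra.
Qed.

(* Dini's criterion: with p - p 0 = k (e(x) - 1), the partial Fourier sums of p
   telescope to p 0 plus Fourier coefficients of k. *)
Lemma fourier_inversion0 p d : (forall x, rcont p x) -> (forall x, p (x + 1) = p x) ->
  rderiv p 0 d ->
  clim \oo (fun N => \sum_(n < N) (fcoef p (Posz n) + fcoef p (Negz n))) (p 0).
Proof.
move=> cp pp dp.
pose E (x : R) : C := ee x%:C - 1.
have Ep x : E (x + 1) = E x by rewrite /E rmorphD eeD ee1 mulr1.
have cE x : rcont E x.
  apply: climB (clim_cst _); have := rcont_ee 1 x; rewrite /rcont mul1r.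
  by apply: clim_ext; apply: filterE => t /=; rewrite mul1r.
have dE : rderiv E 0 (tpi R).
  pose z0 : C := 0 +i* 0.
  have [+ _] := cderiv_line (cderivD (cderiv_ee_affine 1 0 z0) (cderiv_cst (-1) z0)).
  rewrite mulr0 !addr0 ee0 !mulr1; apply: rderiv_ext.
  by apply: filterE => t /=; rewrite mul1r addr0.
have E0 : E 0 = 0 by rewrite /E ee0 subrr.
(* At the integers, the zeros of [E], the quotient gets its limit p'(0) / (2 pi i); this value makes
   [k] continuous. *)
pose k (x : R) : C := if E x == 0 then d / tpi R else (p x - p 0) / E x.
have Ez x (m : int) : E (x + m%:~R) = E x.
  by rewrite /E rmorphD /= -intr_real eeD ee_int mulr1.
have pz x (m : int) : p (x + m%:~R) = p x.
  have pn y (n : nat) : p (y + n%:R) = p y.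
    by elim: n => [|n IH]; rewrite ?addr0// -natr1 addrA pp.
  case: m => n; first exact: pn.
  by rewrite NegzE mulrNz -(pn _ n.+1) subrK.
have Eint x : E x = 0 -> exists m : int, x = m%:~R.
  move=> Ex; exists (Num.floor x).
  set m := Num.floor x; pose y := x - m%:~R.
  have y01 : 0 <= y < 1.
    by rewrite /y subr_ge0 ltrBlDl -intrD1 floor_itv ?num_real.
  have Ey : E y = 0 by rewrite -Ex -(Ez y m) /y subrK.
  have cy : cos (2 * pi * y) = 1.
    move: Ey => /eqP; rewrite subr_eq0 => /eqP; rewrite eeE tpiE /cexp.
    have -> : (0 +i* (2 * pi)) * y%:C = 0 +i* (2 * pi * y).
      by apply: complexP; rewrite !(cReM, cImM)/=; ring.
    by rewrite /= expR0 mul1r => -[].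
  have sy : sin (pi * y) = 0.
    move: cy; rewrite (_ : 2 * pi * y = (pi * y) *+ 2); last by rewrite -mulr_natr; ring.
    rewrite cos_mulr2n cos2sin2 -mulr_natr => cy.
    by apply/eqP; rewrite -sqrf_eq0; apply/eqP; lra.
  apply/eqP; rewrite -subr_eq0 -/y eq_le; case/andP: y01 => y0 y1; rewrite y0 andbT.
  rewrite leNgt; apply/negP => y0'.
  have : 0 < sin (pi * y).
    by apply: sin_gt0_pi; rewrite mulr_gt0 ?pi_gt0//= gtr_pMr// pi_gt0.
  by rewrite sy ltxx.
have pE x : p x = p 0 + k x * E x.
  rewrite /k; case: eqP => [/[dup] + -> |/eqP Ex]; last by field.
  by move=> /Eint[m ->]; rewrite mulr0 addr0 -(pz 0 m) add0r.
have kp x : k (x + 1) = k x by rewrite /k Ep pp.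
have kz x (m : int) : k (x + m%:~R) = k x by rewrite /k Ez pz.
have k0 : rcont k 0.
  (* near 0 both difference quotients converge, to d and to 2 pi i *)
  have quo (F : R -> C) (l : C) : rderiv F 0 l -> clim (rnear 0) (fun x => if x == 0 then l else
      (F x - F 0) / x%:C) l.
    move=> HF e e0; have e2 : 0 < e / 2 by rewrite divr_gt0.
    apply: filterS (HF _ e2) => x /=; case: eqP => [_ _|/eqP x0 h].
      by rewrite subrr cnorm0.
    rewrite subr0 in h; have xC : x%:C != 0 by rewrite -cnorm_eq0 cnorm_real normr_eq0.
    have nx : 0 < `|x| by rewrite normr_gt0.
    rewrite -(ltr_pM2r nx) -cnorm_real -cnormM mulrBl divfK// cnorm_real.
    by rewrite (le_lt_trans h)// ltr_pM2r// gtr_pMr// invf_lt1 ?ltr1n.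
  have kE : k 0 = d / tpi R by rewrite /k E0 eqxx.
  have q1 := quo _ _ dp; have q2 : clim (rnear 0) (fun t : R =>
      (if t == 0 then tpi R else (E t - E 0) / t%:C)^-1) (tpi R)^-1.
    by apply: climV (tpi_neq0 R); exact: quo.
  rewrite /rcont kE; apply: clim_ext (climM q1 q2).
  exists 1 => // x; rewrite subr0 => x1 /=; rewrite /k.
  case: (eqVneq x 0) => [->|x0]; first by rewrite E0 eqxx.
  rewrite E0 subr0.
  case: eqP => [/Eint[m xm]|/eqP Ex].
    exfalso; move: x0 x1; rewrite xm intr_eq0 -intr_norm -[1]/(1%:~R) ltr_int.
    by case: m {xm} => [[|n]|n].
  have xC : x%:C != 0 by rewrite -cnorm_eq0 cnorm_real normr_eq0.
  by field; rewrite Ex xC.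
have ck x : rcont k x.
  have [/Eint[m ->]|Ex] := eqVneq (E x) 0.
    have H : rcont k (m%:~R - m%:~R) by rewrite subrr.
    have := rcont_shift (s := - m%:~R) H; rewrite /rcont subrr => K.
    have km : k m%:~R = k 0 by rewrite -[m%:~R]add0r kz.
    rewrite /rcont km; apply: clim_ext K; apply: filterE => t /=.
    by rewrite -mulrNz kz.
  have kE : k x = (p x - p 0) / E x by rewrite /k (negbTE Ex).
  rewrite /rcont kE.
  apply: clim_ext (climM (climB (cp x) (clim_cst (p 0))) (climV (cE x) Ex)).
  apply: filterS (clim_neq0 (cE x) Ex) => t /= Et.
  by rewrite /k (negbTE Et).
have fE r : fcoef p r = p 0 * (r == 0)%:R + (fcoef k (r - 1) - fcoef k r).
  rewrite -fcoef_ee -fcoef_cst -[X in _ - X]mul1r -mulNr -fcoefZ// -!fcoefD//.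
  - by congr (fcoef _ r); apply/funext => x; rewrite {1}pE /E; ring.
  - by move=> x; exact: rcont_cst.
  - move=> x; apply: rcontD; last by apply: rcontM (ck x); exact: rcont_cst.
    apply: rcontM (ck x) _; have := rcont_ee 1 x; rewrite /rcont mul1r.
    by apply: clim_ext; apply: filterE => t /=; rewrite mul1r.
  - move=> x; apply: rcontM (ck x) _; have := rcont_ee 1 x; rewrite /rcont mul1r.
    by apply: clim_ext; apply: filterE => t /=; rewrite mul1r.
  - by move=> x; apply: rcontM (ck x); exact: rcont_cst.
have sumE N : \sum_(n < N.+1) (fcoef p (Posz n) + fcoef p (Negz n)) =
    p 0 + (fcoef k (Negz N - 1) - fcoef k (Posz N)).
  elim: N => [|N IH].
    rewrite big_ord1 !fE /= (_ : Posz 0 - 1 = Negz 0)//; ring.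
  rewrite big_ord_recr IH /= !fE /= (_ : Negz N.+1 = Negz N - 1); last by lia.
  rewrite (_ : Posz N.+1 - 1 = Posz N); last by lia.
  by ring.
move=> e e0; have e4 : 0 < e / 4 by rewrite divr_gt0.
have [N0 HN0] := riemann_lebesgue ck kp e4.
exists N0.+2 => //= N; case: N => // N /= N0N; rewrite sumE addrAC subrr add0r.
apply: le_lt_trans (cnormB _ _) _.
have h1 : cnorm (fcoef k (Negz N - 1)) <= e / 4 by apply: HN0; lia.
have h2 : cnorm (fcoef k N) <= e / 4 by apply: HN0; lia.
by lra.
Qed.

(** The coefficient of q^r, computed on the line of height [y]. The exponential is taken at the
    complex point, so the value does not change with [y]. *)
Definition hcoef h (y : R) r : C :=
  cint (fun x => h (x +i* y) * ee (- r%:~R * (x +i* y))) 0 1.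

Section PeriodicHolomorphic.
Variables (h : C -> C) (y0 : R).
Hypothesis hdiff : forall z, y0 < Im z -> cdiff h z.
Hypothesis hper : forall z, h (z + 1) = h z.

Let hr r z := h z * ee (- r%:~R * z).

Let hr_diff r z : y0 < Im z -> cdiff (hr r) z.
Proof.
move=> yz; apply: cdiffM; first exact: hdiff.
apply: cdiff_ext (ex_intro _ _ (cderiv_ee_affine (- r%:~R) 0 z)).
by apply: filterE => w /=; rewrite addr0.
Qed.

Let hr_per r z : hr r (z + 1) = hr r z.
Proof.
by rewrite /hr hper mulrDr eeD mulr1 -[in ee (- _)]mulrNz ee_int mulr1.
Qed.

Let hr_cont r (x y : R) : y0 < y -> rcont (fun t => hr r (t +i* y)) x.
Proof. by move=> yy; exact: (rcont_line (cdiff_cont (hr_diff r (_ : y0 < Im (x +i* y))))).1. Qed.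

Lemma hcoef_indep (y1 y2 : R) r : y0 < y1 -> y0 < y2 -> hcoef h y1 r = hcoef h y2 r.
Proof. exact: (cint_line_indep (@hr_diff r) (@hr_per r)). Qed.

Lemma hcoef_le (y M : R) r : y0 < y ->
  (forall x, 0 <= x <= 1 -> cnorm (h (x +i* y)) <= M) ->
  cnorm (hcoef h y r) <= M * expR (2 * pi * r%:~R * y).
Proof.
move=> yy hM; rewrite -[leRHS]mulr1 -[X in _ <= _ * X]subr0.
apply: cint_le => // [x|x x01]; first exact: hr_cont.
rewrite cnormM cnorm_ee ler_pM ?cnorm_ge0 ?expR_ge0 ?hM//.
by rewrite ler_expR le_eqVlt; apply/orP; left; apply/eqP;
   rewrite intr_real -rmorphN cImM /=; ring.
Qed.

(** Dini's criterion is applied along the horizontal line through [tau], translated so that [tau]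
    sits over 0; its differentiability hypothesis comes from holomorphy. [hcoef_indep] then moves
    the coefficients to the height [y]. *)
Lemma hcoef_inversion (y : R) (tau : C) : y0 < y -> y0 < Im tau ->
  clim \oo (fun N => \sum_(n < N) (hcoef h y (Posz n) * ee (n%:R * tau)
     + hcoef h y (Negz n) * ee (- n.+1%:R * tau))) (h tau).
Proof.
move=> yy; case: tau => a b /= bb.
pose p (x : R) := h ((x + a) +i* b).
have cp x : rcont p x.
  apply: (@rcont_shift (fun t => h (t +i* b))).
  exact: (rcont_line (cdiff_cont (hdiff (_ : y0 < Im (_ +i* b))))).1.
have pp x : p (x + 1) = p x.
  by rewrite /p -[RHS]hper; congr h; apply: complexP => /=; rewrite ?addr0// addrAC.
have [d Hd] := hdiff (bb : y0 < Im (a +i* b)).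
have dp : rderiv p 0 d.
  have [+ _] := cderiv_line Hd; move=> H e /H[r r0 Hr]; exists r => // x.
  rewrite subr0 => xr; have := Hr (x + a); rewrite addrK => /(_ xr) /=.
  by rewrite addrK /p add0r subr0.
have E r : fcoef p r = hcoef h y r * ee (r%:~R * (a +i* b)).
  rewrite (hcoef_indep r yy bb) mulrC /hcoef -cintZ; last first.
    by move=> x; exact: hr_cont.
  rewrite -(@cint_per _ _ a) => [|x|x].
  - congr (cint _ 0 1); apply/funext => x; rewrite [RHS]mulrCA -eeD /p.
    congr (_ * ee _); rewrite (_ : (x + a) +i* b = x%:C + (a +i* b)); first by ring.
    by apply: complexP => /=; rewrite ?add0r.
  - by apply: rcontM (rcont_cst _ _) _; exact: hr_cont.
  - congr (_ * _); rewrite -[RHS]hr_per; congr hr.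
    by apply: complexP => /=; rewrite ?addr0.
have := fourier_inversion0 cp pp dp; rewrite /p add0r; apply: clim_ext.
apply: filterE => N /=; apply: eq_bigr => n _; rewrite !E.
by rewrite NegzE mulrNz.
Qed.

Lemma hcoef_eq0 (y : R) (tau : C) : y0 < y -> y0 < Im tau ->
  (forall r, hcoef h y r = 0) -> h tau = 0.
Proof.
move=> yy yt H; have := hcoef_inversion yy yt; move=> /clim_unique; apply.
apply: clim_ext (clim_cst 0); apply: filterE => N /=.
by rewrite big1// => n _; rewrite !H !mul0r addr0.
Qed.

(** Computed at height y1, the coefficient is at most M exp(2 pi r y1), which tends to 0 as y1 grows
    because r <= -1. *)
Lemma hcoef_cusp (y : R) r : y0 < y -> r < 0 -> bounded_along (@icusp R) h ->
  hcoef h y r = 0.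
Proof.
move=> yy r0 [M [Y HM]].
have rR : (r%:~R : R) <= -1 by rewrite -[-1]/((-1)%:~R) ler_int; lia.
apply/eqP; rewrite -cnorm_eq0 eq_le cnorm_ge0 andbT.
apply/ler_addgt0Pr => e e0; rewrite add0r.
pose M' := `|M| + 1; have M0 : 0 < M' by rewrite ltr_wpDl.
(* High enough for the bound at the cusp, for the domain of holomorphy, and for the final estimate
   M' / (1 + y1) <= e. *)
pose y1 := `|Y| + `|y0| + 1 + M' / e.
have Me : 0 < M' / e by rewrite divr_gt0.
have y1Y : Y < y1.
  by have := ler_norm Y; have := normr_ge0 y0; rewrite /y1; lra.
have y10 : y0 < y1.
  by have := ler_norm y0; have := normr_ge0 Y; rewrite /y1; lra.
have y1e : M' / e <= y1.
  by have := normr_ge0 y0; have := normr_ge0 Y; rewrite /y1; lra.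
rewrite (hcoef_indep r yy y10).
apply: le_trans (@hcoef_le y1 M' r y10 _) _.
  move=> x _; apply: le_trans (HM _ _) _ => //.
  by rewrite /M'; have := ler_norm M; lra.
have p2 := pi_ge2 R; have y1p : 0 < y1 by lra.
have k1 : 2 * pi * r%:~R * y1 <= - y1.
  have : 1 * 1 <= (2 * pi) * (- r%:~R) :> R by apply: ler_pM; lra.
  by move=> /(ler_wpM2r (ltW y1p)); rewrite mul1r; lra.
have k2 : expR (2 * pi * r%:~R * y1) <= expR (- y1) by rewrite ler_expR.
apply: le_trans (ler_wpM2l (ltW M0) k2) _; rewrite expRN ler_pdivrMr ?expR_gt0//.
have := expR_ge1Dx y1; rewrite ler_pdivrMr// in y1e.
by move=> k3; have := ler_wpM2l (ltW e0) k3; lra.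
Qed.

(** Negative indices do not contribute, and the bound [S] on the line [y1] makes the n-th term at
    most S x^n, so a geometric series remains. The explicit constant is what yields both remainders
    of order q and a contraction factor in weight 0. *)
Lemma cusp_tail (y1 S x : R) (tau : C) : y0 < y1 -> bounded_along (@icusp R) h ->
  (forall x, 0 <= x <= 1 -> cnorm (h (x +i* y1)) <= S) -> y1 < Im tau ->
  x = expR (- (2 * pi * (Im tau - y1))) ->
  cnorm (h tau - hcoef h y1 0) <= S * (x / (1 - x)).
Proof.
move=> yy bh hS yt xE.
have x0 : 0 < x by rewrite xE expR_gt0.
have x1 : x < 1.
  by rewrite xE expR_lt1 oppr_lt0 !mulr_gt0 ?pi_gt0// subr_gt0.
have S0 : 0 <= S by apply: le_trans (hS 0 _); rewrite ?cnorm_ge0// lexx ler01.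
have Kneg n : hcoef h y1 (Negz n) = 0 by apply: hcoef_cusp.
have yt0 : y0 < Im tau by lra.
have := hcoef_inversion yy yt0 => L.
apply/ler_addgt0Pr => e e0; have [N _ HN] := L _ e0.
have := HN N.+1 (leqnSn N) => /= {}HN.
set s := \sum_(n < N.+1) _ in HN.
have sE : cnorm (s - hcoef h y1 0) <= S * (x / (1 - x)).
  rewrite /s big_ord_recl /= mul0r ee0 mulr1 Kneg mul0r addr0 addrAC subrr add0r.
  apply: le_trans (cnorm_sum _ _ _) _.
  apply: (@le_trans _ _ (\sum_(n < N) S * x ^+ n.+1)).
    apply: ler_sum => n _; rewrite Kneg mul0r addr0 cnormM.
    have := hcoef_le n.+1 yy hS; move=> /(ler_wpM2r (cnorm_ge0 (ee (n.+1%:R * tau)))).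
    move=> h1; apply: le_trans h1 _; rewrite -[leLHS]mulrA ler_wpM2l//.
    rewrite cnorm_ee -expRD xE -expRM_natl ler_expR le_eqVlt; apply/orP; left.
    apply/eqP; rewrite -[n.+1%:R]/(n.+1%:~R) intr_real cImM /=; ring.
  rewrite -mulr_sumr ler_wpM2l//.
  under eq_bigr do rewrite exprS.
  rewrite -mulr_sumr ler_wpM2l ?(ltW x0)//.
  have g : (1 - x) * (\sum_(i < N) x ^+ i) = 1 - x ^+ N.
    have := subrX1 x N; rewrite -opprB => /eqP; rewrite eqr_oppLR => /eqP ->.
    by rewrite -mulNr opprB.
  have x10 : 0 < 1 - x by rewrite subr_gt0.
  rewrite -[_^-1]mul1r ler_pdivlMr// mulrC g lerBlDr lerDl.
  by rewrite exprn_ge0// ltW.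
rewrite (_ : h tau - _ = (s - hcoef h y1 0) - (s - h tau)); last by ring.
apply: le_trans (cnormB _ _) _; apply: lerD => //; exact: ltW.
Qed.

End PeriodicHolomorphic.

End Fourier.

(** * Series with geometric domination and Gaussian decay *)

Section DominatedSeries.
Variable R : realType.
Local Notation C := R[i].
Local Notation Re := complex.Re.
Local Notation Im := complex.Im.
Implicit Types (u v : nat -> C) (K r : R).

Definition csum u : C := limn (series u).

(** One criterion for convergence, termwise integration and termwise differentiation; the Gaussian
    decay of theta series always provides it. *)
Definition gdom u K r := [/\ 0 <= r, r < 1 & forall n, cnorm (u n) <= K * r ^+ n].

Lemma real_gdom_cvg (a : nat -> R) K r : 0 <= r -> r < 1 ->
  (forall n, `|a n| <= K * r ^+ n) -> cvgn (series a).
Proof.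
move=> r0 r1 aK; apply: normed_cvg.
apply: (@series_le_cvg _ _ (geometric K r)).
- by move=> n; exact: normr_ge0.
- by move=> n; exact: le_trans (normr_ge0 _) (aK n).
- by move=> n; exact: aK.
- by apply: is_cvg_geometric_series; rewrite ger0_norm.
Qed.

Lemma gdom_cvg u K r : gdom u K r -> clim \oo (series u) (csum u).
Proof.
move=> [r0 r1 uK].
have c1 : cvgn (series (fun n => Re (u n))).
  by apply: (@real_gdom_cvg _ K r) => // n; exact: le_trans (cnorm_Re _) (uK n).
have c2 : cvgn (series (fun n => Im (u n))).
  by apply: (@real_gdom_cvg _ K r) => // n; exact: le_trans (cnorm_Im _) (uK n).
move/cvg_ex : c1 => [a /cvgrPdist_lt Ha]; move/cvg_ex : c2 => [b /cvgrPdist_lt Hb].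
have L : clim \oo (series u) (a +i* b).
  move=> e e0; have e2 : 0 < e / 2 by rewrite divr_gt0.
  apply: filterS2 (Ha _ e2) (Hb _ e2) => n /= h1 h2.
  have E : series u n - (a +i* b) =
      (series (fun n => Re (u n)) n - a) +i* (series (fun n => Im (u n)) n - b).
    rewrite /series/=; elim: (index_iota 0 n) => [|i s IH].
      by rewrite !big_nil; apply: complexP => /=; rewrite sub0r.
    rewrite !big_cons -!addrA IH.
    by apply: complexP; rewrite !(cReD, cImD)/= ?addrA.
  rewrite E; apply: le_lt_trans (cnorm_le _) _ => /=.
  by rewrite [X in X + _]distrC [X in _ + X]distrC [e]splitr ltrD.
suff -> : csum u = a +i* b by [].
by apply/cvg_lim; [exact: norm_hausdorff|exact/cvg_clim].
Qed.

Lemma csum_unique u K r l : gdom u K r -> clim \oo (series u) l -> csum u = l.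
Proof. by move=> /gdom_cvg H1 H2; exact: clim_unique H1 H2. Qed.

Lemma csum_le u K r : gdom u K r -> cnorm (csum u) <= K / (1 - r).
Proof.
move=> H; have [r0 r1 uK] := H; have := gdom_cvg H => L.
have K0 : 0 <= K by have := uK 0%N; rewrite expr0 mulr1; apply: le_trans (cnorm_ge0 _).
apply/ler_addgt0Pr => e e0; have [N _ /(_ N (leqnn N)) /= HN] := L _ e0.
rewrite -[csum u](subKr (series u N)); apply: le_trans (cnormB _ _) _.
apply: lerD (ltW HN).
rewrite /series/= big_mkord; apply: le_trans (cnorm_sum _ _ _) _.
apply: (@le_trans _ _ (\sum_(n < N) K * r ^+ n)); first by apply: ler_sum => n _.
rewrite -mulr_sumr ler_wpM2l//.
have g : (1 - r) * (\sum_(i < N) r ^+ i) = 1 - r ^+ N.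
  have := subrX1 r N; rewrite -opprB => /eqP; rewrite eqr_oppLR => /eqP ->.
  by rewrite -mulNr opprB.
have x10 : 0 < 1 - r by rewrite subr_gt0.
by rewrite -[_^-1]mul1r ler_pdivlMr// mulrC g lerBlDr lerDl exprn_ge0.
Qed.

Lemma gdom_le u v K r : (forall n, cnorm (v n) <= cnorm (u n)) -> gdom u K r -> gdom v K r.
Proof. by move=> H [r0 r1 uK]; split=> // n; exact: le_trans (H n) (uK n). Qed.

Lemma gdomZ c u K r : gdom u K r -> gdom (fun n => c * u n) (cnorm c * K) r.
Proof. by move=> [r0 r1 uK]; split=> // n; rewrite cnormM -mulrA ler_wpM2l ?cnorm_ge0. Qed.

Lemma gdomD u v K L r : gdom u K r -> gdom v L r -> gdom (fun n => u n + v n) (K + L) r.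
Proof.
move=> [r0 r1 uK] [_ _ vL]; split=> // n; rewrite mulrDl.
by apply: le_trans (cnormD _ _) (lerD (uK n) (vL n)).
Qed.

Lemma csumZ c u K r : gdom u K r -> csum (fun n => c * u n) = c * csum u.
Proof.
move=> H; apply: (csum_unique (gdomZ c H)).
apply: clim_ext (climM (clim_cst c) (gdom_cvg H)).
by apply: filterE => n /=; rewrite /series/= mulr_sumr.
Qed.

Lemma csumD u v K L r : gdom u K r -> gdom v L r ->
  csum (fun n => u n + v n) = csum u + csum v.
Proof.
move=> H H'; apply: (csum_unique (gdomD H H')).
apply: clim_ext (climD (gdom_cvg H) (gdom_cvg H')).
by apply: filterE => n /=; rewrite /series/= big_split.
Qed.

Lemma csumB u v K L r : gdom u K r -> gdom v L r ->
  csum (fun n => u n - v n) = csum u - csum v.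
Proof.
move=> H H'; rewrite -[- csum v]mulN1r -(csumZ _ H') -(csumD H (gdomZ (-1) H')).
by congr csum; apply/funext => n; rewrite mulN1r.
Qed.

Lemma gdomS u K r : gdom u K r -> gdom (fun n => u n.+1) (K * r) r.
Proof. by move=> [r0 r1 uK]; split=> // n; rewrite -mulrA -exprS. Qed.

Lemma csumS u K r : gdom u K r -> csum u = u 0%N + csum (fun n => u n.+1).
Proof.
move=> H; apply: (csum_unique H).
have := climD (clim_cst (u 0%N)) (gdom_cvg (gdomS H)) => L e /L[N _ HN].
exists N.+1 => // -[//|n] /= Nn; have := HN n Nn; rewrite /= /series/= !big_mkord.
by rewrite big_ord_recl.
Qed.

Lemma csum_tail_le u K r : gdom (fun n => u n.+1) K r -> (exists K', gdom u K' r) ->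
  cnorm (csum u - u 0%N) <= K / (1 - r).
Proof.
by move=> H [K' H']; rewrite (csumS H') addrAC subrr add0r; exact: csum_le H.
Qed.

Lemma csum_cint (u : nat -> R -> C) K r (a b : R) : a <= b ->
  (forall n x, rcont (u n) x) -> (forall x, rcont (fun x => csum (u^~ x)) x) ->
  (forall x, gdom (u^~ x) K r) ->
  clim \oo (fun N => \sum_(n < N) cint (u n) a b) (cint (fun x => csum (u^~ x)) a b).
Proof.
move=> ab cu cs H; have [r0 r1 _] := H 0.
have K0 : 0 <= K.
  by have [_ _ /(_ 0%N)] := H 0; rewrite expr0 mulr1; apply: le_trans (cnorm_ge0 _).
have rem N x : cnorm (csum (u^~ x) - \sum_(n < N) u n x) <= K * r ^+ N / (1 - r).
  elim: N => [|N IH].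
    by rewrite big_ord0 subr0 expr0 mulr1; exact: csum_le (H x).
  clear IH; have : csum (u^~ x) - \sum_(n < N.+1) u n x = csum (fun n => u (n + N.+1)%N x).
    elim: N.+1 => [|m IH]; first by rewrite big_ord0 subr0; congr csum; apply/funext => n; rewrite addn0.
    rewrite big_ord_recr /= opprD addrA IH.
    have G : gdom (fun n => u (n + m)%N x) (K * r ^+ m) r.
      by split=> // n; rewrite -mulrA -exprD addnC; have [_ _] := H x.
    rewrite (csumS G) add0n addrAC subrr add0r; congr csum; apply/funext => n.
    by rewrite addSnnS.
  move=> ->; apply: csum_le; split=> // n; rewrite -mulrA -exprD addnC.
  by have [_ _] := H x.
have r10 : 0 < 1 - r by rewrite subr_gt0.
move=> e e0.
pose A := K / (1 - r) * (b - a) + 1.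
have A0 : 0 < A by rewrite ltr_wpDl// mulr_ge0 ?divr_ge0 ?subr_ge0// ltW.
have eA : 0 < e / A by rewrite divr_gt0.
have : (fun n => r ^+ n) @ \oo --> (0 : R).
  by apply: cvg_expr; rewrite ger0_norm.
move=> /cvgrPdist_lt /(_ _ eA); apply: filterS => N /=.
rewrite sub0r normrN ger0_norm ?exprn_ge0// => rN.
have cS x : rcont (fun x => \sum_(n < N) u n x) x by apply: clim_sum => n; exact: cu.
rewrite -cint_sum; last by move=> i x; exact: cu.
rewrite cdistC -mulN1r -cintZ// -cintD//; last first.
  by move=> x; apply: rcontM (cS x); exact: rcont_cst.
apply: (@le_lt_trans _ _ (K * r ^+ N / (1 - r) * (b - a))).
  apply: cint_le => // [x|x _].
    by apply: rcontD (cs x) _; apply: rcontM (cS x); exact: rcont_cst.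
  by rewrite mulN1r; exact: rem.
have -> : K * r ^+ N / (1 - r) * (b - a) = (A - 1) * r ^+ N.
  by rewrite /A addrK; field; rewrite gt_eqF.
move: rN; rewrite ltr_pdivlMr// => rN; apply: le_lt_trans rN.
by rewrite mulrC ler_wpM2l ?exprn_ge0// lerBlDr lerDl.
Qed.

(** The second order remainders of the exponentials, bounded by [cexp_sub1D_le], sum to a multiple
    of |w|^2. The single hypothesis dominates the terms, their derivatives and these remainders for
    |w| <= s. The point 0 is no restriction: an exponential at another point is absorbed in [c]. *)
Lemma cderiv_csum (c B : nat -> C) K r s : 0 < s ->
  gdom (fun n => ((cnorm (c n)) * (1 + cnorm (B n)) ^+ 2 * expR (cnorm (B n) * s))%:C) K r ->
  cderiv (fun w => csum (fun n => c n * cexp (B n * w))) 0 (csum (fun n => c n * B n)).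
Proof.
move=> s0 H; have [r0 r1 HK] := H.
have D n : (cnorm (c n)) * (1 + cnorm (B n)) ^+ 2 * expR (cnorm (B n) * s) <= K * r ^+ n.
  have := HK n; rewrite cnorm_real ger0_norm//.
  by rewrite !mulr_ge0 ?cnorm_ge0 ?sqr_ge0 ?expR_ge0 ?addr_ge0 ?cnorm_ge0.
have K0 : 0 <= K by have := HK 0%N; rewrite expr0 mulr1; apply: le_trans (cnorm_ge0 _).
have r10 : 0 < 1 - r by rewrite subr_gt0.
have B1 n : 1 <= 1 + cnorm (B n) by rewrite lerDl cnorm_ge0.
have sq n : cnorm (B n) ^+ 2 <= (1 + cnorm (B n)) ^+ 2.
  by rewrite lerXn2r ?nnegrE ?cnorm_ge0 ?addr_ge0 ?cnorm_ge0// lerDr.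
have G0 w : cnorm w <= s -> gdom (fun n => c n * cexp (B n * w)) K r.
  move=> ws; split=> // n; apply: le_trans (D n); rewrite cnormM cnorm_cexp.
  rewrite ler_pM ?cnorm_ge0 ?expR_ge0//; first by rewrite ler_peMr ?cnorm_ge0// exprn_ege1.
  rewrite ler_expR; apply: le_trans (ler_norm _) _; apply: le_trans (cnorm_Re _) _.
  by rewrite cnormM ler_wpM2l ?cnorm_ge0.
have G1 : gdom (fun n => c n * B n) K r.
  split=> // n; apply: le_trans (D n); rewrite cnormM -[leLHS]mulr1.
  apply: ler_pM; rewrite ?mulr_ge0 ?cnorm_ge0//; last first.
    by rewrite -expR0 ler_expR mulr_ge0 ?cnorm_ge0// ltW.
  rewrite ler_wpM2l ?cnorm_ge0//; have := cnorm_ge0 (B n); nra.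
apply/cderivP => e e0.
pose A := 5 * K / (1 - r) + 1.
have A0 : 0 < A by rewrite ltr_wpDl// divr_ge0 ?mulr_ge0// ltW.
exists (Num.min s (e / A)); first by rewrite lt_min s0 divr_gt0.
move=> w; rewrite subr0 lt_min => /andP[/ltW ws /ltW weA] /=; rewrite subr0.
have -> : csum (fun n => c n * cexp (B n * w)) - csum (fun n => c n * cexp (B n * 0)) -
    csum (fun n => c n * B n) * w =
    csum (fun n => c n * (cexp (B n * w) - 1 - B n * w)).
  have G00 := G0 0; rewrite cnorm0 in G00.
  rewrite [_ * w]mulrC -(csumZ _ G1) -(csumB (G0 _ ws) (G00 (ltW s0))).
  have [_ _ k0] := gdomZ w G1.
  have Gw : gdom (fun n => w * (c n * B n)) (cnorm w * K) r by exact: gdomZ.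
  have [_ _ k1] := gdomD (G0 _ ws) (gdomZ (-1) (G00 (ltW s0))).
  rewrite -(@csumB _ _ (K + cnorm (-1) * K) (cnorm w * K) r)//; last first.
    by split=> // n; have := k1 n; rewrite mulN1r.
  by congr csum; apply/funext => n; rewrite mulr0 cexp0; ring.
have G : gdom (fun n => c n * (cexp (B n * w) - 1 - B n * w)) (5 * K * cnorm w ^+ 2) r.
  split=> // n; rewrite cnormM.
  apply: le_trans (ler_wpM2l (cnorm_ge0 _) (cexp_sub1D_le _)) _.
  rewrite cnormM exprMn.
  have E1 : expR (cnorm (B n) * cnorm w) <= expR (cnorm (B n) * s).
    by rewrite ler_expR ler_wpM2l ?cnorm_ge0.
  have c0 := cnorm_ge0 (c n); have w2 : 0 <= cnorm w ^+ 2 by rewrite sqr_ge0.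
  apply: (@le_trans _ _ (5 * cnorm w ^+ 2 * (cnorm (c n) * (1 + cnorm (B n)) ^+ 2 *
    expR (cnorm (B n) * s)))).
    rewrite [leLHS](_ : _ = 5 * cnorm w ^+ 2 * (cnorm (c n) * cnorm (B n) ^+ 2 *
      expR (cnorm (B n) * cnorm w))); last by ring.
    apply: ler_wpM2l; first by rewrite mulr_ge0.
    apply: ler_pM E1; rewrite ?expR_ge0//; first by rewrite mulr_ge0 ?sqr_ge0.
    by rewrite ler_wpM2l.
  rewrite [leRHS](_ : _ = 5 * cnorm w ^+ 2 * (K * r ^+ n)); last by ring.
  by apply: ler_wpM2l (D n); rewrite mulr_ge0.
apply: le_trans (csum_le G) _.
have -> : 5 * K * cnorm w ^+ 2 / (1 - r) = (A - 1) * cnorm w * cnorm w.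
  by rewrite /A addrK; field; rewrite gt_eqF.
rewrite ler_wpM2r ?cnorm_ge0//; move: weA; rewrite ler_pdivlMr// => weA.
by apply: le_trans weA; rewrite mulrC ler_wpM2l ?cnorm_ge0// lerBlDr lerDl.
Qed.

(** At most geometric growth; this covers the polynomial and exponential factors that multiply a
    Gaussian. *)
Definition ggrow (g : nat -> R) := exists A L : R,
  [/\ 0 <= A, 0 <= L & forall n, 0 <= g n <= A * L ^+ n].

Lemma ggrow_cst (a : R) : 0 <= a -> ggrow (fun=> a).
Proof. by move=> a0; exists a, 1; split=> // n; rewrite a0 expr1n mulr1 lexx. Qed.

Lemma ggrowM g h : ggrow g -> ggrow h -> ggrow (fun n => g n * h n).
Proof.
move=> [A [L [A0 L0 H]]] [A' [L' [A0' L0' H']]].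
exists (A * A'), (L * L'); split; rewrite ?mulr_ge0// => n.
have /andP[g0 g1] := H n; have /andP[h0 h1] := H' n.
by rewrite mulr_ge0//= exprMn mulrACA ler_pM.
Qed.

Lemma ggrowX g m : ggrow g -> ggrow (fun n => g n ^+ m).
Proof.
move=> H; elim: m => [|m IH]; first exact: ggrow_cst.
have := ggrowM H IH; congr ggrow; apply/funext => n; rewrite exprS //.
Qed.

Lemma ggrow_le g h : (forall n, 0 <= g n <= h n) -> ggrow h -> ggrow g.
Proof.
move=> H [A [L [A0 L0 H']]]; exists A, L; split=> // n.
by have /andP[-> /le_trans->//] := H n; have /andP[] := H' n.
Qed.

Lemma ggrow_nat : ggrow (fun n => n.+1%:R).
Proof.
exists 1, 2; split=> // n; rewrite ler0n mul1r -natrX ler_nat.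
exact: ltn_expl.
Qed.

Lemma ggrow_exp (a b : R) : ggrow (fun n => expR (a * n%:R + b)).
Proof.
exists (expR b), (expR a); split; rewrite ?expR_ge0// => n.
by rewrite expR_ge0/= expRD mulrC expRM_natr.
Qed.

(** Completing the square: n t - beta n^2 <= t^2 / (4 beta), where t is the logarithm of twice the
    growth rate. The factor 2 in [t] pays for the ratio 1/2. *)
Lemma gauss_dom g (beta : R) : ggrow g -> 0 < beta ->
  exists2 K : R, 0 <= K & forall n, g n * expR (- (beta * n%:R ^+ 2)) <= K * 2^-1 ^+ n.
Proof.
move=> [A [L [A0 L0 H]]] b0.
pose t := ln (2 * (L + 1)); have L1 : 0 < 2 * (L + 1) by rewrite mulr_gt0// ltr_wpDl.
exists (A * expR (t ^+ 2 / (4 * beta))); first by rewrite mulr_ge0 ?expR_ge0.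
move=> n; have /andP[g0 g1] := H n.
rewrite exprVn -ler_pdivrMr ?invr_gt0 ?exprn_gt0// invrK.
apply: (@le_trans _ _ (A * ((2 * (L + 1)) ^+ n * expR (- (beta * n%:R ^+ 2))))).
  rewrite (_ : _ * _ * 2 ^+ n = g n * 2 ^+ n * expR (- (beta * n%:R ^+ 2))); last by ring.
  rewrite mulrA ler_wpM2r ?expR_ge0// exprMn (mulrC (2 ^+ n)) mulrA.
  rewrite ler_wpM2r ?exprn_ge0//; apply: le_trans g1 _; rewrite ler_wpM2l//.
  by rewrite lerXn2r ?nnegrE ?addr_ge0// lerDl.
rewrite ler_wpM2l// -[2 * (L + 1)]lnK ?posrE// -/t -expRM_natl -expRD ler_expR.
rewrite ler_pdivlMr ?mulr_gt0//.
have : 0 <= (t - 2 * beta * n%:R) ^+ 2 by exact: sqr_ge0.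
by rewrite (_ : _ ^+ 2 = t ^+ 2 - (n%:R * t - beta * n%:R ^+ 2) * (4 * beta)); [lra|ring].
Qed.

End DominatedSeries.

#[local] Opaque ee cexp.


(** * The theta series, its z-derivatives and its translation laws *)

Section ThetaSeries.
Variable R : realType.
Local Notation C := R[i].
Local Notation Re := complex.Re.
Local Notation Im := complex.Im.
Local Notation tpi := (tpi R).
Implicit Types (tau z : C) (n j : nat).

(** With h = n + 1/2 one has n(n+1)/2 + 1/8 = h^2/2, so the prefactor q^(1/8) zeta^(1/2) of theta is
    absorbed and the sum runs over half-integers. *)
Definition hn n : R := n%:R + 2^-1.

Lemma hn_ge0 n : 0 <= hn n. Proof. by rewrite addr_ge0// invr_ge0. Qed.
Lemma hnC n : (hn n)%:C = n%:R + 2^-1.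
Proof. by rewrite rmorphD fmorphV !rmorph_nat. Qed.
Lemma hnS n : hn n.+1 = hn n + 1.
Proof. by rewrite /hn -natr1 addrAC. Qed.

Definition sterm j tau z n : C :=
  (-1) ^+ n * (tpi * (hn n)%:C) ^+ j * ee (((hn n) ^+ 2 / 2)%:C * tau + (hn n)%:C * z).

Lemma cnorm_sterm j tau z n : cnorm (sterm j tau z n) =
  (2 * pi * hn n) ^+ j * expR (- (2 * pi * (hn n ^+ 2 / 2 * Im tau + hn n * Im z))).
Proof.
rewrite /sterm cnormM cnorm_ee cnormM !cnormX cnormN cnorm1 expr1n mul1r cnormM.
rewrite cnorm_tpi cnorm_real (ger0_norm (hn_ge0 n)); congr (_ * expR (- (_ * _))).
by rewrite cImD !cImM /=; ring.
Qed.

Lemma hn_le n : hn n <= n.+1%:R.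
Proof. by rewrite /hn -[n.+1%:R]natr1 lerD2l invf_le1 ?ler1n. Qed.

Lemma hn_ggrow : ggrow hn.
Proof. by apply: ggrow_le (ggrow_nat R) => n; rewrite hn_ge0 hn_le. Qed.

Lemma hn_exp_ggrow (a : R) : ggrow (fun n => expR (a * hn n)).
Proof.
have := ggrow_exp a (a / 2); congr ggrow; apply/funext => n.
by rewrite /hn mulrDr.
Qed.

Lemma gauss_hn (g : nat -> R) (beta : R) : ggrow g -> 0 < beta ->
  exists2 K : R, 0 <= K & forall n, g n * expR (- (beta * hn n ^+ 2)) <= K * 2^-1 ^+ n.
Proof.
move=> gg b0; have [K K0 HK] := gauss_dom gg b0; exists K => // n.
apply: le_trans (HK n); have [A [L [_ _ /(_ n)/andP[g0 _]]]] := gg.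
rewrite ler_wpM2l// ler_expR lerN2 ler_pM2l//.
by rewrite lerXn2r ?nnegrE ?hn_ge0// /hn lerDl invr_ge0.
Qed.

Lemma half01 : 0 <= 2^-1 :> R /\ 2^-1 < 1 :> R.
Proof. by rewrite invr_ge0 invf_lt1 ?ltr1n. Qed.

Lemma sterm_gdom j tau z : 0 < Im tau -> exists K, gdom (sterm j tau z) K 2^-1.
Proof.
move=> yt; have p0 := pi_gt0 R; have p20 : 0 <= 2 * pi :> R by rewrite mulr_ge0// ltW.
have gg := ggrowM (ggrowX j (ggrowM (ggrow_cst p20) hn_ggrow))
  (hn_exp_ggrow (- (2 * pi * Im z))).
have [K K0 HK] := gauss_hn gg (mulr_gt0 p0 yt).
exists K; split; try by case: half01.
move=> n; rewrite cnorm_sterm; apply: le_trans (HK n).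
rewrite le_eqVlt; apply/orP; left; apply/eqP.
by rewrite -[RHS]mulrA -expRD; congr (_ * expR _); field.
Qed.

Definition SS j tau z := csum (sterm j tau z).
(** This is the j-th z-derivative of theta. The index -n-1 carries the half-integer -h and the
    opposite sign, so the negative half of the bilateral sum is [- SS 0 tau (- z)]. *)
Definition TH j tau z := SS j tau z - (-1) ^+ j * SS j tau (- z).

Lemma cderiv_at0 (h : C -> C) z d : cderiv (fun w => h (z + w)) 0 d -> cderiv h z d.
Proof.
move=> H; have := @cderiv_comp _ (fun w => h (z + w)) (fun w => 1 * w + - z) z d 1.
rewrite mul1r subrr mulr1 => /(_ H (cderiv_affine _ _ _)).
by apply: cderiv_ext; apply: filterE => w /=; congr h; ring.
Qed.

Lemma cderiv_SS j tau z : 0 < Im tau -> cderiv (SS j tau) z (SS j.+1 tau z).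
Proof.
move=> yt; apply: cderiv_at0.
pose B n := tpi * (hn n)%:C.
have nB n : cnorm (B n) = 2 * pi * hn n.
  by rewrite cnormM cnorm_tpi cnorm_real ger0_norm// hn_ge0.
have p0 := pi_gt0 R; have pi20 : 0 <= 2 * pi :> R by rewrite mulr_ge0// ltW.
have gB : ggrow (fun n => 2 * pi * hn n) by exact: ggrowM (ggrow_cst pi20) hn_ggrow.
have gg : ggrow (fun n => (2 * pi * hn n) ^+ j * expR (- (2 * pi * Im z) * hn n) *
    (1 + 2 * pi * hn n) ^+ 2 * expR (2 * pi * hn n)).
  apply: ggrowM; last exact: hn_exp_ggrow.
  apply: ggrowM; first by apply: ggrowM; [exact: ggrowX|exact: hn_exp_ggrow].
  apply: ggrowX; apply: (@ggrow_le _ _ (fun n => (1 + 2 * pi * 2) * n.+1%:R)).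
    move=> n; rewrite addr_ge0 ?mulr_ge0 ?hn_ge0 ?(ltW p0)//=.
    have n1 := hn_le n.
    rewrite [leRHS]mulrDl mul1r; apply: lerD; first by rewrite ler1n.
    by rewrite -[leRHS]mulrA ler_wpM2l// (le_trans n1)// ler_peMl ?ler1n.
  apply: (@ggrowM _ (fun=> 1 + 2 * pi * 2) (fun n => n.+1%:R) _ (ggrow_nat R)).
  apply: ggrow_cst.
  by rewrite addr_ge0// mulr_ge0.
have [|K K0 HK] := gauss_hn gg (_ : 0 < pi * Im tau); first by rewrite mulr_gt0.
have D := @cderiv_csum _ (sterm j tau z) B K 2^-1 1 ltr01.
have {}D := D (And3 _ _ _).
have h1 : 0 <= 2^-1 :> R := half01.1; have h2 : 2^-1 < 1 :> R := half01.2.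
have h3 n : cnorm ((cnorm (sterm j tau z n) * (1 + cnorm (B n)) ^+ 2 *
    expR (cnorm (B n) * 1))%:C : C) <= K * 2^-1 ^+ n.
  rewrite cnorm_real ger0_norm; last first.
    by rewrite !mulr_ge0 ?cnorm_ge0 ?sqr_ge0 ?expR_ge0 ?addr_ge0 ?cnorm_ge0.
  apply: le_trans (HK n); rewrite cnorm_sterm nB mulr1.
  rewrite le_eqVlt; apply/orP; left; apply/eqP.
  rewrite (_ : - (2 * pi * (hn n ^+ 2 / 2 * Im tau + hn n * Im z)) =
    (- (2 * pi * Im z) * hn n) + - (pi * Im tau * hn n ^+ 2)); last by field.
  by rewrite expRD; ring.
have {}D := D h1 h2 h3.
apply: cderiv_eq (cderiv_ext _ D) _.
  apply: filterE => w /=; congr csum; apply/funext => n; rewrite /sterm /B.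
  rewrite (_ : cexp _ = ee ((hn n)%:C * w)); last by rewrite eeE mulrA.
  by rewrite -[LHS]mulrA -eeD; congr (_ * ee _); ring.
rewrite /SS; congr csum; apply/funext => n; rewrite /sterm /B (exprSr (tpi * _)); ring.
Qed.

Lemma cderiv_TH j tau z : 0 < Im tau -> cderiv (TH j tau) z (TH j.+1 tau z).
Proof.
move=> yt.
have := @cderiv_comp _ (SS j tau) (fun w => -1 * w + 0) z _ _
  (cderiv_SS j (-1 * z + 0) yt) (cderiv_affine (-1) 0 z) => D2.
apply: cderiv_eq (cderiv_ext _ (cderivB (cderiv_SS j z yt) (cderivZ ((-1) ^+ j) D2))) _.
  by apply: filterE => w /=; rewrite /TH addr0 mulN1r.
by rewrite /TH addr0 mulN1r exprS; ring.
Qed.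

Lemma thetaE tau z : 0 < Im tau -> theta tau z = TH 0 tau z.
Proof.
move=> yt; have [K1 G1] := sterm_gdom 0 z yt; have [K2 G2] := sterm_gdom 0 (- z) yt.
have c0 : ee (tau / 8) * ee (z / 2) != 0 by rewrite mulf_neq0 ?ee_neq0.
have sqC n : (hn n ^+ 2 / 2)%:C = (n * n.+1)%N%:R / 2 + 8^-1 :> C.
  have -> : hn n ^+ 2 / 2 = (n * n.+1)%N%:R / 2 + 8^-1.
    by rewrite /hn natrM -[n.+1%:R]natr1; field.
  by rewrite rmorphD rmorphM !fmorphV !rmorph_nat.
have t3 n w : ee ((hn n ^+ 2 / 2)%:C * tau + (hn n)%:C * w) =
    ee (tau / 8) * ee (w / 2) * ee ((n * n.+1)%N%:R / 2 * tau) * ee (n%:R * w).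
  by rewrite -!eeD; congr ee; rewrite sqC hnC; field.
have E1 : (fun n : nat => theta_term tau z (Posz n)) =
    (fun n => (ee (tau / 8) * ee (z / 2))^-1 * sterm 0 tau z n).
  apply/funext => n; apply: (mulfI c0); rewrite mulVKf// /theta_term /sterm t3.
  have -> : (Posz n * (Posz n + 1))%:~R = (n * n.+1)%N%:R :> C.
    by rewrite -[RHS]/((Posz (n * n.+1))%:~R); congr (_%:~R); lia.
  by rewrite -exprnP (exprNn (ee z)) -eeMn; ring.
have E2 : (fun n : nat => theta_term tau z (Negz n)) =
    (fun n => (ee (tau / 8) * ee (z / 2))^-1 * (- 1 * sterm 0 tau (- z) n)).
  apply/funext => n; apply: (mulfI c0); rewrite mulVKf// /theta_term /sterm t3.
  have -> : (Negz n * (Negz n + 1))%:~R = (n * n.+1)%N%:R :> C.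
    by rewrite -[RHS]/((Posz (n * n.+1))%:~R); congr (_%:~R); lia.
  have -> : (- ee z) ^ Negz n = -1 * (-1) ^+ n * ee (- (n.+1%:R * z)).
    by rewrite NegzE -exprnN (exprNn (ee z)) invfM -eeMn -eeN -exprVn invrN1 exprS; ring.
  have -> : ee (z / 2) = ee (- z / 2) * ee z by rewrite -eeD; congr ee; field.
  have -> : ee (- (n.+1%:R * z)) = ee (n%:R * - z) * (ee z)^-1.
    by rewrite -eeN -eeD; congr ee; rewrite -[n.+1%:R]natr1; ring.
  by field; exact: ee_neq0.
rewrite /theta E1 E2 -!/(csum _) (csumZ _ G1) (csumZ _ (gdomZ _ G2)) (csumZ _ G2).
by rewrite -mulrDr mulrA mulfV// mul1r /TH expr0 mul1r mulN1r.
Qed.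

Lemma derive1n_theta j tau z : 0 < Im tau -> derive1n j (theta tau) z = TH j tau z.
Proof.
move=> yt; elim: j z => [|j IH] z; first by rewrite derive1n0 thetaE.
rewrite derive1nS (_ : derive1n j (theta tau) = TH j tau); last exact/funext.
exact: cderiv_derive1 (cderiv_TH j z yt).
Qed.

Lemma TH_opp j tau z : TH j tau (- z) = - (-1) ^+ j * TH j tau z.
Proof.
have ss : (-1) ^+ j * (-1) ^+ j = 1 :> C by rewrite -exprD -signr_odd oddD addbb.
rewrite /TH opprK; transitivity ((-1) ^+ j * (-1) ^+ j * SS j tau (- z) - (-1) ^+ j * SS j tau z).
  by rewrite ss mul1r.
by ring.
Qed.

Lemma TH_add1 j tau z : 0 < Im tau -> TH j tau (z + 1) = - TH j tau z.
Proof.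
move=> yt.
have E (s : bool) z' : SS j tau (z' + (-1) ^+ s) = - SS j tau z'.
  have [K G] := sterm_gdom j z' yt; rewrite -[RHS]mulN1r /SS -(csumZ _ G).
  congr csum; apply/funext => n.
  have e1 : ee ((hn n)%:C * (-1) ^+ s) = -1.
    rewrite hnC mulrDl eeD; case: s; rewrite ?expr1 ?expr0 ?mulrN1 ?mulr1.
      by rewrite !eeN ee_nat ee_half invr1 mul1r invrN1.
    by rewrite ee_nat ee_half mul1r.
  by rewrite /sterm mulrDr addrA eeD e1; ring.
have := E false z; rewrite /= expr0 => E1; have := E true (- z); rewrite expr1 => E2.
by rewrite /TH opprD E1 E2; ring.
Qed.

(** The translation shifts the half-integers by one: the term [sterm 0 tau z 0] leaves one half of
    the series and enters the other, and the two occurrences cancel. *)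
Lemma TH0_addtau tau z : 0 < Im tau ->
  TH 0 tau (z + tau) = - ee (- (tau / 2) - z) * TH 0 tau z.
Proof.
move=> yt; have [K1 G1] := sterm_gdom 0 z yt; have [K2 G2] := sterm_gdom 0 (- z) yt.
have [K4 G4] := sterm_gdom 0 (- (z + tau)) yt.
set E := ee (- (tau / 2) - z).
have h2 : (2^-1 : R)%:C = 2^-1 :> C by rewrite fmorphV rmorph_nat.
have A : SS 0 tau (z + tau) = - E * (SS 0 tau z - sterm 0 tau z 0).
  rewrite {2}/SS (csumS G1) addrAC subrr add0r /SS -(csumZ _ (gdomS G1)).
  congr csum; apply/funext => n; rewrite /sterm [(-1) ^+ n.+1]exprS.
  have -> : ee ((hn n ^+ 2 / 2)%:C * tau + (hn n)%:C * (z + tau)) =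
      E * ee ((hn n.+1 ^+ 2 / 2)%:C * tau + (hn n.+1)%:C * z).
    rewrite -eeD hnS; congr ee.
    by rewrite !(rmorphD, rmorphM, rmorphXn) /= h2 rmorph1; field.
  by ring.
have B : SS 0 tau (- (z + tau)) = E * (sterm 0 tau z 0 - SS 0 tau (- z)).
  rewrite {1}/SS (csumS G4) mulrBr; congr (_ + _).
    have h0 : (hn 0)%:C = 2^-1 by rewrite hnC add0r.
    have h02 : (hn 0 ^+ 2 / 2)%:C = 8^-1 :> C by rewrite rmorphM rmorphXn /= h0 h2; field.
    rewrite /sterm !expr0 !mul1r -eeD; congr ee.
    by rewrite h02 h0; field.
  rewrite -mulNr /SS -(csumZ _ G2).
  congr csum; apply/funext => n; rewrite /sterm [(-1) ^+ n.+1]exprS.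
  have -> : ee ((hn n.+1 ^+ 2 / 2)%:C * tau + (hn n.+1)%:C * - (z + tau)) =
      E * ee ((hn n ^+ 2 / 2)%:C * tau + (hn n)%:C * - z).
    rewrite -eeD hnS; congr ee.
    by rewrite !(rmorphD, rmorphM, rmorphXn) /= h2 rmorph1; field.
  by ring.
rewrite /TH expr0 !mul1r A B; ring.
Qed.

Lemma TH_addtau1 j tau z : 0 < Im tau ->
  TH j (tau + 1) z = ee (8^-1) * TH j tau z.
Proof.
move=> yt.
have E z' : SS j (tau + 1) z' = ee (8^-1) * SS j tau z'.
  have [K G] := sterm_gdom j z' yt; rewrite /SS -(csumZ _ G).
  congr csum; apply/funext => n; rewrite /sterm [RHS]mulrCA; congr (_ * _).
  rewrite mulrDr addrAC eeD mulrC; congr (_ * _); rewrite mulr1.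
  have -> : hn n ^+ 2 / 2 = ((n * n.+1)./2)%:R + 8^-1.
    have : (n * n.+1)%N%:R = ((n * n.+1)./2)%:R * 2 :> R.
      by rewrite -natrM muln2 even_halfK// oddM /= andbN.
    move=> E; apply: (mulIf (_ : 2 != 0)); first by rewrite pnatr_eq0.
    by rewrite mulrDl -E /hn natrM -[n.+1%:R]natr1; field.
  by rewrite rmorphD fmorphV !rmorph_nat eeD ee_nat mul1r.
by rewrite /TH !E; ring.
Qed.

(* The zeroth Fourier coefficient of e(-z/2) theta(z) is e(tau/8). *)
Lemma TH0_nonzero tau : 0 < Im tau -> exists z, TH 0 tau z != 0.
Proof.
move=> yt; apply: contrapT => /forallNP H0.
have {}H0 z : TH 0 tau z = 0 by apply/eqP; apply: contrapT => /negP; exact: H0.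
pose u n (x : R) := (sterm 0 tau x%:C n - sterm 0 tau (- x%:C) n) * ee (- (x%:C / 2)).
have nst (x : R) (b : bool) n :
    cnorm (sterm 0 tau ((-1) ^+ b * x%:C) n) = cnorm (sterm 0 tau 0 n).
  have im0 : Im ((-1) ^+ b * x%:C) = 0.
    by case: b; rewrite ?expr1 ?expr0 ?mulN1r ?mul1r /= ?oppr0.
  by rewrite !cnorm_sterm im0.
have [K G] := sterm_gdom 0 0 yt; have [r0 r1 GK] := G.
have gu x : gdom (u^~ x) (K + K) 2^-1.
  split=> // n; rewrite /u cnormM (_ : cnorm (ee _) = 1); last first.
    rewrite (_ : - (x%:C / 2) = (- 2^-1)%:C * x%:C) ?cnorm_ee_real//.
    by rewrite rmorphN fmorphV rmorph_nat; ring.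
  rewrite mulr1 mulrDl; apply: le_trans (cnormB _ _) _; apply: lerD.
    by have := nst x false n; rewrite expr0 mul1r => ->.
  by have := nst x true n; rewrite expr1 mulN1r => ->.
have cu n x : rcont (u n) x.
  have ce (a b : C) y : rcont (fun x : R => ee (a * x%:C + b)) y.
    exact: (@rcont_real_line _ (fun w => ee (a * w + b)) y (ccont_ee_affine a b _)).
  have cs (a : C) y : rcont (fun x : R => sterm 0 tau (a * x%:C) n) y.
    apply: rcontM (rcont_cst _ _) _; have := ce ((hn n)%:C * a) (((hn n) ^+ 2 / 2)%:C * tau) y.
    rewrite /rcont addrC -mulrA; apply: clim_ext; apply: filterE => t /=.
    by rewrite addrC mulrA.
  apply: rcontM.
    have c1 : rcont (fun t => sterm 0 tau t%:C n) x.
      have := cs 1 x; rewrite /rcont mul1r; apply: clim_ext.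
      by apply: filterE => t /=; rewrite mul1r.
    have c2 : rcont (fun t => sterm 0 tau (- t%:C) n) x.
      have := cs (-1) x; rewrite /rcont mulN1r; apply: clim_ext.
      by apply: filterE => t /=; rewrite mulN1r.
    exact: (climB c1 c2).
  have := rcont_ee (- 2^-1) x; rewrite /rcont mulNr mulrC; apply: clim_ext.
  by apply: filterE => t /=; rewrite mulNr mulrC.
have su x : csum (u^~ x) = 0.
  have [K1 G1] := sterm_gdom 0 x%:C yt; have [K2 G2] := sterm_gdom 0 (- x%:C) yt.
  have := H0 x%:C; rewrite /TH expr0 mul1r /SS -(csumB G1 G2).
  have GB := gdomD G1 (gdomZ (-1) G2).
  have {}GB : gdom (fun n => sterm 0 tau x%:C n - sterm 0 tau (- x%:C) n) (K1 + cnorm (-1) * K2) 2^-1.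
    by case: GB => ? ? c; split=> // n; have := c n; rewrite mulN1r.
  move=> E; rewrite /u (_ : (fun n => _) = fun n => ee (- (x%:C / 2)) *
    (sterm 0 tau x%:C n - sterm 0 tau (- x%:C) n)); last by apply/funext => n; rewrite mulrC.
  by rewrite (csumZ _ GB) E mulr0.
have := @csum_cint _ u (K + K) 2^-1 0 1 ler01 cu.
have -> : (fun x => csum (u^~ x)) = fun=> 0 by apply/funext.
move=> /(_ (fun x => rcont_cst _ _) gu).
have -> : cint (fun=> 0 : C) 0 1 = 0 :> C.
  by rewrite (@cintE _ _ (fun=> 0)) ?subrr// => x e e0; apply: filterE => y /=;
    rewrite mul0r !subr0 cnorm0 mulr_ge0// ltW.
(* The n-th term has only the frequencies n and -n-1, so only n = 0 contributes to the constant
   coefficient. *)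
have ci n : cint (u n) 0 1 = (n == 0%N)%:R * ee (tau / 8).
  pose c := (-1) ^+ n * ee (((hn n) ^+ 2 / 2)%:C * tau).
  have cE (a : C) x : rcont (fun x : R => ee (a * x%:C)) x by exact: rcont_ee.
  have -> : u n = fun x => c * ee (- (- (Posz n))%:~R * x%:C) + - c * ee (- (Posz n.+1)%:~R * x%:C).
    apply/funext => x; rewrite /u /sterm /c; set A := (hn n ^+ 2 / 2)%:C * tau.
    have e1 : ee (A + (hn n)%:C * x%:C) * ee (- (x%:C / 2)) =
        ee A * ee (- (- Posz n)%:~R * x%:C).
      by rewrite -!eeD; congr ee; rewrite hnC mulrNz opprK -[(Posz n)%:~R]/(n%:R); field.
    have e2 : ee (A + (hn n)%:C * - x%:C) * ee (- (x%:C / 2)) =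
        ee A * ee (- (Posz n.+1)%:~R * x%:C).
      rewrite -!eeD; congr ee; rewrite hnC -[(Posz n.+1)%:~R]/(n.+1%:R) -[n.+1%:R]natr1.
      by field.
    transitivity ((-1) ^+ n * (ee (A + (hn n)%:C * x%:C) * ee (- (x%:C / 2))) -
      (-1) ^+ n * (ee (A + (hn n)%:C * - x%:C) * ee (- (x%:C / 2)))); first by ring.
    by rewrite e1 e2; ring.
  rewrite cintD; try by move=> x; apply: rcontM (rcont_cst _ _) _; exact: cE.
  have F r (b : C) : cint (fun x : R => b * ee (- r%:~R * x%:C)) 0 1 = b * (r == 0)%:R.
    exact: (fcoef_cst b r).
  rewrite !F /= mulr0 addr0 oppr_eq0 eqz_nat /c; have [->|] := eqVneq n 0%N.
    rewrite expr0 !mul1r mulr1; congr ee.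
    have -> : hn 0 ^+ 2 / 2 = 8^-1 by rewrite /hn add0r; field.
    by rewrite fmorphV rmorph_nat mulrC.
  by rewrite mulr0 mul0r.
have -> : (fun N => \sum_(n < N) cint (u n) 0 1) = fun N => (0 < N)%N%:R * ee (tau / 8).
  apply/funext => -[|N]; first by rewrite big_ord0 mul0r.
  rewrite big_ord_recl ci mul1r big1 ?addr0 ?mul1r// => i _.
  by rewrite ci /= mul0r.
have e0 : 0 < cnorm (ee (tau / 8)) by rewrite cnorm_gt0 ee_neq0.
move=> /(_ _ e0)[N _ /(_ N.+1 (leqnSn N)) /=].
by rewrite mul1r subr0 ltxx.
Qed.

End ThetaSeries.


(** * Theta as a function of tau: holomorphy and behaviour at the cusp *)

Section ThetaTau.
Variable R : realType.
Local Notation C := R[i].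
Local Notation Re := complex.Re.
Local Notation Im := complex.Im.
Local Notation tpi := (tpi R).
Local Notation hn := (@hn R).
Implicit Types (tau z w : C) (n j : nat).

Lemma cdiff_SS_tau j z tau : 0 < Im tau -> cdiff (fun t => SS j t z) tau.
Proof.
move=> yt; eexists; apply: cderiv_at0.
pose B n : C := tpi * (hn n ^+ 2 / 2)%:C.
have nB n : cnorm (B n) = pi * hn n ^+ 2.
  have h : 0 <= hn n ^+ 2 / 2 by rewrite divr_ge0 ?sqr_ge0.
  by rewrite cnormM cnorm_tpi cnorm_real (ger0_norm h); field.
have p0 := pi_gt0 R; have pi20 : 0 <= 2 * pi :> R by rewrite mulr_ge0// ltW.
have gB : ggrow (fun n => 2 * pi * hn n) by exact: ggrowM (ggrow_cst pi20) (hn_ggrow R).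
have gg : ggrow (fun n => (2 * pi * hn n) ^+ j * expR (- (2 * pi * Im z) * hn n) *
    (1 + pi * hn n ^+ 2) ^+ 2).
  apply: ggrowM; first by apply: ggrowM; [exact: ggrowX|exact: hn_exp_ggrow].
  apply: ggrowX; apply: (@ggrow_le _ _ (fun n => (1 + pi) * n.+1%:R ^+ 2)).
    move=> n; have pp : 0 <= pi * hn n ^+ 2 by rewrite mulr_ge0 ?sqr_ge0// ltW.
    rewrite addr_ge0//=.
    have n1 := hn_le R n; rewrite [leRHS]mulrDl mul1r; apply: lerD.
      by rewrite -natrX ler1n expn_gt0.
    by rewrite ler_wpM2l ?(ltW p0)// lerXn2r ?nnegrE ?hn_ge0.
  apply: (@ggrowM _ (fun=> 1 + pi) (fun n => n.+1%:R ^+ 2)).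
    by apply: ggrow_cst; rewrite addr_ge0// ltW.
  by apply: ggrowX; exact: ggrow_nat.
(* Moving [tau] by at most [Im tau / 2] leaves half of the Gaussian decay. *)
have s0 : 0 < Im tau / 2 by rewrite divr_gt0.
have [K K0 HK] := gauss_hn gg (mulr_gt0 p0 s0).
have h3 n : cnorm ((cnorm (sterm j tau z n) * (1 + cnorm (B n)) ^+ 2 *
    expR (cnorm (B n) * (Im tau / 2)))%:C : C) <= K * 2^-1 ^+ n.
  rewrite cnorm_real ger0_norm; last first.
    by rewrite !mulr_ge0 ?cnorm_ge0 ?sqr_ge0 ?expR_ge0 ?addr_ge0 ?cnorm_ge0.
  apply: le_trans (HK n); rewrite cnorm_sterm nB.
  rewrite le_eqVlt; apply/orP; left; apply/eqP.
  rewrite (_ : - (2 * pi * (hn n ^+ 2 / 2 * Im tau + hn n * Im z)) =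
    (- (2 * pi * Im z) * hn n) + - (pi * (Im tau / 2) * hn n ^+ 2) +
    - (pi * hn n ^+ 2 * (Im tau / 2))); last by field.
  rewrite !expRD [expR (- (pi * hn n ^+ 2 * _))]expRN.
  by field; rewrite gt_eqF ?expR_gt0.
have D := @cderiv_csum _ (sterm j tau z) B K 2^-1 _ s0 (And3 (half01 R).1 (half01 R).2 h3).
apply: cderiv_ext D.
apply: filterE => w /=; congr csum; apply/funext => n; rewrite /sterm /B.
rewrite (_ : cexp _ = ee ((hn n ^+ 2 / 2)%:C * w)); last by rewrite eeE mulrA.
by rewrite -[LHS]mulrA -eeD; congr (_ * ee _); ring.
Qed.

Lemma cdiff_TH_tau j z tau : 0 < Im tau -> cdiff (fun t => TH j t z) tau.
Proof.
move=> yt; apply: cdiffB; first exact: cdiff_SS_tau.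
by apply: cdiffM; [exact: cdiff_cst|exact: cdiff_SS_tau].
Qed.

(** A term of a half theta series with the exponent of q as a free parameter [E]. Multiplying by a
    power of q and substituting z = a tau + w only change [E], so one limit lemma handles every
    case. *)
Definition qterm j w (E : nat -> R) tau n : C :=
  (-1) ^+ n * (tpi * (hn n)%:C) ^+ j * ee ((hn n)%:C * w) * ee ((E n)%:C * tau).

Lemma SS_qterm j tau w (a b : R) : 0 < Im tau ->
  ee (b%:C * tau) * SS j tau (a%:C * tau + w) =
  csum (qterm j w (fun n => hn n ^+ 2 / 2 + a * hn n + b) tau).
Proof.
move=> yt; have [K G] := sterm_gdom j (a%:C * tau + w) yt.
rewrite /SS -(csumZ _ G); congr csum; apply/funext => n; rewrite /sterm /qterm.
set P := _ ^+ j; set X := ee (_ + _).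
have e : ee (b%:C * tau) * X =
    ee ((hn n)%:C * w) * ee ((hn n ^+ 2 / 2 + a * hn n + b)%:C * tau).
  by rewrite /X -!eeD !(rmorphD, rmorphM) /=; congr ee; ring.
transitivity ((-1) ^+ n * P * (ee (b%:C * tau) * X)); first by ring.
by rewrite e; ring.
Qed.

Lemma cnorm_qterm j w E tau n : cnorm (qterm j w E tau n) =
  (2 * pi * hn n) ^+ j * expR (- (2 * pi * Im w) * hn n) * expR (- (2 * pi * E n * Im tau)).
Proof.
rewrite /qterm cnormM cnorm_ee cnormM cnorm_ee cnormM !cnormX cnormN cnorm1 expr1n mul1r.
rewrite cnormM cnorm_tpi cnorm_real (ger0_norm (hn_ge0 R n)) !cImM /=.
by congr (_ * expR _ * expR _); ring.
Qed.

(** The first term is free of q, and the others are dominated by a geometric series of ratio L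
    |q|^(1/2). *)
Lemma qterm_clim j w E : E 0%N = 0 -> (forall n, n%:R / 2 <= E n) ->
  clim (@icusp R) (fun tau => csum (qterm j w E tau)) (qterm j w E 0 0%N).
Proof.
move=> E0 En e e0; have p0 := pi_gt0 R; have p2 := pi_ge2 R.
have pi20 : 0 <= 2 * pi :> R by rewrite mulr_ge0// ltW.
have [A [L [A0 L0 HAL]]] : ggrow (fun n => (2 * pi * hn n) ^+ j *
    expR (- (2 * pi * Im w) * hn n)).
  apply: ggrowM; last exact: hn_exp_ggrow.
  by apply: ggrowX; exact: ggrowM (ggrow_cst pi20) (hn_ggrow R).
(* The summands ensure, in this order, a ratio at most 1/2, a positive height, and a tail below
   [e]. *)
exists (2 * L + 2 + 2 * A * L / e) => tau yt /=.
have AL : 0 <= 2 * A * L / e by rewrite divr_ge0 ?mulr_ge0// ltW.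
have y0 : 0 < Im tau by lra.
pose rho := expR (- (pi * Im tau)).
have r0 : 0 < rho by rewrite expR_gt0.
have rb : rho * (1 + Im tau) <= 1.
  rewrite /rho expRN mulrC ler_pdivrMr ?expR_gt0// mul1r.
  apply: le_trans (expR_ge1Dx _); rewrite lerD2l ler_peMl ?(ltW y0)//; lra.
have Lr : L * rho <= 2^-1.
  have : rho * (2 * L) <= rho * (1 + Im tau) by rewrite ler_pM2l//; lra.
  by move=> h; have := le_trans h rb; lra.
have G : gdom (qterm j w E tau) A (L * rho).
  split=> [||n]; [by rewrite mulr_ge0// ltW|by have := (half01 R).2; lra|].
  rewrite cnorm_qterm [leRHS](_ : _ = A * L ^+ n * rho ^+ n); last by rewrite exprMn mulrA.
  apply: ler_pM.
  - by have /andP[] := HAL n.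
  - exact: expR_ge0.
  - by have /andP[] := HAL n.
  - rewrite /rho -expRM_natl ler_expR.
    have : n%:R / 2 * (2 * pi * Im tau) <= E n * (2 * pi * Im tau).
      by rewrite ler_wpM2r// mulr_ge0// ltW.
    by lra.
have q0 : qterm j w E tau 0%N = qterm j w E 0 0%N by rewrite /qterm E0 !mul0r.
rewrite -q0; apply: le_lt_trans (csum_tail_le (gdomS G) (ex_intro _ A G)) _.
have Lr0 : 0 <= L * rho by rewrite mulr_ge0// ltW.
rewrite ltr_pdivrMr; last by lra.
have h1 : e / 2 <= e * (1 - L * rho) by rewrite ler_wpM2l ?(ltW e0)//; lra.
apply: lt_le_trans h1.
have h2 : rho * (2 * A * L / e) < rho * (1 + Im tau) by rewrite ltr_pM2l//; lra.
have := lt_le_trans h2 rb; rewrite mulrA ltr_pdivrMr// mul1r.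
by lra.
Qed.

Lemma hn_sqE n : hn n ^+ 2 / 2 - 8^-1 = (n%:R ^+ 2 + n%:R) / 2 :> R.
Proof. by rewrite /hn; field. Qed.

Lemma nat_sq_ge n : n%:R <= n%:R ^+ 2 :> R.
Proof. by case: n => [|n]; rewrite ?expr0n// expr2 ler_peMl ?ler1n. Qed.

(** The coefficient of q^(1/8) in [TH j], that is the j-th derivative of zeta^(1/2) -
    zeta^(-1/2). *)
Definition TH_lim j z : C := (tpi / 2) ^+ j * (ee (z / 2) - (-1) ^+ j * ee (- z / 2)).

Lemma TH_qterm j tau z : 0 < Im tau ->
  let E := fun n => hn n ^+ 2 / 2 + 0 * hn n - 8^-1 in
  ee (- (tau / 8)) * TH j tau z =
  csum (qterm j z E tau) - (-1) ^+ j * csum (qterm j (- z) E tau).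
Proof.
move=> yt E; have b8 : - (tau / 8) = (- 8^-1 : R)%:C * tau.
  by rewrite rmorphN fmorphV rmorph_nat; ring.
have K w : ee (- (tau / 8)) * SS j tau w = csum (qterm j w E tau).
  rewrite b8 -(SS_qterm j w 0 (- 8^-1) yt); congr (_ * SS _ _ _).
  by rewrite rmorph0 mul0r add0r.
by rewrite /TH mulrBr mulrCA !K.
Qed.

Lemma TH_cusp j z : clim (@icusp R) (fun tau => ee (- (tau / 8)) * TH j tau z) (TH_lim j z).
Proof.
pose E n : R := hn n ^+ 2 / 2 + 0 * hn n - 8^-1.
have E0 : E 0%N = 0 by rewrite /E /hn; field.
have En n : n%:R / 2 <= E n.
  by rewrite /E mul0r addr0 hn_sqE; have := nat_sq_ge n; have := ler0n R n; lra.
have L w := @qterm_clim j w E E0 En.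
have -> : TH_lim j z = qterm j z E 0 0%N - (-1) ^+ j * qterm j (- z) E 0 0%N.
  rewrite /qterm !mulr0 ee0 /TH_lim expr0 !mul1r !mulr1 hnC add0r.
  by rewrite (mulrC 2^-1 z) (mulrC 2^-1 (- z)); ring.
apply: clim_ext (climB (L z) (climM (clim_cst ((-1) ^+ j)) (L (- z)))).
by exists 0 => tau yt /=; rewrite TH_qterm.
Qed.

Lemma clim_ee_cusp (a : R) : 0 < a -> clim (@icusp R) (fun tau => ee (a%:C * tau)) 0.
Proof.
move=> a0 e e0; exists (e^-1 / a) => tau yt /=; rewrite subr0 cnorm_ee cImM /= mul0r addr0.
have ei : 0 < e^-1 by rewrite invr_gt0.
have p2 := pi_ge2 R; rewrite expRN invf_plt ?posrE ?expR_gt0//.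
rewrite ltr_pdivrMr// mulrC in yt.
apply: lt_le_trans (expR_ge1Dx _); apply: (lt_trans yt).
have h : 1 * (a * Im tau) <= 2 * pi * (a * Im tau).
  by rewrite ler_wpM2r//; [rewrite ltW// (lt_trans _ yt)|lra].
by lra.
Qed.

Lemma TH0_half_qterm tau w : 0 < Im tau ->
  ee (tau / 8) * TH 0 tau (tau / 2 + w) =
  csum (qterm 0 w (fun n => hn n ^+ 2 / 2 + 2^-1 * hn n + 8^-1) tau) -
  csum (qterm 0 (- w) (fun n => hn n ^+ 2 / 2 + - 2^-1 * hn n + 8^-1) tau).
Proof.
move=> yt; rewrite /TH expr0 mul1r mulrBr -!(SS_qterm _ _ _ _ yt).
have b8 : tau / 8 = (8^-1 : R)%:C * tau by rewrite fmorphV rmorph_nat mulrC.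
have e1 : (2^-1 : R)%:C * tau + w = tau / 2 + w by rewrite fmorphV rmorph_nat mulrC.
have e2 : (- 2^-1 : R)%:C * tau + - w = - (tau / 2 + w).
  by rewrite rmorphN fmorphV rmorph_nat; ring.
by rewrite b8 e1 e2.
Qed.

(** At z = tau/2 + w, after multiplication by q^(1/8), the exponents are (n+1)^2/2 in one half of
    the series and n^2/2 in the other; only the term n = 0 of the second survives. *)
Lemma TH0_half_cusp w : clim (@icusp R)
  (fun tau => ee (tau / 8) * TH 0 tau (tau / 2 + w)) (- ee (- w / 2)).
Proof.
pose E1 n : R := hn n ^+ 2 / 2 + 2^-1 * hn n + 8^-1.
(* [E1] minus 1/2: with q^(1/2) taken out, the exponent starts at 0 as [qterm_clim] requires. *)
pose E1' n : R := (n%:R ^+ 2 + 2 * n%:R) / 2.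
pose E2 n : R := hn n ^+ 2 / 2 + - 2^-1 * hn n + 8^-1.
have L2 := @qterm_clim 0 (- w) E2.
have L1 := @qterm_clim 0 w E1'.
have {}L2 : clim (@icusp R) (fun tau => csum (qterm 0 (- w) E2 tau)) (ee (- w / 2)).
  rewrite (_ : ee _ = qterm 0 (- w) E2 0 0%N); last first.
    by rewrite /qterm mulr0 ee0 !expr0 !mul1r mulr1 hnC add0r mulrC.
  apply: L2; first by rewrite /E2 /hn; field.
  move=> n; have -> : E2 n = n%:R ^+ 2 / 2 by rewrite /E2 /hn; field.
  by have := nat_sq_ge n; lra.
have {}L1 : clim (@icusp R) (fun tau => csum (qterm 0 w E1' tau)) (qterm 0 w E1' 0 0%N).
  apply: L1; first by rewrite /E1'; field.
  by move=> n; rewrite /E1'; have := nat_sq_ge n; have := ler0n R n; lra.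
have L3 : clim (@icusp R) (fun tau => csum (qterm 0 w E1 tau)) 0.
  rewrite -(mul0r (qterm 0 w E1' 0 0%N)).
  apply: clim_ext (climM (@clim_ee_cusp 2^-1 _) L1); last by rewrite invr_gt0.
  exists (2^-1) => tau yt /=; have y0 : 0 < Im tau by apply: lt_trans yt; rewrite invr_gt0.
  have b2 : ee ((2^-1 : R)%:C * tau) = ee ((- 8^-1 + 8^-1 + 2^-1 : R)%:C * tau).
    by rewrite addNr add0r.
  have [K G] : exists K, gdom (qterm 0 w E1' tau) K 2^-1.
    have [K G] := sterm_gdom 0 (2^-1%:C * tau + w) y0.
    exists (cnorm (ee ((8^-1 - 2^-1 : R)%:C * tau)) * K).
    have := gdomZ (ee ((8^-1 - 2^-1 : R)%:C * tau)) G; apply: gdom_le => n.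
    rewrite le_eqVlt; apply/orP; left; apply/eqP; congr cnorm.
    rewrite /sterm /qterm !expr0 !mulr1.
    rewrite [RHS](_ : _ = (-1) ^+ n * (ee ((8^-1 - 2^-1)%:C * tau) *
      ee ((hn n ^+ 2 / 2)%:C * tau + (hn n)%:C * (2^-1%:C * tau + w)))); last by ring.
    rewrite -mulrA -!eeD; congr (_ * ee _).
    have -> : E1' n = hn n ^+ 2 / 2 + 2^-1 * hn n + (8^-1 - 2^-1).
      by rewrite /E1' /hn; field.
    by rewrite !(rmorphD, rmorphM, rmorphN) /=; ring.
  rewrite -(csumZ _ G); congr csum; apply/funext => n; rewrite /qterm.
  have -> : ee ((E1 n)%:C * tau) = ee ((2^-1 : R)%:C * tau) * ee ((E1' n)%:C * tau).
    have e : E1 n = 2^-1 + E1' n by rewrite /E1 /E1' /hn; field.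
    by rewrite e (rmorphD (real_complex R)) mulrDl eeD.
  by ring.
rewrite -sub0r; apply: clim_ext (climB L3 L2).
by exists 0 => tau yt /=; rewrite TH0_half_qterm.
Qed.

(** From (1 + 1/4)^4 = 625/256. The inverse 5/12 turns the estimates below into rational
    arithmetic. *)
Lemma expR1_ge : 12 / 5 <= expR 1 :> R.
Proof.
have -> : 1 = 4%:R * 4^-1 :> R by field.
rewrite expRM_natl.
have h : 5 / 4 <= expR 4^-1 :> R.
  by apply: le_trans (expR_ge1Dx _); lra.
have h2 : (5 / 4) ^+ 4 <= expR 4^-1 ^+ 4 :> R by rewrite lerXn2r// nnegrE ?expR_ge0//; lra.
by apply: le_trans h2; rewrite !exprS expr0; lra.
Qed.

Lemma expRN_nat_le n (a : R) : n%:R <= a -> expR (- a) <= (5 / 12) ^+ n.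
Proof.
move=> na; apply: (@le_trans _ _ (expR (n%:R * -1))).
  by rewrite ler_expR; lra.
have h : (expR 1)^-1 <= 5 / 12 :> R.
  have k := expR1_ge; have e0 := expR_gt0 (1 : R).
  by rewrite -[(expR 1)^-1]mul1r ler_pdivrMr//; lra.
rewrite expRM_natl expRN; apply: lerXn2r => //.
  by rewrite nnegrE invr_ge0 expR_ge0.
by rewrite nnegrE; lra.
Qed.

Lemma gdom_unshift (u : nat -> C) (K r : R) : 0 < r -> gdom (fun n => u n.+1) K r ->
  exists K', gdom u K' r.
Proof.
move=> r0 [_ r1 H]; exists (cnorm (u 0%N) + `|K| / r); split=> [||n] //; first exact: ltW.
case: n => [|n].
  by rewrite expr0 mulr1 lerDl divr_ge0// ltW.
apply: le_trans (H n) _; rewrite exprS mulrA mulrDl divfK ?gt_eqF//.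
rewrite ler_wpM2r ?exprn_ge0 ?(ltW r0)//; apply: le_trans (ler_norm _) _.
by rewrite lerDr mulr_ge0 ?cnorm_ge0// ltW.
Qed.

(** * Non-vanishing of theta constants for Im tau >= 1/2 *)

Section LowHeight.
Variables (tau : C).
Hypothesis ytau : 2^-1 <= Im tau.

Let y0 : 0 < Im tau. Proof. by apply: lt_le_trans ytau; rewrite invr_gt0. Qed.

Let t2 : 2 <= 2 * pi * Im tau.
Proof.
have := ler_pM (_ : 0 <= 2 * 2 :> R) (_ : 0 <= 2^-1 :> R)
  (_ : 2 * 2 <= 2 * pi) ytau.
rewrite invr_ge0 => H; apply: le_trans (H _ _ _); last by have := pi_ge2 R; lra.
- by lra.
- by lra.
- by [].
Qed.

Let expt (a : R) m : 0 <= a -> m%:R <= 2 * a -> expR (- (2 * pi * a * Im tau)) <= (5 / 12) ^+ m.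
Proof.
move=> a0 ma; apply: expRN_nat_le; apply: le_trans ma _.
by have := ler_wpM2r a0 t2; lra.
Qed.

(** Since [2 <= 2 * pi * Im tau], each unit of twice the exponent of q costs a factor at most 5/12,
    so a linear lower bound [s + m n] on twice the exponent gives a geometric series. The factor
    [2 ^+ n] leaves room for polynomial coefficients. *)
Lemma low_gdom (u : nat -> C) (a : nat -> R) (K : R) (s m : nat) : 0 <= K ->
  (forall n, 0 <= a n) -> (forall n, (s + m * n)%N%:R <= 2 * a n) -> (2 <= m)%N ->
  (forall n, cnorm (u n) <= K * 2 ^+ n * expR (- (2 * pi * a n * Im tau))) ->
  gdom u (K * (5 / 12) ^+ s) (2 * (5 / 12) ^+ m).
Proof.
move=> K0 a0 sm m2 H; have r512 k : 0 <= (5 / 12 : R) ^+ k by rewrite exprn_ge0//; lra.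
split.
- by rewrite mulr_ge0.
- apply: (@le_lt_trans _ _ (2 * (5 / 12) ^+ 2)); last by rewrite expr2; lra.
  by rewrite ler_pM2l// ler_wiXn2l//; lra.
- move=> n; apply: le_trans (H n) _; have h := expt (a0 n) (sm n).
  rewrite [(2 * _) ^+ n]exprMn -exprM; apply: le_trans (ler_wpM2l _ h) _.
    by rewrite mulr_ge0 ?exprn_ge0.
  by rewrite exprD le_eqVlt; apply/orP; left; apply/eqP; ring.
Qed.

Let nE n : hn n.+1 ^+ 2 / 2 + 0 * hn n.+1 - 8^-1 = (n%:R ^+ 2 + 3 * n%:R + 2) / 2.
Proof. by rewrite mul0r addr0 hn_sqE -natr1; field. Qed.

Let r4 : 0 < 2 * (5 / 12) ^+ 4 :> R. Proof. by rewrite !exprS expr0; lra. Qed.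

(** At z = 0 the two halves of the series coincide. After removal of q^(1/8) the leading term has
    modulus pi, more than the sum of the others. *)
Lemma TH1_neq0_low : TH 1 tau 0 != 0.
Proof.
have := TH_qterm 1 0 y0; rewrite /= oppr0 expr1 mulN1r opprK.
set E := fun n => _; set u := qterm _ _ _ _ => Es.
have G : gdom (fun n => u n.+1) (3 * pi * (5 / 12) ^+ 2) (2 * (5 / 12) ^+ 4).
  apply: (@low_gdom _ (fun n => E n.+1)) => // [|n|n|n].
  - by rewrite mulr_ge0// pi_ge0.
  - by rewrite /E nE divr_ge0// !addr_ge0 ?sqr_ge0 ?mulr_ge0.
  - rewrite /E nE natrD natrM; have := nat_sq_ge n; lra.
  - rewrite cnorm_qterm ler_wpM2r ?expR_ge0// expr1 mulr0 oppr0 mul0r expR0 mulr1.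
    rewrite (_ : 2 * pi * hn n.+1 = pi * (2 * n%:R + 3)); last first.
      by rewrite /hn -natr1; field.
    rewrite (_ : 3 * pi * 2 ^+ n = pi * (3 * 2 ^+ n)); last by ring.
    rewrite ler_wpM2l ?pi_ge0//.
    have : (n.+1)%:R <= 2 ^+ n :> R by rewrite -natrX ler_nat ltn_expl.
    by rewrite -natr1; have := ler0n R n; lra.
have u0 : cnorm (u 0%N) = pi.
  rewrite cnorm_qterm expr1 mulr0 oppr0 mul0r expR0 mulr1 /E mul0r addr0 hn_sqE.
  by rewrite expr0n /= addr0 mul0r mulr0 mul0r oppr0 expR0 mulr1 /hn add0r; field.
have T := csum_tail_le G (gdom_unshift r4 G).
apply: contraTneq T => T0; rewrite T0 mulr0 in Es.
have -> : csum u = 0.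
  by move/esym/eqP: Es; rewrite -mulr2n mulrn_eq0 => /orP[//|/eqP].
rewrite sub0r cnormN u0 -ltNge ltr_pdivrMr.
  by have := pi_gt0 R; rewrite !exprS !expr0; lra.
by rewrite !exprS !expr0; lra.
Qed.

(** The leading terms of the two halves are e(1/4) and its negative, at distance 2, while each tail
    is at most 1/2. *)
Lemma TH0_half1_neq0_low : TH 0 tau 2^-1 != 0.
Proof.
have := TH_qterm 0 2^-1 y0; rewrite /= expr0 mul1r.
set E := fun n => _ => Es.
have h2 : 2^-1 = (2^-1 : R)%:C :> C by rewrite fmorphV rmorph_nat.
have G (b : bool) : gdom (fun n => qterm 0 ((-1) ^+ b * 2^-1) E tau n.+1)
    (1 * (5 / 12) ^+ 2) (2 * (5 / 12) ^+ 4).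
  apply: (@low_gdom _ (fun n => E n.+1)) => // n.
  - by rewrite /E nE divr_ge0// !addr_ge0 ?sqr_ge0 ?mulr_ge0.
  - by rewrite /E nE natrD natrM; have := nat_sq_ge n; lra.
  - rewrite cnorm_qterm ler_wpM2r ?expR_ge0// expr0 mul1r.
    have im2 : Im (2^-1 : C) = 0.
      by have -> : (2^-1 : C) = (2^-1 : R)%:C by rewrite fmorphV rmorph_nat.
    have -> : Im ((-1) ^+ b * 2^-1 : C) = 0.
      by case: b; rewrite ?expr1 ?expr0 ?mulN1r ?mul1r ?cImN im2 ?oppr0.
    by rewrite mulr0 oppr0 mul0r expR0 mul1r exprn_ege1// ler1n.
have T1 := csum_tail_le (G false) (gdom_unshift r4 (G false)).
have T2 := csum_tail_le (G true) (gdom_unshift r4 (G true)).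
rewrite expr0 mul1r in T1; rewrite expr1 mulN1r in T2.
have q0 w : qterm 0 w E tau 0%N = ee (w / 2).
  rewrite /qterm !expr0 !mul1r hnC add0r /E mul0r addr0 hn_sqE expr0n /= addr0 mul0r.
  by rewrite mul0r ee0 mulr1 mulrC.
rewrite !q0 in T1 T2.
have e4 : ee (2^-1 / 2 : C) * ee (2^-1 / 2) = -1.
  by rewrite -eeD -ee_half; congr ee; field.
have e4n : ee (- 2^-1 / 2 : C) = - ee (2^-1 / 2).
  rewrite mulNr eeN; apply: (mulIf (ee_neq0 (2^-1 / 2 : C))).
  by rewrite mulVf ?ee_neq0// mulNr e4 opprK.
have ne4 : cnorm (ee (2^-1 / 2 : C)) = 1.
  have -> : 2^-1 / 2 = (2^-1 : R)%:C * (2^-1 : R)%:C by rewrite !fmorphV !rmorph_nat.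
  exact: cnorm_ee_real.
apply/eqP => T0; rewrite T0 mulr0 in Es.
move: T1 T2; rewrite e4n opprK; set s1 := csum _ in Es *; set s2 := csum _ in Es *.
have -> : s1 = s2 by apply/eqP; rewrite -subr_eq0 -Es.
set x := ee _ in ne4 *; move=> T1 T2.
have := cnormB (s2 - x) (s2 + x); rewrite (_ : _ - _ = - (2 * x)); last by ring.
rewrite cnormN cnormM ne4 mulr1 (_ : cnorm 2 = 2); last first.
  by rewrite -(rmorph_nat (real_complex R) 2) cnorm_real ger0_norm.
have b : 1 * (5 / 12) ^+ 2 / (1 - 2 * (5 / 12) ^+ 4) <= 2^-1 :> R.
  by rewrite ler_pdivrMr !exprS !expr0; lra.
by lra.
Qed.

(** The term n = 0 of the second half has modulus 1; the rest of that half and the whole first half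
    are at most 49/100 each. *)
Lemma TH0_half_neq0_low (x : R) : TH 0 tau (tau / 2 + x%:C) != 0.
Proof.
have := TH0_half_qterm x%:C y0.
set E1 := fun n => _; set u := qterm _ _ _ _; set E2 := fun n => _; set v := qterm _ _ _ _ => Es.
have E1E n : E1 n = (n%:R ^+ 2 + 2 * n%:R + 1) / 2 by rewrite /E1 /hn; field.
have E2E n : E2 n.+1 = (n%:R ^+ 2 + 2 * n%:R + 1) / 2.
  by rewrite /E2 /hn -natr1; field.
have ex n (y : R) : cnorm (qterm 0 y%:C (fun=> 0) tau n) = 1.
  by rewrite cnorm_qterm expr0 mul1r /= !mulr0 mul0r oppr0 mul0r expR0 mulr1.
have cn (y : R) E n : cnorm (qterm 0 y%:C E tau n) = expR (- (2 * pi * E n * Im tau)).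
  by rewrite cnorm_qterm expr0 mul1r /= mulr0 oppr0 mul0r expR0 mul1r.
have b1 n : (1 : R) <= 1 * 2 ^+ n by rewrite mul1r exprn_ege1// ler1n.
have nn n : 0 <= (n%:R ^+ 2 + 2 * n%:R + 1) / 2 :> R.
  by rewrite divr_ge0// !addr_ge0 ?sqr_ge0 ?mulr_ge0.
have nm n : (1 + 3 * n)%N%:R <= 2 * ((n%:R ^+ 2 + 2 * n%:R + 1) / 2) :> R.
  by rewrite natrD natrM; have := nat_sq_ge n; lra.
have Gu : gdom u (1 * (5 / 12) ^+ 1) (2 * (5 / 12) ^+ 3).
  apply: (@low_gdom _ E1) => // n; rewrite ?E1E//.
  by rewrite /u cn E1E -[leLHS]mul1r ler_wpM2r ?expR_ge0.
have Gv : gdom (fun n => v n.+1) (1 * (5 / 12) ^+ 1) (2 * (5 / 12) ^+ 3).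
  apply: (@low_gdom _ (fun n => E2 n.+1)) => // n; rewrite ?E2E//.
  by rewrite /v -rmorphN cn E2E -[leLHS]mul1r ler_wpM2r ?expR_ge0.
have v0 : cnorm (v 0%N) = 1.
  by rewrite /v -rmorphN cn (_ : E2 0%N = 0) ?mulr0 ?mul0r ?oppr0 ?expR0// /E2 /hn; field.
have r3 : 0 < 2 * (5 / 12) ^+ 3 :> R by rewrite !exprS expr0; lra.
have T1 := csum_le Gu.
have T2 := csum_tail_le Gv (gdom_unshift r3 Gv).
apply/eqP => T0; rewrite T0 mulr0 in Es.
have E : csum u = csum v by apply/eqP; rewrite -subr_eq0 -Es.
have := cnormB (csum u) (csum v - v 0%N); rewrite E (_ : _ - _ = v 0%N); last by ring.
rewrite v0; rewrite E in T1.
have b : 1 * (5 / 12) ^+ 1 / (1 - 2 * (5 / 12) ^+ 3) <= 49 / 100 :> R.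
  by rewrite ler_pdivrMr !exprS !expr0; lra.
by lra.
Qed.

End LowHeight.

End ThetaTau.


(** * Independent functions and sample points *)

Section LinearAlgebra.
Variable F : fieldType.

Lemma kernel_row_free m n (A : 'M[F]_(m, n)) :
  (forall v : 'rV_m, v *m A = 0 -> v = 0) -> row_free A.
Proof.
move=> H; rewrite -kermx_eq0; apply/eqP/row_matrixP => i; rewrite row0; apply: H.
by rewrite -row_mul mulmx_ker row0.
Qed.

Definition independent d T (f : 'I_d -> T -> F) :=
  forall c : 'I_d -> F, (forall t, \sum_i c i * f i t = 0) -> forall i, c i = 0.

(** Points are added one at a time. While there are fewer than [d], some nonzero vector [c] is
    killed by the rows found so far; the combination of the [f i] with coefficients [c] is not
    identically zero, and a point where it is nonzero gives a new independent row. Coefficients can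
    then be recovered from finitely many values. *)
Lemma sample_points d T (f : 'I_d -> T -> F) : independent f ->
  exists t : 'I_d -> T, (\matrix_(s, i) f i (t s)) \in unitmx.
Proof.
move=> ind.
suff H k : (k <= d)%N -> exists t : 'I_k -> T, row_free (\matrix_(s < k, i < d) f i (t s)).
  by have [t tf] := H d (leqnn d); exists t; rewrite -row_free_unit.
elim: k => [|k IH] kd.
  exists (fun i : 'I_0 => False_rect T (notF (ltn_ord i))).
  by apply: kernel_row_free => v _; apply/rowP => -[].
have [t tf] := IH (ltnW kd); set A := matrix_of_fun _ _ in tf.
have [c c0 Ac] : exists2 c : 'cV[F]_d, c != 0 & A *m c = 0.
  have : cokermx A != 0.
    rewrite -mxrank_eq0 mxrank_coker subn_eq0 -ltnNge.
    by apply: leq_ltn_trans kd; exact: rank_leq_row.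
  move=> /eqP N; have /existsP[j Hj] : [exists j, col j (cokermx A) != 0].
    apply: contrapT => /negP; rewrite negb_exists => /forallP H; apply: N.
    apply/matrixP => i j; have := H j; rewrite negbK => /eqP /colP /(_ i).
    by rewrite !mxE.
  by exists (col j (cokermx A)) => //; rewrite colE mulmxA mulmx_coker mul0mx.
have [t' Ht'] : exists t', \sum_i c i 0 * f i t' != 0.
  apply: contrapT => /forallNP H; move/eqP: c0; apply; apply/colP => i; rewrite mxE.
  by apply: (ind (fun i => c i 0)) => x; apply/eqP; apply: contrapT => /negP; exact: H.
rewrite -addn1; pose t2 (s : 'I_(k + 1)) := match fintype.split s with inl j => t j | inr _ => t' end.
exists t2; apply: kernel_row_free => v.
have -> : \matrix_(s < k + 1, i < d) f i (t2 s) = col_mx A (\row_i f i t').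
  apply/matrixP => s i; rewrite !mxE /t2; case: (fintype.split s) => j; rewrite !mxE //.
rewrite -[v]hsubmxK mul_row_col; move: (lsubmx v) (rsubmx v) => vl vr E.
have K : (vr *m (\row_i f i t' *m c)) 0 0 = 0.
  have := congr1 (fun M : 'rV_d => (M *m c) 0 0) E.
  by rewrite /= mulmxDl -!mulmxA Ac mulmx0 add0r mul0mx [RHS]mxE.
have a0 : vr = 0.
  apply/rowP => i; rewrite ord1 [RHS]mxE; apply/eqP.
  move: K; rewrite mxE big_ord1 => /eqP; rewrite mulf_eq0 => /orP[//|/eqP K].
  case/eqP: Ht'; rewrite -[RHS]K mxE; apply: eq_bigr => j _.
  by rewrite mxE mulrC.
move: E; rewrite a0 mul0mx addr0 => /eqP; rewrite mulmx_free_eq0// => /eqP ->.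
by rewrite row_mx0.
Qed.

End LinearAlgebra.

(** * Spaces of quasi-periodic entire functions *)

Section ThetaSpaces.
Variable R : realType.
Local Notation C := R[i].
Local Notation Re := complex.Re.
Local Notation Im := complex.Im.
Implicit Types (tau z w : C) (h : C -> C).

(* Entire functions of index a: sections of a degree a line bundle on C / (Z + Z tau). *)
Definition Vsp (a : nat) tau h := [/\ forall z, cdiff h z,
  forall z, h (z + 1) = (-1) ^+ a * h z &
  forall z, h (z + tau) = (-1) ^+ a * ee (- (a%:R / 2 * tau) - a%:R * z) * h z].

Lemma Vsp_lin a tau d (f : 'I_d -> C -> C) (c : 'I_d -> C) :
  (forall i, Vsp a tau (f i)) -> Vsp a tau (fun z => \sum_i c i * f i z).
Proof.
move=> H; split=> z.
- by apply: cdiff_sum => i; apply: cdiffM; [exact: cdiff_cst|have [] := H i].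
- by rewrite mulr_sumr; apply: eq_bigr => i _; have [_ -> _] := H i; ring.
- by rewrite mulr_sumr; apply: eq_bigr => i _; have [_ _ ->] := H i; ring.
Qed.

Lemma VspM a b tau f g : Vsp a tau f -> Vsp b tau g ->
  Vsp (a + b) tau (fun z => f z * g z).
Proof.
move=> [f1 f2 f3] [g1 g2 g3]; split=> z.
- exact: cdiffM.
- by rewrite f2 g2 exprD; ring.
- have e : ee (- ((a + b)%:R / 2 * tau) - (a + b)%:R * z) =
      ee (- (a%:R / 2 * tau) - a%:R * z) * ee (- (b%:R / 2 * tau) - b%:R * z).
    by rewrite -eeD natrD; congr ee; field.
  by rewrite f3 g3 exprD e; ring.
Qed.

Lemma Vsp1 tau : Vsp 0 tau (fun=> 1).
Proof.
split=> z; first exact: cdiff_cst.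
  by rewrite expr0 mulr1.
by rewrite expr0 !mul0r !oppr0 addr0 ee0 !mulr1.
Qed.

Lemma VspX a tau f n : Vsp a tau f -> Vsp (n * a) tau (fun z => f z ^+ n).
Proof.
move=> H; elim: n => [|n IH]; first by exact: Vsp1.
rewrite mulSn; have := VspM H IH; congr Vsp; apply/funext => z.
by rewrite exprS.
Qed.

Section Dimension.
Variables (a : nat) (tau : C).
Hypothesis a_gt0 : (0 < a)%N.
Hypothesis tau_gt0 : 0 < Im tau.

(* e(-a z/2) h(z), made 1-periodic. *)
Let per h z := h z * ee (- (a%:R / 2) * z).

Let per_diff h : Vsp a tau h -> forall z, cdiff (per h) z.
Proof.
move=> [h1 _ _] z; apply: cdiffM => //.
apply: cdiff_ext (ex_intro _ _ (cderiv_ee_affine (- (a%:R / 2)) 0 z)).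
by apply: filterE => w /=; rewrite addr0.
Qed.

Let ee_ahalf : ee (- (a%:R / 2) : C) = (-1) ^+ a.
Proof.
by rewrite eeN eeMn ee_half -exprVn invrN1.
Qed.

Let sgn2 : (-1) ^+ a * (-1) ^+ a = 1 :> C.
Proof. by rewrite -exprD -signr_odd oddD addbb. Qed.

Let per_per h : Vsp a tau h -> forall z, per h (z + 1) = per h z.
Proof.
move=> [_ h2 _] z; rewrite /per h2 mulrDr mulr1 eeD ee_ahalf.
transitivity (((-1) ^+ a * (-1) ^+ a) * (h z * ee (- (a%:R / 2) * z))); first by ring.
by rewrite sgn2 mul1r.
Qed.

Let per_tau h : Vsp a tau h -> forall z,
  per h (z + tau) = (-1) ^+ a * ee (- (a%:R * tau) - a%:R * z) * per h z.
Proof.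
move=> [_ _ h3] z; rewrite /per h3 (mulrDr _ z) (eeD (_ * z)).
have -> : ee (- (a%:R * tau) - a%:R * z) =
    ee (- (a%:R / 2 * tau) - a%:R * z) * ee (- (a%:R / 2) * tau).
  by rewrite -eeD; congr ee; field.
by ring.
Qed.

Let cf h (r : int) := hcoef (per h) 0 r.

Let line_cont h (r : int) (x y : R) : Vsp a tau h ->
  rcont (fun t => per h (t +i* y) * ee (- r%:~R * (t +i* y))) x.
Proof.
move=> V; apply: (rcont_line (h := fun z => per h z * ee (- r%:~R * z)) _).1.
apply: climM; first exact: cdiff_cont (per_diff V _).
have := ccont_ee_affine (- r%:~R) 0 (x +i* y); rewrite /ccont addr0.
by apply: clim_ext; apply: filterE => t /=; rewrite addr0.
Qed.

(** The line of integration is moved from height 0 to height Im tau and the translation law is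
    applied there. The result is a recursion of step [a], so [a] consecutive coefficients determine
    the function. *)
Let cf_shift h (r : int) : Vsp a tau h ->
  cf h r = (-1) ^+ a * ee (- (a%:R + r%:~R) * tau) * cf h (r + a).
Proof.
move=> V; have y1 : - 1 < 0 :> R by lra.
have y2 : - 1 < Im tau by have := tau_gt0; lra.
rewrite /cf (hcoef_indep (fun z _ => per_diff V z) (per_per V) r y1 y2).
rewrite {2}/hcoef -cintZ; last by move=> x; exact: line_cont.
rewrite /hcoef -(@cint_per _ _ (Re tau)) => [|x|x].
- congr (cint _ 0 1); apply/funext => x.
  have -> : (x + Re tau) +i* Im tau = x%:C + tau.
    by case: (tau) => p q; apply: complexP => /=; rewrite ?add0r.
  have ra : (r + a)%:~R = r%:~R + a%:R :> C by rewrite intrD.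
  rewrite (per_tau V) -[x +i* 0]/(x%:C) ra.
  transitivity ((-1) ^+ a * per h x%:C * (ee (- (a%:R * tau) - a%:R * x%:C) *
    ee (- r%:~R * (x%:C + tau)))); first by ring.
  have -> : ee (- (a%:R * tau) - a%:R * x%:C) * ee (- r%:~R * (x%:C + tau)) =
      ee (- (a%:R + r%:~R) * tau) * ee (- (r%:~R + a%:R) * x%:C).
    by rewrite -!eeD; congr ee; ring.
  by ring.
- exact: line_cont.
- have -> : (x + 1) +i* Im tau = (x +i* Im tau) + 1.
    by apply: complexP => /=; rewrite ?addr0.
  by rewrite (per_per V) mulrDr mulr1 eeD -mulrNz ee_int mulr1.
Qed.

Lemma Vsp_eq0 h : Vsp a tau h -> (forall r : 'I_a, cf h (Posz r) = 0) ->
  forall z, h z = 0.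
Proof.
move=> V H.
have up (r : int) : cf h r = 0 -> cf h (r + a) = 0.
  rewrite cf_shift// => /eqP; rewrite mulf_eq0 => /orP[|/eqP//].
  by rewrite mulf_eq0 (negbTE (ee_neq0 _)) orbF expf_eq0 oppr_eq0 oner_eq0 andbF.
have down (r : int) : cf h (r + a) = 0 -> cf h r = 0.
  by rewrite (cf_shift r V) => ->; rewrite mulr0.
have all (r : int) : cf h r = 0.
  have base : cf h (r %% a)%Z = 0.
    have h1 : (0 <= (r %% a)%Z)%R by apply: modz_ge0; rewrite eqz_nat -lt0n.
    have h2 : ((r %% a)%Z < a)%R by apply: ltz_pmod; rewrite ltz_nat.
    by move: h1 h2; case: (r %% a)%Z => // n _ na; exact: (H (Ordinal (na : (n < a)%N))).
  rewrite (divz_eq r a) addrC; move: (r %/ a)%Z (r %% a)%Z base => q b base.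
  case: q => n.
    elim: n => [|n IH]; first by rewrite mul0r addr0.
    rewrite (_ : Posz n.+1 = Posz n + 1); last by lia.
    by rewrite mulrDl mul1r addrA; exact: up.
  rewrite NegzE; elim: n.+1 => [|m IH]; first by rewrite oppr0 mul0r addr0.
  apply: down; rewrite (_ : _ + _ = b + - Posz m * a)//.
  by rewrite (_ : Posz m.+1 = Posz m + 1); [ring|lia].
(* Any bound below both 0, where the coefficients are computed, and Im z will do. *)
move=> z; have := @hcoef_eq0 _ (per h) (Im z - `|Im z| - 1) (fun z _ => per_diff V z)
  (per_per V) 0 z _ _ all.
have yz : Im z - `|Im z| - 1 < 0 by have := ler_norm (Im z); lra.
have yz2 : Im z - `|Im z| - 1 < Im z by have := normr_ge0 (Im z); lra.
move=> /(_ yz yz2) /eqP; rewrite mulf_eq0 (negbTE (ee_neq0 _)) orbF.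
by move/eqP.
Qed.

Let cf_lin d (f : 'I_d -> C -> C) (c : 'I_d -> C) r : (forall i, Vsp a tau (f i)) ->
  cf (fun z => \sum_i c i * f i z) r = \sum_i c i * cf (f i) r.
Proof.
move=> V; rewrite /cf /hcoef.
have E i : c i * cint (fun x => per (f i) (x +i* 0) * ee (- r%:~R * (x +i* 0))) 0 1 =
    cint (fun x => c i * (per (f i) (x +i* 0) * ee (- r%:~R * (x +i* 0)))) 0 1.
  by rewrite cintZ// => x; exact: line_cont.
rewrite (eq_bigr _ (fun i _ => E i)) -cint_sum.
  congr (cint _ 0 1); apply/funext => x; rewrite /per !mulr_suml.
  by apply: eq_bigr => i _; ring.
by move=> i x; apply: rcontM (rcont_cst _ _) _; exact: line_cont.
Qed.

(** By [Vsp_eq0] the coefficients of index 0, .., a-1 are faithful, so [a] independent elements have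
    an invertible coefficient matrix. The combination that matches these coefficients of [h] then
    equals [h]. *)
Lemma Vsp_span (psi : 'I_a -> C -> C) h : (forall i, Vsp a tau (psi i)) ->
  independent psi -> Vsp a tau h -> exists c, forall z, h z = \sum_i c i * psi i z.
Proof.
move=> V ind Vh.
pose A : 'M[C]_a := \matrix_(i, r) cf (psi i) (Posz r).
have uA : A \in unitmx.
  rewrite -row_free_unit; apply: kernel_row_free => v vA.
  apply/rowP => i; rewrite mxE; apply: (ind (v 0)) => z.
  apply: (Vsp_eq0 (Vsp_lin (v 0) V)) => r; rewrite cf_lin//.
  have := congr1 (fun M : 'rV_a => M 0 r) vA; rewrite !mxE => E; rewrite -[RHS]E.
  by apply: eq_bigr => j _; rewrite mxE.
pose v : 'rV[C]_a := (\row_r cf h (Posz r)) *m invmx A.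
exists (v 0) => z; apply/eqP; rewrite -subr_eq0; apply/eqP.
(* The difference of [h] and the combination is written as one linear combination of a + 1 elements,
   to which [cf_lin] applies. *)
pose f2 (i : 'I_a.+1) := if unlift ord0 i is Some j then psi j else h.
pose c2 (i : 'I_a.+1) : C := if unlift ord0 i is Some j then - v 0 j else 1.
have V2 i : Vsp a tau (f2 i) by rewrite /f2; case: unliftP.
have E x : \sum_i c2 i * f2 i x = h x - \sum_i v 0 i * psi i x.
  rewrite big_ord_recl /c2 /f2 unlift_none mul1r -sumrN; congr (_ + _).
  by apply: eq_bigr => i _; rewrite liftK mulNr.
rewrite -E; apply: (Vsp_eq0 (Vsp_lin c2 V2)) => r; rewrite cf_lin//.
rewrite big_ord_recl /c2 /f2 unlift_none mul1r.
have -> : cf h (Posz r) = (v *m A) 0 r by rewrite /v mulmxKV// mxE.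
rewrite [(v *m A) 0 r]mxE -big_split big1//= => i _; rewrite liftK.
have -> : A i r = cf (psi i) (Posz r) by rewrite mxE.
by ring.
Qed.

End Dimension.

(* Distinct vanishing orders a - e i at 0 force linear independence. *)
Lemma order_independent d (a : nat) (e : 'I_d -> nat) (s : C -> C) (P : 'I_d -> C -> C)
    (l : 'I_d -> C) :
  (forall i j : 'I_d, (i < j)%N -> (e i < e j)%N) -> (forall i, (e i <= a)%N) ->
  clim (cdnear 0) s 0 -> cdnear 0 [set z | s z != 0] ->
  (forall i, clim (cdnear 0) (P i) (l i)) -> (forall i, l i != 0) ->
  independent (fun i z => s z ^+ (a - e i) * P i z).
Proof.
move=> einc ea s0 sn0 PL l0 c Hc.
(* Downward induction on [i]: once the larger indices are gone, [s ^+ (a - e i)] is the lowest power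
   of [s] left, and dividing by it and letting z tend to 0 isolates [c i * l i]. *)
suff H n : forall i : 'I_d, (d <= i + n)%N -> c i = 0 by move=> i; apply: (H d); exact: leq_addl.
elim: n => [|n IH] i; first by rewrite addn0 leqNgt ltn_ord.
move=> din.
have K : clim (cdnear 0) (fun z => c i * P i z +
    \sum_(j < d) (if (j < i)%N then c j * (s z ^+ (e i - e j) * P j z) else 0)) (c i * l i + 0).
  apply: climD; first exact: climM (clim_cst _) (PL i).
  have L (j : 'I_d) : clim (cdnear 0) (fun z => if (j < i)%N then
      c j * (s z ^+ (e i - e j) * P j z) else 0) 0.
    case: (boolP (j < i)%N) => ji /=; last exact: clim_cst.
    rewrite [X in clim _ _ X](_ : 0 = c j * (0 ^+ (e i - e j) * l j)).
      exact: climM (clim_cst _) (climM (climX _ s0) (PL j)).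
    by rewrite expr0n subn_eq0 leqNgt einc// mul0r mulr0.
  have := clim_sum (index_enum (ordinal d)) L; rewrite big1 //.
  exact.
have Z : clim (cdnear 0) (fun z => c i * P i z +
    \sum_(j < d) (if (j < i)%N then c j * (s z ^+ (e i - e j) * P j z) else 0)) 0.
  apply: clim_ext (clim_cst 0); apply: filterS sn0 => z sz /=.
  have := Hc z; rewrite (bigD1 i)//= => E.
  apply: (mulfI (expf_neq0 (a - e i) sz)); rewrite mulr0 -[LHS]E mulrDr.
  congr (_ + _); first by ring.
  rewrite mulr_sumr [RHS](bigD1 i)//= ltnn mulr0 add0r; apply: eq_bigr => j ji.
  case: ifP => [lt|ge]; last first.
    have ji' : nat_of_ord j <> nat_of_ord i.
      by move=> /ord_inj /eqP; rewrite (negbTE ji).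
    by rewrite IH ?mul0r ?mulr0//; lia.
  transitivity (c j * (s z ^+ (a - e i) * s z ^+ (e i - e j) * P j z)); last by ring.
  by rewrite -exprD addnBA ?(ltnW (einc _ _ lt))// subnK.
have : c i * l i + 0 = 0 by exact: (clim_unique K Z).
by rewrite addr0 => /eqP; rewrite mulf_eq0 (negbTE (l0 i)) orbF => /eqP.
Qed.

End ThetaSpaces.


(** * The basis built from theta quotients, and its modular behaviour *)

Section ThetaQuotients.
Variable R : realType.
Local Notation C := R[i].
Local Notation Re := complex.Re.
Local Notation Im := complex.Im.
Local Notation tpi := (tpi R).
Implicit Types (tau z w : C) (T : nat -> C -> C).

(* For T j the j-th derivative of theta these are phi = theta / theta'(0), and
   x = phi^2 wp, y = phi^3 wp' where wp is the Weierstrass function. *)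
Definition phG T z := T 0%N z / T 1%N 0.
Definition xxG T z := (T 1%N z ^+ 2 - T 0%N z * T 2%N z +
  T 3%N 0 / (3 * T 1%N 0) * T 0%N z ^+ 2) / T 1%N 0 ^+ 2.
Definition yyG T z := (3 * T 0%N z * T 1%N z * T 2%N z - T 0%N z ^+ 2 * T 3%N z -
  2 * T 1%N z ^+ 3) / T 1%N 0 ^+ 3.

(* Pole order of the i-th basis element divided by phi^a: 0, 2, 3, .., a. *)
Definition ordi (i : nat) : nat := if i is i'.+1 then i'.+2 else 0.
Definition PfG T (e : nat) z :=
  if odd e then xxG T z ^+ (e - 3)./2 * yyG T z else xxG T z ^+ e./2.
Definition psG T (a : nat) (i : 'I_a) z := phG T z ^+ (a - ordi i) * PfG T (ordi i) z.

Definition ph tau := phG (fun j => TH j tau).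
Definition xx tau := xxG (fun j => TH j tau).
Definition yy tau := yyG (fun j => TH j tau).
Definition psi (a : nat) (i : 'I_a) tau := psG (fun j => TH j tau) i.
Definition psiL (a : nat) (i : 'I_a) := psG (@TH_lim R) i.

Lemma ordi_le a (i : 'I_a) : (ordi i <= a)%N.
Proof. by case: i => -[|i]. Qed.
Lemma ordi_inc a (i j : 'I_a) : (i < j)%N -> (ordi i < ordi j)%N.
Proof. by case: i j => -[|i] ? [[|j] ?]. Qed.

(** At 0 [phG] has a simple zero while [xxG] and [yyG] take the values 1 and -2, so the vanishing
    orders are the distinct numbers [a - ordi i]. An abstract [T] covers both theta and its limit at
    the cusp. *)
Lemma psG_independent T a : T 0%N 0 = 0 -> T 1%N 0 != 0 -> cderiv (T 0%N) 0 (T 1%N 0) ->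
  (forall j, ccont (T j) 0) -> independent (@psG T a).
Proof.
move=> T0 T1 D cT.
have near j : clim (cdnear 0) (T j) (T j 0) by move=> e /(cT j) /cnear_cdnear.
have L0 : clim (cdnear 0) (phG T) 0.
  rewrite [X in clim _ _ X](_ : 0 = T 0%N 0 / T 1%N 0); last by rewrite T0 mul0r.
  exact: climM (near 0%N) (clim_cst _).
have Lx : clim (cdnear 0) (xxG T) 1.
  rewrite [X in clim _ _ X](_ : 1 = xxG T 0).
    apply: climM (clim_cst _); apply: climD; first apply: climB.
    - exact: climX.
    - exact: climM.
    - by apply: climM (clim_cst _) _; exact: climX.
  by rewrite /xxG T0; field.
have Ly : clim (cdnear 0) (yyG T) (- 2).
  rewrite [X in clim _ _ X](_ : - 2 = yyG T 0).
    apply: climM (clim_cst _); apply: climB; first apply: climB.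
    - by apply: climM (near 2%N); apply: climM (near 1%N); exact: climM (clim_cst _) (near 0%N).
    - by apply: climM (near 3%N); exact: climX.
    - by apply: climM (clim_cst _) _; exact: climX.
  by rewrite /yyG T0; field.
apply: (@order_independent R a a (fun i => ordi i) (phG T) (fun i => PfG T (ordi i))
  (fun i => if odd (ordi i) then - 2 else 1)).
- exact: ordi_inc.
- exact: ordi_le.
- exact: L0.
- have [u Hu [r r0 Hr]] := D.
  have [s s0 Hs] := clim_neq0 Hu T1.
  exists (Num.min r s); first by rewrite lt_min r0.
  move=> w w0; rewrite lt_min => /andP[wr ws] /=.
  rewrite /phG mulf_neq0 ?invr_eq0// (Hr w wr) T0 add0r mulf_neq0 ?subr_eq0//.
  exact: Hs.
- move=> i; rewrite /PfG; case: odd.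
    rewrite [X in clim _ _ X](_ : _ = 1 ^+ (ordi i - 3)./2 * - 2); last by rewrite expr1n mul1r.
    by apply: climM Ly; exact: climX.
  rewrite [X in clim _ _ X](_ : _ = 1 ^+ (ordi i)./2); last by rewrite expr1n.
  exact: climX.
- by move=> i; case: odd; rewrite ?oner_eq0// oppr_eq0 pnatr_eq0.
Qed.

(** Homogeneity of degree 0 in [T]; it lets the factor q^(1/8) be removed before passing to the
    cusp. *)
Lemma psG_scale T a (i : 'I_a) (k : C) z : k != 0 -> T 1%N 0 != 0 ->
  psG (fun j z => k * T j z) i z = psG T i z.
Proof.
move=> k0 t0; have E1 : phG (fun j z => k * T j z) z = phG T z.
  by rewrite /phG; field; rewrite k0 t0.
have E2 : xxG (fun j z => k * T j z) z = xxG T z.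
  by rewrite /xxG; field; rewrite k0 t0.
have E3 : yyG (fun j z => k * T j z) z = yyG T z.
  by rewrite /yyG; field; rewrite k0 t0.
by rewrite /psG /PfG E1 E2 E3.
Qed.

Section PsiLimits.
Context {I : Type} {FF : set_system I} {Ffil : Filter FF}.

Lemma clim_psG a (i : 'I_a) (T : I -> nat -> C -> C) (L : nat -> C -> C) z :
  (forall j z, clim FF (fun t => T t j z) (L j z)) -> L 1%N 0 != 0 ->
  clim FF (fun t => psG (T t) i z) (psG L i z).
Proof.
move=> H L0.
have H1 : clim FF (fun t => (T t 1%N 0)^-1) (L 1%N 0)^-1 by exact: climV (H 1%N 0) L0.
have P1 : clim FF (fun t => phG (T t) z) (phG L z) by exact: climM (H 0%N z) H1.
have P2 : clim FF (fun t => xxG (T t) z) (xxG L z).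
  apply: climM; last by apply: climV; [exact: climX|exact: expf_neq0].
  apply: climD; first by apply: climB; [exact: climX|exact: climM].
  apply: climM; last exact: climX.
  apply: climM (H 3%N 0) _; apply: climV; first exact: climM (clim_cst _) (H 1%N 0).
  by rewrite mulf_neq0// pnatr_eq0.
have P3 : clim FF (fun t => yyG (T t) z) (yyG L z).
  apply: climM; last by apply: climV; [exact: climX|exact: expf_neq0].
  apply: climB; first apply: climB.
  - by apply: climM (H 2%N z); apply: climM (H 1%N z); exact: climM (clim_cst _) (H 0%N z).
  - by apply: climM (H 3%N z); exact: climX.
  - by apply: climM (clim_cst _) _; exact: climX.
apply: climM; first exact: climX.
by rewrite /PfG; case: odd; [apply: climM P3; exact: climX|exact: climX].
Qed.
End PsiLimits.

Lemma TH_lim10 : TH_lim 1 (0 : C) = tpi.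
Proof. by rewrite /TH_lim oppr0 mul0r ee0 !expr1; field. Qed.

Lemma psiL_independent a : independent (@psiL a).
Proof.
have D (j : nat) z : cderiv (@TH_lim R j) z (TH_lim j.+1 z).
  have := cderivZ ((tpi / 2) ^+ j) (cderivB (cderiv_ee_affine 2^-1 0 z)
    (cderivZ ((-1) ^+ j) (cderiv_ee_affine (- 2^-1) 0 z))).
  rewrite !addr0 => D; apply: cderiv_eq (cderiv_ext _ D) _.
    apply: filterE => w /=; rewrite /TH_lim !addr0 (mulrC 2^-1 w) mulNr (mulrC 2^-1 w).
    by rewrite mulNr.
  have e1 : ee (2^-1 * z) = ee (z / 2) by rewrite mulrC.
  have e2 : ee (- 2^-1 * z) = ee (- z / 2) by congr ee; ring.
  by rewrite e1 e2 /TH_lim !exprS; ring.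
apply: psG_independent.
- by rewrite /TH_lim oppr0 mul0r !expr0 !mul1r subrr.
- by rewrite TH_lim10 tpi_neq0.
- exact: D.
- by move=> j; exact: cderiv_cont (D j 0).
Qed.

Lemma TH00 tau : TH 0 tau 0 = 0.
Proof. by rewrite /TH oppr0 expr0 mul1r subrr. Qed.

(** Differentiating the law of [TH j] in z gives that of the next derivative; the exponential factor
    has logarithmic derivative [- tpi]. *)
Lemma TH_step_tau j tau (G G' : C -> C) : 0 < Im tau ->
  (forall z, TH j tau (z + tau) = - ee (- (tau / 2) - z) * G z) ->
  (forall z, cderiv G z (G' z)) ->
  forall z, TH j.+1 tau (z + tau) = - ee (- (tau / 2) - z) * (G' z - tpi * G z).
Proof.
move=> yt H D z.
have := @cderiv_comp _ (TH j tau) (fun w => 1 * w + tau) z _ _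
  (cderiv_TH j (1 * z + tau) yt) (cderiv_affine 1 tau z); rewrite mulr1 mul1r => D1.
have D2 := cderivM (cderivN (cderiv_ee_affine (-1) (- (tau / 2)) z)) (D z).
apply: (cderiv_unique D1).
apply: cderiv_eq (cderiv_ext _ D2) _.
  by apply: filterE => w /=; rewrite mul1r H mulN1r (addrC (- w)).
by rewrite mulN1r (addrC (- z)); ring.
Qed.

Lemma TH_tau tau z : 0 < Im tau -> let E := ee (- (tau / 2) - z) in
  [/\ TH 0 tau (z + tau) = - E * TH 0 tau z,
      TH 1 tau (z + tau) = - E * (TH 1 tau z - tpi * TH 0 tau z),
      TH 2 tau (z + tau) = - E * (TH 2 tau z - 2 * tpi * TH 1 tau z + tpi ^+ 2 * TH 0 tau z) &
      TH 3 tau (z + tau) = - E * (TH 3 tau z - 3 * tpi * TH 2 tau z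
        + 3 * tpi ^+ 2 * TH 1 tau z - tpi ^+ 3 * TH 0 tau z)].
Proof.
move=> yt E; have D j w := cderiv_TH j w yt.
have e0 w : TH 0 tau (w + tau) = - ee (- (tau / 2) - w) * TH 0 tau w by exact: TH0_addtau.
have e1 := TH_step_tau yt e0 (D 0%N).
have D1 w := cderivB (D 1%N w) (cderivZ tpi (D 0%N w)).
have e2 := TH_step_tau yt e1 D1.
have D2 w := cderivB (cderivB (D 2%N w) (cderivZ tpi (D 1%N w))) (cderivZ tpi (D1 w)).
have e3 := TH_step_tau yt e2 D2.
by split; rewrite ?e0 ?e1 ?e2 ?e3 -/E; ring.
Qed.

Lemma VspZ a tau (c : C) h : Vsp a tau h -> Vsp a tau (fun z => c * h z).
Proof.
move=> [h1 h2 h3]; split=> z; first exact: cdiffM (cdiff_cst _ _) (h1 z).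
  by rewrite h2; ring.
by rewrite h3; ring.
Qed.

Lemma Vsp_TH tau : 0 < Im tau -> Vsp 1 tau (TH 0 tau).
Proof.
move=> yt; split=> z; first by exists (TH 1 tau z); exact: cderiv_TH.
  by rewrite TH_add1// mulN1r.
by rewrite TH0_addtau// expr1 mulN1r; congr (- ee _ * _); field.
Qed.

Lemma Vsp_ph tau : 0 < Im tau -> Vsp 1 tau (ph tau).
Proof.
move=> yt; have := VspZ (TH 1 tau 0)^-1 (Vsp_TH yt); congr Vsp.
by apply/funext => z; rewrite /ph /phG mulrC.
Qed.

(** [xx / ph ^+ 2] is a constant minus the second logarithmic derivative of theta, and
    [yy / ph ^+ 3] is minus the third. A translation changes log theta by an affine function, so the
    extra terms in the laws of the derivatives cancel. *)
Lemma Vsp_xx tau : 0 < Im tau -> Vsp 2 tau (xx tau).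
Proof.
move=> yt; have d j z : cdiff (TH j tau) z by exists (TH j.+1 tau z); exact: cderiv_TH.
split=> z.
- apply: cdiffM (cdiff_cst _ _); apply: cdiffD; first apply: cdiffB.
  + exact: cdiffX.
  + exact: cdiffM.
  + by apply: cdiffM (cdiff_cst _ _) _; exact: cdiffX.
- by rewrite /xx /xxG !TH_add1//; ring.
- have [e0 e1 e2 _] := TH_tau z yt; rewrite /xx /xxG e0 e1 e2.
  have -> : ee (- (2 / 2 * tau) - 2 * z) = ee (- (tau / 2) - z) * ee (- (tau / 2) - z).
    by rewrite -eeD; congr ee; field.
  by ring.
Qed.

Lemma Vsp_yy tau : 0 < Im tau -> Vsp 3 tau (yy tau).
Proof.
move=> yt; have d j z : cdiff (TH j tau) z by exists (TH j.+1 tau z); exact: cderiv_TH.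
split=> z.
- apply: cdiffM (cdiff_cst _ _); apply: cdiffB; first apply: cdiffB.
  + by apply: cdiffM => //; apply: cdiffM => //; exact: cdiffM (cdiff_cst _ _) _.
  + by apply: cdiffM => //; exact: cdiffX.
  + by apply: cdiffM (cdiff_cst _ _) _; exact: cdiffX.
- by rewrite /yy /yyG !TH_add1//; ring.
- have [e0 e1 e2 e3] := TH_tau z yt; rewrite /yy /yyG e0 e1 e2 e3.
  have -> : ee (- (3 / 2 * tau) - 3 * z) =
      ee (- (tau / 2) - z) * ee (- (tau / 2) - z) * ee (- (tau / 2) - z).
    by rewrite -!eeD; congr ee; field.
  by ring.
Qed.

Lemma ordi_parity i : let e := ordi i in
  if odd e then e = ((e - 3)./2 * 2 + 3)%N else e = (e./2 * 2)%N.
Proof.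
rewrite /=; case: ifP => o; last by rewrite muln2 even_halfK// o.
have e3 : (3 <= ordi i)%N by move: o; case: i => [|[|i]].
have : ~~ odd (ordi i - 3) by rewrite oddB// o.
by move=> /even_halfK h; rewrite muln2 h subnK.
Qed.

Lemma Vsp_psi a (i : 'I_a) tau : 0 < Im tau -> Vsp a tau (psi i tau).
Proof.
move=> yt.
have P : Vsp (ordi i) tau (PfG (fun j => TH j tau) (ordi i)).
  have := ordi_parity i; rewrite /= /PfG; case: odd => {1}->.
    by apply: VspM (Vsp_yy yt); apply: VspX; exact: Vsp_xx.
  by apply: VspX; exact: Vsp_xx.
have Q : Vsp ((a - ordi i) * 1) tau (fun z => ph tau z ^+ (a - ordi i)).
  by apply: VspX; exact: Vsp_ph.
by have := VspM Q P; rewrite muln1 subnK ?ordi_le.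
Qed.

Lemma ImV tau : 0 < Im tau -> Im (- tau^-1) = Im tau / cnorm tau ^+ 2.
Proof.
case: tau => p q /= q0; rewrite /cnorm /= sqr_sqrtr ?addr_ge0 ?sqr_ge0//.
by rewrite opprK.
Qed.

Lemma ImV_gt0 tau : 0 < Im tau -> 0 < Im (- tau^-1).
Proof.
move=> yt; rewrite ImV// divr_gt0// exprn_gt0// cnorm_gt0.
by apply: contraTneq yt => ->; rewrite ltxx.
Qed.

Lemma H_neq0 tau : 0 < Im tau -> tau != 0.
Proof. by apply: contraTneq => ->; rewrite ltxx. Qed.

Lemma ImD1 tau : Im (tau + 1) = Im tau.
Proof. by rewrite cImD /= addr0. Qed.

(* Translating to |Re tau| <= 1/2, inversion at least doubles Im tau when Im tau < 1/2. *)
Lemma modular_reduction (P : C -> Prop) :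
  (forall tau, 2^-1 <= Im tau -> P tau) ->
  (forall tau, 0 < Im tau -> P (tau + 1) <-> P tau) ->
  (forall tau, 0 < Im tau -> P (- tau^-1) -> P tau) ->
  forall tau, 0 < Im tau -> P tau.
Proof.
move=> Plow PT PS.
have Pn (n : nat) tau : 0 < Im tau -> P (tau + n%:R) <-> P tau.
  move=> yt; elim: n => [|n IH]; first by rewrite addr0.
  rewrite -natr1 addrA; apply: iff_trans IH; apply: PT.
  by rewrite cImD -(rmorph_nat (real_complex R)) /= addr0.
have Pz (m : int) tau : 0 < Im tau -> P (tau - m%:~R) -> P tau.
  case: m => n yt; last by rewrite NegzE mulrNz opprK => h; apply/(Pn n.+1 _ yt).
  have yn : 0 < Im (tau - n%:R).
    by rewrite cImD cImN -(rmorph_nat (real_complex R)) /= oppr0 addr0.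
  by move=> h; rewrite -(subrK n%:R tau); apply/(Pn n _ yn).
have H (n : nat) tau : 0 < Im tau -> 2^-1 / 2 ^+ n <= Im tau -> P tau.
  elim: n tau => [|n IH] tau yt; first by rewrite expr0 divr1 => /Plow.
  move=> hn; have [/Plow//|low] := leP 2^-1 (Im tau).
  pose m := Num.floor (Re tau + 2^-1).
  have mi : Im (m%:~R : C) = 0 by rewrite intr_real.
  have mr : Re (m%:~R : C) = m%:~R by rewrite intr_real.
  apply: (Pz m) => //; set t := tau - m%:~R.
  have tI : Im t = Im tau by rewrite cImD cImN mi oppr0 addr0.
  have tR : `|Re t| <= 2^-1.
    rewrite cReD cReN mr; have /andP[] := floor_itv (Re tau + 2^-1).
    rewrite intrD1 -/m => f1 f2; rewrite ler_norml; apply/andP; split; lra.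
  have yt' : 0 < Im t by rewrite tI.
  apply: PS => //; apply: IH; first exact: ImV_gt0.
  rewrite ImV//; have n2 : cnorm t ^+ 2 <= 2^-1.
    have -> : cnorm t ^+ 2 = Re t ^+ 2 + Im t ^+ 2.
      by case: (t) => p q; rewrite /cnorm /= sqr_sqrtr// addr_ge0 ?sqr_ge0.
    have h1 : `|Re t| ^+ 2 <= 2^-1 ^+ 2 by rewrite lerXn2r ?nnegrE ?invr_ge0.
    have h2 : Im t ^+ 2 <= 2^-1 ^+ 2 by rewrite lerXn2r ?nnegrE ?invr_ge0 ?tI ?ltW.
    move: h1; rewrite real_normK ?num_real// => h1.
    have : 2^-1 ^+ 2 + 2^-1 ^+ 2 = 2^-1 :> R by field.
    by lra.
  have n0 : 0 < cnorm t ^+ 2 by rewrite exprn_gt0// cnorm_gt0 H_neq0.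
  rewrite ler_pdivlMr//; have q0 : 0 <= 2^-1 / 2 ^+ n :> R by rewrite divr_ge0// exprn_ge0.
  apply: le_trans (ler_wpM2l q0 n2) _; rewrite tI; apply: le_trans hn.
  by rewrite exprSr invfM mulrA.
move=> tau yt; have [n hn] := exists_small_half 2^-1 yt; apply: (H n) => //; exact: ltW.
Qed.

(** Multiplied by e(- z^2 / (2 tau)), the left side lies in the one-dimensional space of index 1,
    hence is a multiple of theta. The constant [k], which depends on [tau], stays unspecified: it
    cancels in quotients. *)
Lemma S_theta tau : 0 < Im tau -> exists2 k : C, k != 0 &
  forall z, TH 0 (- tau^-1) (z / tau) = k * ee (z ^+ 2 / (2 * tau)) * TH 0 tau z.
Proof.
move=> yt; have t0 := H_neq0 yt; set s := - tau^-1; have ys : 0 < Im s := ImV_gt0 yt.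
pose h z := ee (- (z ^+ 2 / (2 * tau))) * TH 0 s (z / tau).
have Vh : Vsp 1 tau h.
  split=> z.
  - apply: cdiffM.
      apply: (@cdiff_comp _ (@ee R)); first exact: cdiff_ee.
      by apply: cdiffN; apply: cdiffM (cdiff_cst _ _); apply: cdiffX; exact: cdiff_id.
    apply: (@cdiff_comp _ (TH 0 s)); first by eexists; exact: cderiv_TH.
    by apply: cdiffM (cdiff_cst _ _); exact: cdiff_id.
  - have := TH0_addtau ((z + 1) / tau) ys.
    have -> : (z + 1) / tau + s = z / tau by rewrite /s; field.
    rewrite /h expr1 => ->.
    rewrite [in RHS](_ : ee (- (z ^+ 2 / (2 * tau))) = ee (- ((z + 1) ^+ 2 / (2 * tau))) *
      ee (z / tau + (2 * tau)^-1)); last by rewrite -eeD; congr ee; field.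
    rewrite (_ : - (s / 2) - (z + 1) / tau = - (z / tau + (2 * tau)^-1)); last first.
      by rewrite /s; field.
    rewrite (eeN (z / tau + (2 * tau)^-1)).
    by field; exact: ee_neq0.
  - rewrite /h (_ : (z + tau) / tau = z / tau + 1); last by field.
    rewrite TH_add1// expr1 (_ : ee (- ((z + tau) ^+ 2 / (2 * tau))) =
      ee (- (1 / 2 * tau) - 1 * z) * ee (- (z ^+ 2 / (2 * tau)))); first by ring.
    by rewrite -eeD; congr ee; field.
have ind : independent (fun (_ : 'I_1) => TH 0 tau).
  move=> c Hc i; have [z tz] := TH0_nonzero yt; have := Hc z.
  rewrite (ord1 i) big_ord1 => /eqP; rewrite mulf_eq0 (negbTE tz) orbF => /eqP c0.
  exact: c0.
have [c Hc] := Vsp_span (ltn0Sn 0) yt (fun _ => Vsp_TH yt) ind Vh.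
have E z : TH 0 s (z / tau) = c ord0 * ee (z ^+ 2 / (2 * tau)) * TH 0 tau z.
  have := Hc z; rewrite big_ord1 /h eeN => e; have e0 := ee_neq0 (z ^+ 2 / (2 * tau)).
  by apply: (mulfI (invr_neq0 e0)); rewrite e; field.
exists (c ord0) => //; apply/eqP => c0.
have [w] := TH0_nonzero ys.
have : TH 0 s ((w * tau) / tau) = 0 by rewrite E c0 !mul0r.
by rewrite mulfK// => ->; rewrite eqxx.
Qed.

Lemma TH_step_S j tau (k : C) (G G' : C -> C) : 0 < Im tau ->
  (forall z, TH j (- tau^-1) (z / tau) = tau ^+ j * k * ee (z ^+ 2 / (2 * tau)) * G z) ->
  (forall z, cderiv G z (G' z)) ->
  forall z, TH j.+1 (- tau^-1) (z / tau) =
    tau ^+ j.+1 * k * ee (z ^+ 2 / (2 * tau)) * (G' z + tpi / tau * z * G z).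
Proof.
move=> yt H D z; have t0 := H_neq0 yt; have ys := ImV_gt0 yt.
have D1 := @cderiv_comp _ (TH j (- tau^-1)) (fun w => tau^-1 * w + 0) z _ _
  (cderiv_TH j (tau^-1 * z + 0) ys) (cderiv_affine tau^-1 0 z); rewrite addr0 in D1.
have Dg : cderiv (fun z => ee (z ^+ 2 / (2 * tau))) z
    (tpi / tau * z * ee (z ^+ 2 / (2 * tau))).
  have Dq : cderiv (fun w => w ^+ 2 / (2 * tau)) z (z / tau).
    apply: cderiv_eq (cderivM (cderivX 2 (cderiv_id z)) (cderiv_cst (2 * tau)^-1 z)) _.
    by rewrite expr1; field.
  have := @cderiv_comp _ (fun w => ee (1 * w + 0)) (fun w => w ^+ 2 / (2 * tau)) z _ _
    (cderiv_ee_affine 1 0 (z ^+ 2 / (2 * tau))) Dq; rewrite mulr1 mul1r addr0 => Dc.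
  apply: cderiv_eq (cderiv_ext _ Dc) _; last by ring.
  by apply: filterE => w /=; rewrite mul1r addr0.
have D2 := cderivM (cderivZ (tau ^+ j * k) Dg) (D z).
have E : TH j.+1 (- tau^-1) (tau^-1 * z) * tau^-1 =
    tau ^+ j * k * (tpi / tau * z * ee (z ^+ 2 / (2 * tau))) * G z +
    tau ^+ j * k * ee (z ^+ 2 / (2 * tau)) * G' z.
  apply: (cderiv_unique D1); apply: cderiv_ext D2; apply: filterE => w /=.
  by rewrite addr0 -H mulrC.
have -> : z / tau = tau^-1 * z by rewrite mulrC.
have -> : TH j.+1 (- tau^-1) (tau^-1 * z) = TH j.+1 (- tau^-1) (tau^-1 * z) * tau^-1 * tau.
  by rewrite mulfVK.
by rewrite E (exprS tau j); field.
Qed.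

Lemma TH_S tau : 0 < Im tau -> exists2 k : C, k != 0 & forall z,
  let g := k * ee (z ^+ 2 / (2 * tau)) in let u := tpi / tau in
  [/\ TH 0 (- tau^-1) (z / tau) = g * TH 0 tau z,
      TH 1 (- tau^-1) (z / tau) = tau * g * (TH 1 tau z + u * z * TH 0 tau z),
      TH 2 (- tau^-1) (z / tau) = tau ^+ 2 * g * (TH 2 tau z + 2 * u * z * TH 1 tau z
        + (u + u ^+ 2 * z ^+ 2) * TH 0 tau z) &
      TH 3 (- tau^-1) (z / tau) = tau ^+ 3 * g * (TH 3 tau z + 3 * u * z * TH 2 tau z
        + 3 * (u + u ^+ 2 * z ^+ 2) * TH 1 tau z
        + (3 * u ^+ 2 * z + u ^+ 3 * z ^+ 3) * TH 0 tau z)].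
Proof.
move=> yt; have [k k0 Hk] := S_theta yt; exists k => // z g u.
have D j w := cderiv_TH j w yt.
have e0 w : TH 0 (- tau^-1) (w / tau) =
  tau ^+ 0 * k * ee (w ^+ 2 / (2 * tau)) * TH 0 tau w by rewrite Hk; ring.
have e1 := TH_step_S yt e0 (D 0%N).
have Dz (w : C) : cderiv (fun w => u * w) w u.
  by apply: cderiv_eq (cderivZ u (cderiv_id w)) _; rewrite mulr1.
have D1 w := cderivD (D 1%N w) (cderivM (Dz w) (D 0%N w)).
have e2 := TH_step_S yt e1 D1.
have D2 w := cderivD (cderivD (D 2%N w) (cderivD (cderivZ u (D 0%N w))
  (cderivM (Dz w) (D 1%N w)))) (cderivM (Dz w) (D1 w)).
have {}D2 w : cderiv (fun w => TH 2 tau w + (u * TH 0 tau w + u * w * TH 1 tau w) +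
    u * w * (TH 1 tau w + u * w * TH 0 tau w)) w _ := D2 w.
have e3 := TH_step_S yt e2 D2.
by split; rewrite ?e0 ?e1 ?e2 ?e3 -/u /g; ring.
Qed.

(** Both generators multiply theta'(0) by nonzero factors, so the estimate at height at least 1/2
    suffices. *)
Lemma D0_neq0 tau : 0 < Im tau -> TH 1 tau 0 != 0.
Proof.
move: tau; apply: modular_reduction => [tau|tau yt|tau yt].
- exact: TH1_neq0_low.
- by rewrite TH_addtau1// mulf_eq0 (negbTE (ee_neq0 _)).
- have [k k0 /(_ 0)[_ + _ _]] := TH_S yt; rewrite mul0r TH00 !mulr0 addr0 => ->.
  by rewrite !mulf_eq0 !negb_or => /andP[].
Qed.

Lemma psi_independent a tau : 0 < Im tau -> independent (fun i => @psi a i tau).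
Proof.
move=> yt; apply: psG_independent.
- exact: TH00.
- exact: D0_neq0.
- exact: cderiv_TH.
- by move=> j; exact: cderiv_cont (cderiv_TH j 0 yt).
Qed.

Lemma quot_T tau z : 0 < Im tau -> [/\ ph (tau + 1) z = ph tau z,
  xx (tau + 1) z = xx tau z & yy (tau + 1) z = yy tau z].
Proof.
move=> yt; have d0 := D0_neq0 yt; have e0 := ee_neq0 (8^-1 : C).
by rewrite /ph /phG /xx /xxG /yy /yyG !TH_addtau1//; split; field; rewrite e0 d0.
Qed.

(** The constant [T 3 0 / (3 * T 1 0)] in [xxG] is there for this: under inversion it acquires the
    same term [tpi / tau] as the second logarithmic derivative of theta, and the two cancel. *)
Lemma quot_S tau z : 0 < Im tau -> let g := ee (z ^+ 2 / (2 * tau)) in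
  [/\ ph (- tau^-1) (z / tau) = tau^-1 * g * ph tau z,
      xx (- tau^-1) (z / tau) = g ^+ 2 * xx tau z &
      yy (- tau^-1) (z / tau) = g ^+ 3 * yy tau z].
Proof.
move=> yt g; have d0 := D0_neq0 yt; have t0 := H_neq0 yt.
have [k k0 H] := TH_S yt; have [e0 e1 e2 e3] := H z; have [_ f1 _ f3] := H 0.
rewrite !mul0r TH00 expr0n /= mul0r ee0 !mulr0 !mul0r !addr0 mulr1 in f1 f3.
by rewrite /ph /phG /xx /xxG /yy /yyG e0 e1 e2 e3 f1 f3 -/g; split; field;
  rewrite ?d0 ?k0 ?t0.
Qed.

Lemma psi_T a (i : 'I_a) tau z : 0 < Im tau -> psi i (tau + 1) z = psi i tau z.
Proof.
move=> yt; have [e1 e2 e3] := quot_T z yt.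
by rewrite /psi /psG /PfG -!/(ph _ _) -!/(xx _ _) -!/(yy _ _) e1 e2 e3.
Qed.

Lemma psi_S a (i : 'I_a) tau z : 0 < Im tau ->
  psi i (- tau^-1) (z / tau) =
  (tau ^+ (a - ordi i))^-1 * ee (z ^+ 2 / (2 * tau)) ^+ a * psi i tau z.
Proof.
move=> yt; have [e1 e2 e3] := quot_S z yt; set g := ee _ in e1 e2 e3 *.
have P : PfG (fun j => TH j (- tau^-1)) (ordi i) (z / tau) =
    g ^+ ordi i * PfG (fun j => TH j tau) (ordi i) z.
  have gm k : g ^+ (k * 2) = (g ^+ 2) ^+ k by rewrite mulnC exprM.
  have := ordi_parity i; rewrite /= /PfG -!/(xx _ _) -!/(yy _ _) e2 e3.
  by case: odd => E; rewrite [in g ^+ ordi i]E ?exprD gm exprMn; ring.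
have ga : g ^+ a = g ^+ (a - ordi i) * g ^+ ordi i by rewrite -exprD subnK ?ordi_le.
have pw (A B D : C) n : (A^-1 * B * D) ^+ n = (A ^+ n)^-1 * B ^+ n * D ^+ n.
  by rewrite !exprMn exprVn.
by rewrite /psi /psG P -!/(ph _ _) e1 pw ga; ring.
Qed.

Lemma cdiff_psi a (i : 'I_a) z tau : 0 < Im tau -> cdiff (fun t => psi i t z) tau.
Proof.
move=> yt; have d0 := D0_neq0 yt; have d j w := cdiff_TH_tau j w yt.
have iV : cdiff (fun t : C => (TH 1 t 0)^-1) tau by exact: cdiffV.
have h1 : cdiff (fun t => ph t z) tau by exact: cdiffM.
have h2 : cdiff (fun t => xx t z) tau.
  apply: cdiffM; last by apply: cdiffV; [exact: cdiffX|exact: expf_neq0].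
  apply: cdiffD; first by apply: cdiffB; [exact: cdiffX|exact: cdiffM].
  apply: cdiffM; last exact: cdiffX.
  apply: cdiffM => //; apply: cdiffV; first exact: cdiffM (cdiff_cst _ _) _.
  by rewrite mulf_neq0// pnatr_eq0.
have h3 : cdiff (fun t => yy t z) tau.
  apply: cdiffM; last by apply: cdiffV; [exact: cdiffX|exact: expf_neq0].
  apply: cdiffB; first apply: cdiffB.
  - by apply: cdiffM => //; apply: cdiffM => //; exact: cdiffM (cdiff_cst _ _) _.
  - by apply: cdiffM => //; exact: cdiffX.
  - by apply: cdiffM (cdiff_cst _ _) _; exact: cdiffX.
apply: cdiffM; first exact: cdiffX.
by rewrite /PfG; case: odd; [apply: cdiffM => //; exact: cdiffX|exact: cdiffX].
Qed.

Lemma psi_cusp a (i : 'I_a) z : clim (@icusp R) (fun t => psi i t z) (psiL i z).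
Proof.
have L0 : TH_lim 1 (0 : C) != 0 by rewrite TH_lim10 tpi_neq0.
have K : clim (@icusp R) (fun t => psG (fun j z => ee (- (t / 8)) * TH j t z) i z)
    (psiL i z).
  by apply: clim_psG L0 => j w; exact: TH_cusp.
apply: clim_ext K; exists 0 => t yt /=; apply: psG_scale; first exact: ee_neq0.
exact: D0_neq0.
Qed.

End ThetaQuotients.


(** * Determinants depending on a parameter *)

Section Determinants.
Variable R : realType.
Local Notation C := R[i].

Lemma cdiff_det n (M : C -> 'M[C]_n) z :
  (forall i j, cdiff (fun t => M t i j) z) -> cdiff (fun t => \det (M t)) z.
Proof.
move=> H; apply: cdiff_sum => s; apply: cdiffM; first exact: cdiff_cst.
by apply: cdiff_prod => i; exact: H.
Qed.

Lemma clim_det T (F : set_system T) {FF : Filter F} n (M : T -> 'M[C]_n) (L : 'M[C]_n) :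
  (forall i j, clim F (fun t => M t i j) (L i j)) -> clim F (fun t => \det (M t)) (\det L).
Proof.
move=> H; apply: clim_sum => s; apply: climM; first exact: clim_cst.
by apply: clim_prod => i; exact: H.
Qed.

Lemma cramer n (A : 'M[C]_n) (g f : 'cV[C]_n) : A *m g = f -> \det A != 0 ->
  forall i, g i 0 = (\det A)^-1 * \sum_s (\adj A i s * f s 0).
Proof.
move=> <- d0 i; have := congr1 (fun M : 'cV_n => M i 0) (mulmxA (\adj A) A g).
rewrite mul_adj_mx mul_scalar_mx [X in _ = X]mxE => E.
rewrite (_ : \sum_s _ = (\adj A *m (A *m g)) i 0); last by rewrite [RHS]mxE.
by rewrite E mulKf.
Qed.

End Determinants.

(** * Coefficients in the basis as functions of tau *)

Section Coefficients.
Variable R : realType.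
Local Notation C := R[i].
Local Notation Im := complex.Im.
Implicit Types (tau z w : C).

Variables (a : nat) (F : C -> C -> C).
Hypothesis a_gt0 : (0 < a)%N.
Hypothesis FV : forall tau, 0 < Im tau -> Vsp a tau (F tau).

(** Chosen separately for each [tau], with default value 0 off the half-plane. Any regularity in
    [tau] has to come from uniqueness and from [pcoef_sample]. *)
Definition pcoef tau (i : 'I_a) : C :=
  match pselect (0 < Im tau) with
  | left yt => sval (cid (Vsp_span a_gt0 yt (fun i => Vsp_psi i yt)
      (psi_independent yt) (FV yt))) i
  | right _ => 0
  end.

Lemma pcoefE tau z : 0 < Im tau -> F tau z = \sum_i pcoef tau i * psi i tau z.
Proof.
move=> yt; rewrite /pcoef; case: pselect => // h.
exact: (svalP (cid (Vsp_span _ _ _ _ _))).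
Qed.

Lemma pcoef_unique tau (c : 'I_a -> C) : 0 < Im tau ->
  (forall z, F tau z = \sum_i c i * psi i tau z) -> forall i, pcoef tau i = c i.
Proof.
move=> yt H i; apply/eqP; rewrite -subr_eq0; apply/eqP; move: i.
apply: (psi_independent yt) => z.
under eq_bigr do rewrite mulrBl.
by rewrite big_split /= sumrN -pcoefE// -H subrr.
Qed.

Let A (t : 'I_a -> C) tau : 'M[C]_a := \matrix_(s, i) psi i tau (t s).

Lemma pcoef_sample (t : 'I_a -> C) tau i : 0 < Im tau -> \det (A t tau) != 0 ->
  pcoef tau i = (\det (A t tau))^-1 * \sum_s (\adj (A t tau) i s * F tau (t s)).
Proof.
move=> yt d0.
have := @cramer R a (A t tau) (\col_i pcoef tau i) (\col_s F tau (t s)) _ d0 i.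
rewrite !mxE => ->; first by congr (_ * _); apply: eq_bigr => s _; rewrite mxE.
apply/colP => s; rewrite !mxE pcoefE//; apply: eq_bigr => j _.
by rewrite !mxE mulrC.
Qed.

Lemma exists_sample tau : 0 < Im tau -> exists t, \det (A t tau) != 0.
Proof.
move=> yt; have [t] := sample_points (psi_independent (a := a) yt).
by rewrite unitmxE unitfE => H; exists t.
Qed.

(** Sample points chosen at [tau] keep a nonzero determinant nearby, and there Cramer's rule
    expresses the coefficient by holomorphic functions. *)
Lemma pcoef_cdiff tau i : (forall tau z, 0 < Im tau -> cdiff (F^~ z) tau) ->
  0 < Im tau -> cdiff (pcoef^~ i) tau.
Proof.
move=> FD yt; have [t d0] := exists_sample yt.
have dA n (r c : 'I_n -> 'I_a) : cdiff (fun tau => \det (\matrix_(k, l) A t tau (r k) (c l))) tau.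
  apply: cdiff_det => k l; apply: cdiff_ext (cdiff_psi (c l) (t (r k)) yt).
  by apply: filterE => w; rewrite /= !mxE.
have dd : cdiff (fun tau => \det (A t tau)) tau.
  apply: cdiff_det => k l; apply: cdiff_ext (cdiff_psi l (t k) yt).
  by apply: filterE => w; rewrite /= !mxE.
apply: (@cdiff_ext _ (fun tau => (\det (A t tau))^-1 * \sum_s (\adj (A t tau) i s * F tau (t s)))).
  have n1 : cnear tau [set w | \det (A t w) != 0] by exact: (clim_neq0 (cdiff_cont dd) d0).
  have n2 : cnear tau [set w | 0 < Im w].
    exists (Im tau) => // w; have := cnorm_Im (w - tau); rewrite cImD cImN => h1 h2 /=.
    by have := ler_norm (- (Im w - Im tau)); rewrite normrN; lra.
  by apply: filterS2 n1 n2 => w d0w yw; rewrite /= -pcoef_sample.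
apply: cdiffM; first exact: cdiffV.
apply: cdiff_sum => s; apply: cdiffM; last exact: FD.
apply: (@cdiff_ext _ (fun tau => (-1) ^+ (s + i) *
  \det (\matrix_(k, l) A t tau (lift s k) (lift i l)))).
  apply: filterE => w /=; rewrite mxE /cofactor; congr (_ * \det _).
  by apply/matrixP => k l; rewrite !mxE.
by apply: cdiffM; [exact: cdiff_cst|exact: dA].
Qed.

(** Here the sample points are chosen for the limit basis [psiL], so that the determinant has a
    nonzero limit at the cusp. *)
Lemma pcoef_bounded i : (forall z, bounded_along (@icusp R) (F^~ z)) ->
  bounded_along (@icusp R) (pcoef^~ i).
Proof.
move=> FB; have [t] := sample_points (@psiL_independent R a).
pose L : 'M[C]_a := \matrix_(s, j) psiL j (t s).
rewrite unitmxE unitfE => d0.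
have dA n (r c : 'I_n -> 'I_a) : clim (@icusp R)
    (fun tau => \det (\matrix_(k, l) A t tau (r k) (c l)))
    (\det (\matrix_(k, l) L (r k) (c l))).
  apply: clim_det => k l; rewrite !mxE; apply: clim_ext (psi_cusp (c l) (t (r k))).
  by apply: filterE => w; rewrite /= !mxE.
have dd : clim (@icusp R) (fun tau => \det (A t tau)) (\det L).
  apply: clim_det => k l; rewrite !mxE; apply: clim_ext (psi_cusp l (t k)).
  by apply: filterE => w; rewrite /= !mxE.
have n1 := clim_neq0 dd d0.
have n2 : icusp [set w : C | 0 < Im w] by exists 0.
apply: (@bounded_ext _ _ _ _ (fun tau => (\det (A t tau))^-1 *
    \sum_s (\adj (A t tau) i s * F tau (t s)))).
  by apply: filterS2 (n1 _) n2 => w d0w yw; rewrite /= -pcoef_sample.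
apply: boundedM; first exact: clim_bounded (climV dd d0).
apply: bounded_sum => s; apply: boundedM; last exact: FB.
apply: (@bounded_ext _ _ _ _ (fun tau => (-1) ^+ (s + i) *
  \det (\matrix_(k, l) A t tau (lift s k) (lift i l)))).
  apply: filterE => w /=; rewrite mxE /cofactor; congr (_ * \det _).
  by apply/matrixP => k l; rewrite !mxE.
by apply: boundedM; apply: clim_bounded; [exact: clim_cst|exact: dA].
Qed.

Lemma pcoef_T tau i : (forall tau z, 0 < Im tau -> F (tau + 1) z = F tau z) ->
  0 < Im tau -> pcoef (tau + 1) i = pcoef tau i.
Proof.
move=> FT yt; have yt1 : 0 < Im (tau + 1) by rewrite ImD1.
apply: (@pcoef_unique _ (pcoef tau)) => // z; rewrite FT// pcoefE//.
by apply: eq_bigr => j _; rewrite psi_T.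
Qed.

End Coefficients.

(** Two functions are allowed because in two variables the inversion also moves the parameter, from
    w to w / tau. *)
Lemma pcoef_S (R : realType) a (F F' : R[i] -> R[i] -> R[i]) (a0 : (0 < a)%N)
    (FV : forall tau, 0 < complex.Im tau -> Vsp a tau (F tau))
    (FV' : forall tau, 0 < complex.Im tau -> Vsp a tau (F' tau)) tau m i :
  0 < complex.Im tau ->
  (forall z, F' (- tau^-1) (z / tau) = m * ee (z ^+ 2 / (2 * tau)) ^+ a * F tau z) ->
  pcoef a0 FV' (- tau^-1) i = m * tau ^+ (a - ordi i) * pcoef a0 FV tau i.
Proof.
move=> yt FS; have t0 := H_neq0 yt; have ys := ImV_gt0 yt.
apply: (@pcoef_unique _ _ _ _ _ _ (fun i => m * tau ^+ (a - ordi i) * pcoef a0 FV tau i)) => // w.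
have -> : w = (w * tau) / tau by rewrite mulfK.
rewrite FS (pcoefE a0 FV)// mulr_sumr; apply: eq_bigr => j _; rewrite psi_S//.
by field; rewrite expf_neq0.
Qed.


(** * Level one modular forms *)

Section ModularForms.
Variable R : realType.
Local Notation C := R[i].
Local Notation Im := complex.Im.
Implicit Types (tau z w : C) (g h : C -> C).

(** The transformation law is imposed on the two generators of the modular group, and holomorphy at
    the cusp is boundedness for large Im tau. *)
Definition mform (k : int) g := [/\ forall tau, 0 < Im tau -> cdiff g tau,
  forall tau, 0 < Im tau -> g (tau + 1) = g tau,
  forall tau, 0 < Im tau -> g (- tau^-1) = tau ^ k * g tau &
  bounded_along (@icusp R) g].

(** Extension by 0 makes [g] 1-periodic on the whole plane, as the Fourier lemmas ask. *)
Definition ext0 g z : C := if 0 < Im z then g z else 0.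

Lemma near_upper tau : 0 < Im tau -> cnear tau [set w | 0 < Im w].
Proof.
move=> yt; exists (Im tau) => // w; have := cnorm_Im (w - tau); rewrite cImD cImN => h1 h2 /=.
by have := ler_norm (- (Im w - Im tau)); rewrite normrN; lra.
Qed.

Section PeriodicOnH.
Variable g : C -> C.
Hypothesis gD : forall tau, 0 < Im tau -> cdiff g tau.
Hypothesis gT : forall tau, 0 < Im tau -> g (tau + 1) = g tau.

Lemma ext0E tau : 0 < Im tau -> ext0 g tau = g tau. Proof. by rewrite /ext0 => ->. Qed.

Lemma ext0_diff tau : 0 < Im tau -> cdiff (ext0 g) tau.
Proof.
move=> yt; apply: cdiff_ext (gD yt); apply: filterS (near_upper yt) => w yw.
by rewrite /= ext0E.
Qed.

Lemma ext0_per tau : ext0 g (tau + 1) = ext0 g tau.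
Proof. by rewrite /ext0 ImD1; case: ifP => // /gT. Qed.

Lemma ext0_cusp : bounded_along (@icusp R) g -> bounded_along (@icusp R) (ext0 g).
Proof. by apply: bounded_ext; exists 0 => w yw; rewrite /= ext0E. Qed.

Lemma bounded_line (y : R) : 0 < y ->
  exists M, forall x, 0 <= x <= 1 -> cnorm (g (x +i* y)) <= M.
Proof.
move=> y0; have [x|M HM] := @bounded_segment _ (fun x => g (x +i* y)); last by exists M.
exact: (rcont_line (cdiff_cont (gD (_ : 0 < Im (x +i* y))))).1.
Qed.

(** [cusp_tail], from the line at height 1, bounds the remainder by a multiple of |q|. In this form
    it is ready to be divided by a function of exact order q. *)
Lemma cusp_expansion : bounded_along (@icusp R) g ->
  exists c, bounded_along (@icusp R) (fun tau => (g tau - c) * ee (- tau)).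
Proof.
move=> gB; have [M HM] := bounded_line ltr01.
exists (hcoef (ext0 g) 1 0); exists (2 * M * expR (2 * pi)); exists 2 => tau yt /=.
have y0 : 0 < Im tau by lra.
have M0 : 0 <= M by apply: le_trans (HM 0 _); rewrite ?cnorm_ge0// lexx ler01.
have HM' x : 0 <= x <= 1 -> cnorm (ext0 g (x +i* 1)) <= M by rewrite /ext0 /= ltr01; exact: HM.
have y1 : 1 < Im tau by lra.
have := cusp_tail ext0_diff ext0_per ltr01 (ext0_cusp gB) HM' y1 (erefl _).
rewrite ext0E// cnormM cnorm_ee cImN; set x := expR _ => h.
have p2 := pi_ge2 R.
have x2 : x <= 2^-1.
  have k : 2 <= expR (2 * pi * (Im tau - 1)).
    apply: le_trans (expR_ge1Dx _); have : 1 * 1 <= 2 * pi * (Im tau - 1) by apply: ler_pM; lra.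
    by lra.
  by rewrite /x expRN lef_pV2 ?posrE ?expR_gt0.
have x0 : 0 < x by rewrite expR_gt0.
have hx : M * (x / (1 - x)) <= 2 * M * x.
  rewrite (_ : 2 * M * x = M * (2 * x)); last by ring.
  rewrite ler_wpM2l// ler_pdivrMr; last by lra.
  by nra.
apply: le_trans (ler_wpM2r (expR_ge0 _) (le_trans h hx)) _.
rewrite -[leLHS]mulrA /x -expRD; apply: ler_wpM2l; first exact: mulr_ge0.
by rewrite ler_expR; lra.
Qed.

End PeriodicOnH.

(* |g| on Im = 1/4 bounds |g| on Im >= 1/2 with a factor < 1, and reduction theory
   bounds it back. *)
Lemma mform0_vanish g : mform 0 g -> bounded_along (@icusp R) (fun tau => g tau * ee (- tau)) ->
  forall tau, 0 < Im tau -> g tau = 0.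
Proof.
move=> [gD gT gS gB] g0.
have q4 : 0 < 4^-1 :> R by rewrite invr_gt0.
have [M0 HM0] := bounded_line gD q4.
(* The constant coefficient of [g] is the coefficient of index -1 of g e(- tau), which is bounded at
   the cusp. *)
have a0 : hcoef (ext0 g) 4^-1 0 = 0.
  pose h z := g z * ee (- z).
  have hD tau : 0 < Im tau -> cdiff h tau.
    move=> yt; apply: cdiffM; first exact: gD.
    apply: cdiff_ext (ex_intro _ _ (cderiv_ee_affine (-1) 0 tau)).
    by apply: filterE => w /=; rewrite addr0 mulN1r.
  have hT tau : 0 < Im tau -> h (tau + 1) = h tau.
    by move=> yt; rewrite /h gT// opprD eeD [ee (- 1)]eeN ee1 invr1 mulr1.
  have := hcoef_cusp (ext0_diff hD) (ext0_per hT) q4 (ltrN10 _) (ext0_cusp g0).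
  move=> E; rewrite -[RHS]E /hcoef; congr (cint _ 0 1); apply/funext => x.
  rewrite /ext0 /= q4 /h mulr0z oppr0 mul0r ee0 mulr1 -mulrA -eeD.
  by rewrite mulrN1z opprK mul1r addNr ee0 mulr1.
have bnd (S : R) : (forall x, 0 <= x <= 1 -> cnorm (g (x +i* 4^-1)) <= S) ->
    forall tau, 0 < Im tau -> cnorm (g tau) <= S * (5 / 7).
  move=> HS.
  have S00 : 0 <= S by apply: le_trans (HS 0 _); rewrite ?cnorm_ge0// lexx ler01.
  apply: modular_reduction => [tau yt|tau yt|tau yt].
  - have q4t : 4^-1 < Im tau by lra.
    have HS' x : 0 <= x <= 1 -> cnorm (ext0 g (x +i* 4^-1)) <= S.
      by rewrite /ext0 /= q4; exact: HS.
    have := cusp_tail (ext0_diff gD) (ext0_per gT) q4 (ext0_cusp gB) HS' q4t (erefl _).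
    rewrite a0 subr0 ext0E; last by lra.
    set x := expR _ => h; apply: le_trans h _; rewrite ler_wpM2l//.
    have x0 : 0 < x by rewrite expR_gt0.
    have p2 := pi_ge2 R.
    (* The heights differ by at least 1/4 and 2 pi / 4 >= 1. From x <= 5/12 follows x / (1 - x) <=
       5/7, the contraction factor. *)
    have x3 : x <= 5 / 12.
      rewrite /x -[5 / 12]expr1; apply: expRN_nat_le.
      have : 4 * 4^-1 <= 2 * pi * (Im tau - 4^-1) by apply: ler_pM; lra.
      by lra.
    by rewrite ler_pdivrMr; lra.
  - by rewrite gT.
  - by rewrite gS// expr0z mul1r.
(* Three contractions, since (5/7)^3 < 1/2. *)
have bnd2 (S : R) : (forall tau, 0 < Im tau -> cnorm (g tau) <= S) ->
    forall tau, 0 < Im tau -> cnorm (g tau) <= S / 2.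
  move=> HS tau yt.
  have L (S' : R) : (forall tau, 0 < Im tau -> cnorm (g tau) <= S') ->
      forall tau, 0 < Im tau -> cnorm (g tau) <= S' * (5 / 7).
    by move=> HS'; apply: bnd => x _; apply: HS'.
  have := L _ (L _ (L _ HS)) tau yt; have := le_trans (cnorm_ge0 _) (HS tau yt); lra.
move=> tau yt; apply/eqP; rewrite -cnorm_eq0; apply/eqP/le_anti.
rewrite cnorm_ge0 andbT leNgt; apply/negP => g1.
have bn n : forall tau, 0 < Im tau -> cnorm (g tau) <= M0 * (5 / 7) / 2 ^+ n.
  elim: n => [|n IH]; first by rewrite expr0 divr1; exact: bnd HM0.
  by move=> w yw; apply: le_trans (bnd2 _ IH w yw) _; rewrite exprSr invfM [leRHS]mulrA.
have [n hn] := exists_small_half (M0 * (5 / 7)) g1.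
by have := bn n tau yt; rewrite leNgt hn.
Qed.

End ModularForms.


(** * Expansion in two variables *)

Section TwoVariables.
Variable R : realType.
Local Notation C := R[i].
Local Notation Im := complex.Im.
Implicit Types (tau z w : C).

(** The expansion in z has coefficients depending on w; uniqueness gives them the quasi-periodicity
    of [F] in w, so they can be expanded in turn. Under inversion the basis functions have weights
    [- (a - ordi i)] and [- (c - ordi j)], and the coefficient makes up for them. *)
Lemma two_variable_coefficients (a c : nat) (k : int) (F : C -> C -> C -> C) :
  (0 < a)%N -> (0 < c)%N ->
  (forall tau w, 0 < Im tau -> Vsp a tau (fun z => F tau z w)) ->
  (forall tau z, 0 < Im tau -> Vsp c tau (F tau z)) ->
  (forall tau z w, 0 < Im tau -> cdiff (fun t => F t z w) tau) ->
  (forall tau z w, 0 < Im tau -> F (tau + 1) z w = F tau z w) ->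
  (forall tau z w, 0 < Im tau -> F (- tau^-1) (z / tau) (w / tau) =
    tau ^ k * ee (w ^+ 2 / (2 * tau)) ^+ c * ee (z ^+ 2 / (2 * tau)) ^+ a * F tau z w) ->
  (forall z w, bounded_along (@icusp R) (fun t => F t z w)) ->
  exists g : 'I_a -> 'I_c -> C -> C, (forall i j, exists l, mform l (g i j)) /\
    forall tau z w, 0 < Im tau ->
      F tau z w = \sum_i \sum_j g i j tau * (psi i tau z * psi j tau w).
Proof.
move=> a0 c0 V1 V2 FD FT FS FB.
have V w tau (yt : 0 < Im tau) := V1 tau w yt.
pose p i tau w := pcoef a0 (V w) tau i.
have pE tau z w : 0 < Im tau -> F tau z w = \sum_i p i tau w * psi i tau z.
  by move=> yt; exact: (pcoefE a0 (V w)).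
have pV i tau : 0 < Im tau -> Vsp c tau (p i tau).
  move=> yt; split=> w.
  - have [t d0] := exists_sample a yt.
    set A := (X in \det X) in d0.
    apply: (@cdiff_ext _ (fun w => (\det A)^-1 * \sum_s (\adj A i s * F tau (t s) w))).
      by apply: filterE => w' /=; rewrite /p (pcoef_sample a0 (V w') i yt d0).
    apply: cdiffM; first exact: cdiff_cst.
    apply: cdiff_sum => s; apply: cdiffM; first exact: cdiff_cst.
    by have [d _ _] := V2 tau (t s) yt; exact: d.
  - apply: (@pcoef_unique _ _ _ a0 (V (w + 1)) _ (fun i => (-1) ^+ c * p i tau w)) => // z.
    have [_ -> _] := V2 tau z yt; rewrite pE// mulr_sumr; apply: eq_bigr => j _.
    by rewrite mulrA.
  - apply: (@pcoef_unique _ _ _ a0 (V (w + tau)) _ (fun i => (-1) ^+ c *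
      ee (- (c%:R / 2 * tau) - c%:R * w) * p i tau w)) => // z.
    have [_ _ ->] := V2 tau z yt; rewrite pE// mulr_sumr; apply: eq_bigr => j _.
    by rewrite mulrA.
exists (fun i j tau => pcoef c0 (pV i) tau j); split.
  move=> i j; exists (k + (a - ordi i)%:Z + (c - ordi j)%:Z); split=> [tau yt|tau yt|tau yt|].
  - apply: pcoef_cdiff => // t w yt'; apply: (pcoef_cdiff a0 (V w)) => // s z ys.
    exact: FD.
  - apply: pcoef_T => // t w yt'; apply: (pcoef_T a0 (V w)) => // s z ys.
    exact: FT.
  - have t0 := H_neq0 yt.
    rewrite (pcoef_S c0 (pV i) (pV i) (m := tau ^ k * tau ^+ (a - ordi i)))//.
      by rewrite !expfzDr// !exprnP.
    move=> w; rewrite /p (pcoef_S a0 (V w) (V (w / tau)) (m := tau ^ k *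
      ee (w ^+ 2 / (2 * tau)) ^+ c))//; first by ring.
    by move=> z; rewrite FS.
  - apply: pcoef_bounded => w; apply: (pcoef_bounded a0 (V w)) => z; exact: FB.
move=> tau z w yt; rewrite pE//; apply: eq_bigr => i _.
rewrite (pcoefE c0 (pV i) w yt) mulr_suml; apply: eq_bigr => j _; ring.
Qed.

End TwoVariables.

(** * The Weierstrass equation and the structure of level one forms *)

Section Weierstrass.
Variable R : realType.
Local Notation C := R[i].
Local Notation Im := complex.Im.
Local Notation tpi := (tpi R).
Implicit Types (tau z w v : C) (g h : C -> C) (k l : int).

Lemma mform_wt k l g : k = l -> mform k g -> mform l g. Proof. by move=> ->. Qed.

Lemma mform_cst (c : C) : mform 0 (fun=> c).
Proof.
split=> [tau _|//|tau _|]; first exact: cdiff_cst.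
  by rewrite expr0z mul1r.
by apply: clim_bounded (clim_cst c).
Qed.

Lemma mformM k l g h : mform k g -> mform l h -> mform (k + l) (fun t => g t * h t).
Proof.
move=> [g1 g2 g3 g4] [h1 h2 h3 h4]; split=> [tau yt|tau yt|tau yt|].
- by apply: cdiffM; [exact: g1|exact: h1].
- by rewrite g2// h2.
- by rewrite g3// h3// expfzDr ?H_neq0//; ring.
- exact: boundedM.
Qed.

Lemma mformD k g h : mform k g -> mform k h -> mform k (fun t => g t + h t).
Proof.
move=> [g1 g2 g3 g4] [h1 h2 h3 h4]; split=> [tau yt|tau yt|tau yt|].
- by apply: cdiffD; [exact: g1|exact: h1].
- by rewrite g2// h2.
- by rewrite g3// h3// mulrDr.
- exact: boundedD.
Qed.

Lemma mformZ k (c : C) g : mform k g -> mform k (fun t => c * g t).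
Proof. by move=> H; apply: mform_wt (mformM (mform_cst c) H); rewrite add0r. Qed.

Lemma mformX k n g : mform k g -> mform (k * n%:Z) (fun t => g t ^+ n).
Proof.
move=> H; elim: n => [|n IH]; first by rewrite mulr0; exact: mform_cst.
apply: mform_wt (_ : mform (k + k * n%:Z) _); first by lia.
by have := mformM H IH; congr mform; apply/funext => t; rewrite exprS.
Qed.

(** Inverting twice returns to [tau], but the product of the two automorphy factors is -1. *)
Lemma mform_odd k g : mform (2 * k + 1) g -> forall tau, 0 < Im tau -> g tau = 0.
Proof.
move=> [_ _ gS _] tau yt; have t0 := H_neq0 yt.
have := gS _ (ImV_gt0 yt); rewrite (gS tau yt) invrN invrK opprK mulrA => E.
have s1 : (- tau^-1) ^ (2 * k + 1) * tau ^ (2 * k + 1) = -1.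
  rewrite -exprzMl ?unitfE ?oppr_eq0 ?invr_eq0// mulNr mulVf//.
  have s2 : (-1) ^ (2 : int) = 1 :> C by rewrite -[LHS]/((-1) ^+ 2) sqrrN expr1n.
  by rewrite expfzDr ?oppr_eq0 ?oner_eq0// -exprz_exp s2 exp1rz mul1r expr1z.
move: E; rewrite s1 mulN1r => /eqP; rewrite -subr_eq0 opprK -mulr2n mulrn_eq0 /=.
by move/eqP.
Qed.

Lemma quot_opp tau z :
  [/\ ph tau (- z) = - ph tau z, xx tau (- z) = xx tau z & yy tau (- z) = yy tau z].
Proof.
by split; rewrite /ph /xx /yy /phG /xxG /yyG !TH_opp; ring.
Qed.

Lemma ph0 tau : ph tau 0 = 0. Proof. by rewrite /ph /phG TH00 mul0r. Qed.

Lemma xx0 tau : 0 < Im tau -> xx tau 0 = 1.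
Proof. by move=> yt; rewrite /xx /xxG TH00; field; exact: D0_neq0. Qed.

Lemma yy0 tau : 0 < Im tau -> yy tau 0 = -2.
Proof. by move=> yt; rewrite /yy /yyG TH00; field; exact: D0_neq0. Qed.

Let o6 (n : nat) (h : (n < 6)%N) := @Ordinal 6 n h.

Lemma psi_yy tau z : psi (@Ordinal 3 2 isT) tau z = yy tau z.
Proof.
have -> : psi (@Ordinal 3 2 isT) tau z = ph tau z ^+ 0 * (xx tau z ^+ 0 * yy tau z) by [].
by rewrite !expr0 !mul1r.
Qed.

Lemma yy2V tau : 0 < Im tau -> Vsp 6 tau (fun z => yy tau z ^+ 2).
Proof. by move=> yt; exact: (VspX 2 (Vsp_yy yt)). Qed.

Let al := pcoef (isT : (0 < 6)%N) yy2V.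

Lemma al_mform (i : 'I_6) : mform (6 - ordi i)%:Z (al^~ i).
Proof.
split=> [tau yt|tau yt|tau yt|].
- apply: pcoef_cdiff => // t z yt'; apply: cdiffX.
  apply: cdiff_ext (cdiff_psi (@Ordinal 3 2 isT) z yt').
  by apply: filterE => w; rewrite /= psi_yy.
- apply: pcoef_T => // t z yt'; by have [_ _ ->] := quot_T z yt'.
- rewrite /al (pcoef_S _ yy2V yy2V (m := 1))// ?mul1r// => z.
  have [_ _ ->] := quot_S z yt; rewrite mul1r; set e := ee _; ring.
- apply: pcoef_bounded => z; apply: (@clim_bounded _ _ _ _ _ (psiL (@Ordinal 3 2 isT) z ^+ 2)).
  apply: climX; apply: clim_ext (psi_cusp (@Ordinal 3 2 isT) z).
  by apply: filterE => w; rewrite /= psi_yy.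
Qed.

(** In the expansion of [yy ^+ 2], of index 6, the odd powers of [ph] disappear by parity, as [ph]
    is odd and [xx], [yy] are even. At z = 0 only the cube of [xx] survives, and [yy] has the value
    -2 there, whence the coefficient 4. *)
Lemma weierstrass : exists al0 al1 al2 : C -> C,
  [/\ mform 6 al0, mform 4 al1, mform 2 al2 & forall tau z, 0 < Im tau ->
    yy tau z ^+ 2 = 4 * xx tau z ^+ 3 + al2 tau * ph tau z ^+ 2 * xx tau z ^+ 2 +
      al1 tau * ph tau z ^+ 4 * xx tau z + al0 tau * ph tau z ^+ 6].
Proof.
exists (al^~ (o6 (isT : 0 < 6)%N)), (al^~ (o6 (isT : 1 < 6)%N)), (al^~ (o6 (isT : 3 < 6)%N)).
split; [exact: (al_mform (o6 (isT : 0 < 6)%N))|exact: (al_mform (o6 (isT : 1 < 6)%N))|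
  exact: (al_mform (o6 (isT : 3 < 6)%N))|move=> tau z yt].
have sum6 (f : 'I_6 -> C) : \sum_i f i = f (o6 (isT : 0 < 6)%N) + (f (o6 (isT : 1 < 6)%N) +
    (f (o6 (isT : 2 < 6)%N) + (f (o6 (isT : 3 < 6)%N) + (f (o6 (isT : 4 < 6)%N) +
    f (o6 (isT : 5 < 6)%N))))).
  by rewrite !big_ord_recl big_ord0 addr0; do !congr (_ + _); congr f; apply/val_inj.
have p0 w : psi (o6 (isT : 0 < 6)%N) tau w = ph tau w ^+ 6 * 1 by [].
have p1 w : psi (o6 (isT : 1 < 6)%N) tau w = ph tau w ^+ 4 * xx tau w by [].
have p2 w : psi (o6 (isT : 2 < 6)%N) tau w = ph tau w ^+ 3 * (1 * yy tau w) by [].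
have p3 w : psi (o6 (isT : 3 < 6)%N) tau w = ph tau w ^+ 2 * xx tau w ^+ 2 by [].
have p4 w : psi (o6 (isT : 4 < 6)%N) tau w = ph tau w ^+ 1 * (xx tau w ^+ 1 * yy tau w) by [].
have p5 w : psi (o6 (isT : 5 < 6)%N) tau w = ph tau w ^+ 0 * xx tau w ^+ 3 by [].
have S w : yy tau w ^+ 2 = \sum_i al tau i * psi i tau w by exact: (pcoefE (isT : (0 < 6)%N) yy2V w yt).
have odd0 (i : 'I_6) : odd (6 - ordi i) -> al tau i = 0.
  move=> oi; have E : al tau i = (-1) ^+ (6 - ordi i) * al tau i.
    apply: (@pcoef_unique _ _ _ _ yy2V _ (fun i => (-1) ^+ (6 - ordi i) * al tau i)) => // w.
    have [_ _ <-] := quot_opp tau w; rewrite S; apply: eq_bigr => j _.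
    rewrite [_ * al tau j]mulrC -mulrA; congr (_ * _).
    have [h1 h2 h3] := quot_opp tau w.
    rewrite /psi /psG /PfG -!/(ph _ _) -!/(xx _ _) -!/(yy _ _) h1 h2 h3.
    by rewrite (exprNn (ph tau w)) mulrA.
  move: E; rewrite -signr_odd oi expr1 mulN1r => /eqP.
  by rewrite -subr_eq0 opprK -mulr2n mulrn_eq0 /= => /eqP.
have a5 : al tau (o6 (isT : 5 < 6)%N) = 4.
  have := S 0; rewrite sum6 p0 p1 p2 p3 p4 p5 ph0 xx0// yy0// => E.
  apply: (@eq_trans _ _ ((-2) ^+ 2)); last by ring.
  by rewrite E; ring.
rewrite S sum6 p0 p1 p2 p3 p4 p5 a5 (odd0 (o6 (isT : 2 < 6)%N))// (odd0 (o6 (isT : 4 < 6)%N))//.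
by ring.
Qed.

(** As a function of z the product has index 2, hence is a combination of [ph ^+ 2] and [xx]; z = 0
    and z = v give the coefficients. Divided by the squares of [ph] at z and v, it is the
    sigma-function formula for wp(v) - wp(z). *)
Lemma ph_addition tau z v : 0 < Im tau -> ph tau v != 0 ->
  ph tau (z + v) * ph tau (z - v) = xx tau v * ph tau z ^+ 2 - ph tau v ^+ 2 * xx tau z.
Proof.
move=> yt v0; have [d p1 pt] := Vsp_ph yt.
pose h z := ph tau (z + v) * ph tau (z - v).
have Vh : Vsp 2 tau h.
  split=> w.
  - apply: cdiffM.
      apply: (@cdiff_comp _ (ph tau) (fun w => w + v)); first exact: d.
      by apply: cdiffD; [exact: cdiff_id|exact: cdiff_cst].
    apply: (@cdiff_comp _ (ph tau) (fun w => w - v)); first exact: d.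
    by apply: cdiffB; [exact: cdiff_id|exact: cdiff_cst].
  - rewrite /h (addrAC w 1 v) (addrAC w 1 (- v)) !p1; ring.
  - rewrite /h (addrAC w tau v) (addrAC w tau (- v)) !pt.
    have -> : ee (- (2%:R / 2 * tau) - 2%:R * w) = ee (- (1 / 2 * tau) - 1 * (w + v)) *
        ee (- (1 / 2 * tau) - 1 * (w - v)) by rewrite -eeD; congr ee; field.
    by ring.
have [c hc] := Vsp_span (isT : (0 < 2)%N) yt (fun i => Vsp_psi i yt) (psi_independent yt) Vh.
have E w : h w = c ord0 * ph tau w ^+ 2 + c ord_max * xx tau w.
  rewrite hc big_ord_recl big_ord1.
  have -> : psi (ord0 : 'I_2) tau w = ph tau w ^+ 2 * 1 by [].
  have -> : lift ord0 ord0 = ord_max :> 'I_2 by apply/val_inj.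
  have -> : psi (ord_max : 'I_2) tau w = ph tau w ^+ 0 * xx tau w by [].
  by rewrite mulr1 mul1r.
have c1 : c ord_max = - ph tau v ^+ 2.
  have := E 0; rewrite ph0 xx0// /h add0r sub0r; have [-> _ _] := quot_opp tau v.
  by rewrite expr0n /= mulr0 add0r mulr1 => <-; ring.
have c0 : c ord0 = xx tau v.
  have := E v; rewrite /h subrr ph0 mulr0 c1 => /esym/eqP; rewrite mulNr subr_eq0 => /eqP.
  by rewrite [RHS]mulrC; apply: mulIf; exact: expf_neq0.
by rewrite -/(h z) E c0 c1 mulNr.
Qed.

(** * The forms of weight 4 and 6 and the discriminant *)

Section Discriminant.
Variables al0 al1 al2 : C -> C.
Hypothesis m0 : mform 6 al0.
Hypothesis m1 : mform 4 al1.
Hypothesis m2 : mform 2 al2.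
Hypothesis rel : forall tau z, 0 < Im tau ->
    yy tau z ^+ 2 = 4 * xx tau z ^+ 3 + al2 tau * ph tau z ^+ 2 * xx tau z ^+ 2 +
      al1 tau * ph tau z ^+ 4 * xx tau z + al0 tau * ph tau z ^+ 6.

(* In terms of the roots e1, e2, e3 of the cubic, E4 and E6 are
   s1^2 - 3 s2 and (2e1-e2-e3)(2e2-e1-e3)(2e3-e1-e2), and Dl is the discriminant. *)
Definition E4 tau : C := al2 tau * al2 tau / 16 + (- 3 / 4) * al1 tau.
Definition E6 tau : C := (- 1 / 32) * (al2 tau * al2 tau * al2 tau) +
  (9 / 16 * (al2 tau * al1 tau) + (- 27 / 4) * al0 tau).
Definition Dl tau : C := 4 / 27 * E4 tau ^+ 3 + (- 1 / 27) * E6 tau ^+ 2.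

Lemma E4_mform : mform 4 E4.
Proof.
have := mformD (mformZ (16^-1) (mformM m2 m2)) (mformZ (- 3 / 4) m1).
by congr mform; apply/funext => t; rewrite /E4; congr (_ + _); rewrite mulrC.
Qed.

Lemma E6_mform : mform 6 E6.
Proof.
exact: (mformD (mformZ _ (mformM (mformM m2 m2) m2))
  (mformD (mformZ _ (mformM m2 m1)) (mformZ _ m0))).
Qed.

Lemma Dl_mform : mform 12 Dl.
Proof. exact: (mformD (mformZ _ (mformX 3 E4_mform)) (mformZ _ (mformX 2 E6_mform))). Qed.

(** theta'(0) and theta at the three half periods, each scaled by the power of q that gives it a
    finite nonzero limit at the cusp. *)
Let t1 tau := ee (- (tau / 8)) * TH 1 tau 0.
Let b1 tau := ee (- (tau / 8)) * TH 0 tau 2^-1.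
Let b2 tau := ee (tau / 8) * TH 0 tau (tau / 2 + 0).
Let b3 tau := ee (tau / 8) * TH 0 tau (tau / 2 + 2^-1).
(** The root differences e1 - e2, e1 - e3 and e2 - e3 as [ph_addition] expresses them. The factor
    q^(1/2) in [d23] is the source of the simple zero of the discriminant at the cusp. *)
Let d12 tau := - (b3 tau ^+ 2 * t1 tau ^+ 2 / (b1 tau ^+ 2 * b2 tau ^+ 2)).
Let d13 tau := - (b2 tau ^+ 2 * t1 tau ^+ 2 / (b1 tau ^+ 2 * b3 tau ^+ 2)).
Let d23' tau := b1 tau ^+ 2 * t1 tau ^+ 2 / (b2 tau ^+ 2 * b3 tau ^+ 2).
Let d23 tau := ee (tau / 2) * d23' tau.

Lemma cubic_root tau z : 0 < Im tau -> ph tau z != 0 -> yy tau z = 0 ->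
  let e := xx tau z / ph tau z ^+ 2 in
  4 * e ^+ 3 + al2 tau * e ^+ 2 + al1 tau * e + al0 tau = 0.
Proof.
move=> yt p0 y0 /=; have := rel z yt; rewrite y0 expr0n /= => E.
apply: (mulIf (expf_neq0 6 p0)); rewrite mul0r [RHS]E; by field.
Qed.

Lemma neg_self (x : C) : x = - x -> x = 0.
Proof.
by move/eqP; rewrite -subr_eq0 opprK -mulr2n mulrn_eq0 /= => /eqP.
Qed.


(** [yy] is even, and a full period relates its values at the two opposite half-period points by the
    factor -1, so it equals its own negative there. *)
Lemma yy_half tau : 0 < Im tau ->
  [/\ yy tau 2^-1 = 0, yy tau (tau / 2) = 0 & yy tau (tau / 2 + 2^-1) = 0].
Proof.
move=> yt; have [_ p1 pt] := Vsp_yy yt.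
have op z : yy tau (- z) = yy tau z by have [_ _] := quot_opp tau z.
have s3 : (-1) ^+ 3 = -1 :> C by ring.
split; apply: neg_self.
- have := p1 (- 2^-1); rewrite op s3 mulN1r => <-; congr yy; by field.
- have := pt (- (tau / 2)); rewrite op s3.
  rewrite (_ : - (3 / 2 * tau) - 3 * - (tau / 2) = 0); last by field.
  by rewrite ee0 mulr1 mulN1r => <-; congr yy; field.
- have := pt (- (tau / 2 + 2^-1) + 1); rewrite p1 op s3.
  rewrite (_ : - (3 / 2 * tau) - 3 * (- (tau / 2 + 2^-1) + 1) = 2^-1 - 2%:R); last by field.
  rewrite eeB ee_half ee_nat divr1 mulrNN mul1r mul1r mulN1r => <-; congr yy; by field.
Qed.

(** The half periods give three roots of the cubic, and their differences are products of theta
    constants that are known to be nonzero at this height. The coefficients of the cubic then follow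
    from the roots. *)
Lemma disc_low tau : 2^-1 <= Im tau ->
  [/\ E4 tau = (d12 tau ^+ 2 + d13 tau ^+ 2 + d23 tau ^+ 2) / 2,
      E6 tau = (d12 tau + d13 tau) * (d23 tau - d12 tau) * (- d13 tau - d23 tau),
      Dl tau = (d12 tau * d13 tau * d23 tau) ^+ 2 & d12 tau * d13 tau * d23 tau != 0].
Proof.
move=> y2; have yt : 0 < Im tau by lra.
have [n0 n1 n2] := And3 (TH1_neq0_low y2) (TH0_half1_neq0_low y2) (TH0_half_neq0_low y2 0).
have n3 := TH0_half_neq0_low y2 2^-1.
rewrite rmorphV ?unitfE// rmorph_nat in n3.
rewrite rmorph0 addr0 in n2.
have f1 : ph tau 2^-1 != 0 by rewrite mulf_neq0 ?invr_neq0.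
have f2 : ph tau (tau / 2) != 0 by rewrite mulf_neq0 ?invr_neq0.
have f3 : ph tau (tau / 2 + 2^-1) != 0 by rewrite mulf_neq0 ?invr_neq0.
have [y1 y2' y3] := yy_half yt.
have := cubic_root yt f1 y1; have := cubic_root yt f2 y2'; have := cubic_root yt f3 y3 => /=.
set e1 := xx tau 2^-1 / _; set e2 := xx tau (tau / 2) / _; set e3 := xx tau (_ + _) / _.
move=> c3 c2 c1.
have [_ p1 pt] := Vsp_ph yt.
have s1 : (-1) ^+ 1 = -1 :> C by ring.
have dE z v : ph tau z != 0 -> ph tau v != 0 -> xx tau v / ph tau v ^+ 2 - xx tau z / ph tau z ^+ 2
    = ph tau (z + v) * ph tau (z - v) / (ph tau z ^+ 2 * ph tau v ^+ 2).
  by move=> z0 v0; rewrite ph_addition//; field; rewrite z0 v0.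
have h0 := ee_neq0 (tau / 8).
have D12 : e1 - e2 = d12 tau.
  rewrite /e1 /e2 dE// (_ : ph tau (tau / 2 + 2^-1) * _ = - ph tau (tau / 2 + 2^-1) ^+ 2).
    by rewrite /d12 /b1 /b2 /b3 /t1 addr0 /ph /phG eeN; field; rewrite ?h0 ?n0 ?n1 ?n2.
  have := p1 (tau / 2 - 2^-1); rewrite s1 mulN1r => /(congr1 -%R); rewrite opprK => <-.
  by rewrite (_ : tau / 2 - 2^-1 + 1 = tau / 2 + 2^-1); [ring|field].
have D13 : e1 - e3 = d13 tau.
  rewrite /e1 /e3 dE// (_ : ph tau (tau / 2 + 2^-1 + 2^-1) * _ = - ph tau (tau / 2) ^+ 2).
    by rewrite /d13 /b1 /b2 /b3 /t1 addr0 /ph /phG eeN; field; rewrite ?h0 ?n0 ?n1 ?n3.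
  rewrite addrK (_ : tau / 2 + 2^-1 + 2^-1 = tau / 2 + 1); last by field.
  by rewrite p1 s1; ring.
have D23 : e2 - e3 = d23 tau.
  rewrite /e2 /e3 dE// (_ : ph tau (tau / 2 + 2^-1 + tau / 2) * _ =
      ee (- (tau / 2)) * ph tau 2^-1 ^+ 2).
    rewrite /d23 /d23' /b1 /b2 /b3 /t1 addr0 /ph /phG !eeN.
    have -> : ee (tau / 2) = ee (tau / 8) ^+ 4 by rewrite -eeMn; congr ee; field.
    by field; rewrite ?h0 ?n0 ?n2 ?n3.
  rewrite (_ : tau / 2 + 2^-1 + tau / 2 = 2^-1 + tau); last by field.
  rewrite (_ : tau / 2 + 2^-1 - tau / 2 = 2^-1); last by field.
  rewrite pt s1 (_ : - (1 / 2 * tau) - 1 * 2^-1 = - (tau / 2) - 2^-1); last by field.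
  by rewrite eeB ee_half; field.
have nb1 : b1 tau != 0 by rewrite mulf_neq0 ?ee_neq0.
have nb2 : b2 tau != 0 by rewrite mulf_neq0 ?ee_neq0 ?addr0.
have nb3 : b3 tau != 0 by rewrite mulf_neq0 ?ee_neq0.
have nt1 : t1 tau != 0 by rewrite mulf_neq0 ?ee_neq0.
have nz (x y u v : C) : x != 0 -> y != 0 -> u != 0 -> v != 0 ->
    x ^+ 2 * y ^+ 2 / (u ^+ 2 * v ^+ 2) != 0.
  by move=> *; apply: mulf_neq0; rewrite ?invr_eq0; apply: mulf_neq0; exact: expf_neq0.
have N12 : d12 tau != 0.
  by rewrite /d12 /d13 oppr_eq0; exact: nz.
have N13 : d13 tau != 0.
  by rewrite /d12 /d13 oppr_eq0; exact: nz.
have N23 : d23 tau != 0.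
  by apply: mulf_neq0 (ee_neq0 _) _; exact: nz.
(* Divided differences of the root equations; a second one yields [r2], the sum of the roots. *)
have q12 : 4 * (e1 ^+ 2 + e1 * e2 + e2 ^+ 2) + al2 tau * (e1 + e2) + al1 tau = 0.
  apply: (mulfI N12); rewrite -D12 mulr0 -[RHS](subrr 0) -{1}c1 -c2; ring.
have q13 : 4 * (e1 ^+ 2 + e1 * e3 + e3 ^+ 2) + al2 tau * (e1 + e3) + al1 tau = 0.
  apply: (mulfI N13); rewrite -D13 mulr0 -[RHS](subrr 0) -{1}c1 -c3; ring.
have r2 : al2 tau = - 4 * (e1 + e2 + e3).
  apply/eqP; rewrite -subr_eq0; apply/eqP; apply: (mulfI N23).
  rewrite -D23 mulr0 -[RHS](subrr 0) -{1}q12 -q13; ring.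
have r1 : al1 tau = - (4 * (e1 ^+ 2 + e1 * e2 + e2 ^+ 2) + al2 tau * (e1 + e2)).
  by rewrite -[LHS]subr0 -[X in _ - X]q12; ring.
have r0 : al0 tau = - (4 * e1 ^+ 3 + al2 tau * e1 ^+ 2 + al1 tau * e1).
  by rewrite -[LHS]subr0 -[X in _ - X]c1; ring.
split; last by apply: mulf_neq0 => //; exact: mulf_neq0.
- by rewrite /E4 r1 r2 -D12 -D13 -D23; field.
- by rewrite /E6 r0 r1 r2 -D12 -D13 -D23; field.
- by rewrite /Dl /E4 /E6 r0 r1 r2 -D12 -D13 -D23; field.
Qed.

Lemma disc_cusp : [/\ clim (@icusp R) d12 (- (tpi ^+ 2 / 4)),
  clim (@icusp R) d13 (- (tpi ^+ 2 / 4)) & clim (@icusp R) d23' (4 * tpi ^+ 2)].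
Proof.
have L1 : clim (@icusp R) (fun t => t1 t ^+ 2) (tpi ^+ 2).
  by apply: climX; rewrite -TH_lim10; exact: TH_cusp.
have B1 : clim (@icusp R) (fun t => b1 t ^+ 2) (- 4).
  rewrite [X in clim _ _ X](_ : - 4 = TH_lim 0 (2^-1 : C) ^+ 2).
    by apply: climX; exact: TH_cusp.
  rewrite /TH_lim !expr0 !mul1r mulNr eeN; set x := ee _.
  have x2 : x ^+ 2 = -1 by rewrite /x -eeMn -ee_half; congr ee; field.
  rewrite (_ : (x - x^-1) ^+ 2 = (x ^+ 2 - 1) ^+ 2 / x ^+ 2); last by field; exact: ee_neq0.
  by rewrite x2; field.
have B2 : clim (@icusp R) (fun t => b2 t ^+ 2) 1.
  rewrite [X in clim _ _ X](_ : 1 = (- ee (- 0 / 2 : C)) ^+ 2).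
    by apply: climX; exact: TH0_half_cusp.
  by rewrite oppr0 mul0r ee0 sqrrN expr1n.
have B3 : clim (@icusp R) (fun t => b3 t ^+ 2) (- 1).
  rewrite [X in clim _ _ X](_ : - 1 = (- ee (- 2^-1 / 2 : C)) ^+ 2).
    by apply: climX; exact: TH0_half_cusp.
  by rewrite sqrrN -eeMn (_ : 2%:R * _ = - 2^-1 :> C); [rewrite eeN ee_half invrN1|field].
split.
- rewrite [X in clim _ _ X](_ : _ = - (- 1 * tpi ^+ 2 / (- 4 * 1))); last by field.
  apply: climN; apply: climM; first exact: (climM B3 L1).
  by apply: climV; [exact: (climM B1 B2)|rewrite mulr1 oppr_eq0 pnatr_eq0].
- rewrite [X in clim _ _ X](_ : _ = - (1 * tpi ^+ 2 / (- 4 * - 1))); last by field.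
  apply: climN; apply: climM; first exact: (climM B2 L1).
  by apply: climV; [exact: (climM B1 B3)|rewrite mulrNN mulr1 pnatr_eq0].
- rewrite [X in clim _ _ X](_ : _ = - 4 * tpi ^+ 2 / (1 * - 1)); last by field.
  apply: climM; first exact: (climM B1 L1).
  by apply: climV; [exact: (climM B2 B3)|rewrite mul1r oppr_eq0 oner_eq0].
Qed.

Lemma Dl_neq0 tau : 0 < Im tau -> Dl tau != 0.
Proof.
have [_ DT DS _] := Dl_mform; move: tau; apply: modular_reduction => [tau y2|tau yt|tau yt].
- by have [_ _ -> h] := disc_low y2; exact: expf_neq0.
- by rewrite DT.
- by rewrite DS// mulf_eq0 negb_or => /andP[].
Qed.

Lemma level_one_cusp : [/\ exists2 l, l != 0 & clim (@icusp R) E4 l,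
  exists2 l, l != 0 & clim (@icusp R) E6 l &
  exists2 l, l != 0 & clim (@icusp R) (fun t => Dl t * ee (- t)) l].
Proof.
have [L1 L2 L3'] := disc_cusp.
have low : icusp [set tau : C | 2^-1 <= Im tau] by exists 2^-1 => t /ltW.
have e2 : clim (@icusp R) (fun t => ee (t / 2)) 0.
  have h2 : 0 < 2^-1 :> R by rewrite invr_gt0.
  apply: clim_ext (clim_ee_cusp h2); apply: filterE => t /=.
  by rewrite mulrC rmorphV ?unitfE// rmorph_nat.
have L3 : clim (@icusp R) d23 0.
  by rewrite [X in clim _ _ X](_ : 0 = 0 * (4 * tpi ^+ 2)); [exact: (climM e2 L3')|rewrite mul0r].
have tp := tpi_neq0 R.
split.
- exists ((tpi ^+ 2 / 4) ^+ 2); first by rewrite expf_neq0// mulf_neq0// ?expf_neq0// invr_neq0.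
  apply: (@clim_ext _ _ _ _ (fun t => (d12 t ^+ 2 + d13 t ^+ 2 + d23 t ^+ 2) / 2)).
    by apply: filterS low => t yt /=; have [-> _ _ _] := disc_low yt.
  rewrite [X in clim _ _ X](_ : _ = ((- (tpi ^+ 2 / 4)) ^+ 2 + (- (tpi ^+ 2 / 4)) ^+ 2 + 0 ^+ 2) / 2).
    apply: climM; last exact: clim_cst.
    by apply: climD; [apply: climD|]; apply: climX.
  by field.
- exists (- 2 * (tpi ^+ 2 / 4) ^+ 3).
    by rewrite mulf_neq0 ?oppr_eq0// expf_neq0// mulf_neq0// ?expf_neq0// invr_neq0.
  apply: (@clim_ext _ _ _ _ (fun t => (d12 t + d13 t) * (d23 t - d12 t) * (- d13 t - d23 t))).
    by apply: filterS low => t yt /=; have [_ -> _ _] := disc_low yt.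
  rewrite [X in clim _ _ X](_ : _ = (- (tpi ^+ 2 / 4) + - (tpi ^+ 2 / 4)) *
    (0 - - (tpi ^+ 2 / 4)) * (- - (tpi ^+ 2 / 4) - 0)); last by field.
  apply: climM; [apply: climM|]; [exact: climD|exact: climB|apply: climB => //].
  exact: climN.
- exists ((- (tpi ^+ 2 / 4) * - (tpi ^+ 2 / 4) * (4 * tpi ^+ 2)) ^+ 2).
    have q : - (tpi ^+ 2 / 4) != 0 by rewrite oppr_eq0 mulf_neq0// ?expf_neq0// invr_neq0.
    rewrite expf_neq0// mulf_neq0//; first by rewrite mulf_neq0.
    by rewrite mulf_neq0// expf_neq0.
  apply: (@clim_ext _ _ _ _ (fun t => (d12 t * d13 t * d23' t) ^+ 2)).
    apply: filterS low => t yt; have [_ _ /= -> _] := disc_low yt.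
    rewrite /d23 (_ : ee (- t) = (ee (t / 2) ^+ 2)^-1); first by field; exact: ee_neq0.
    by rewrite -eeMn -eeN; congr ee; field.
  by apply: climX; apply: climM => //; exact: climM.
Qed.

Lemma cusp_value g (c : C) : bounded_along (@icusp R) (fun t => (g t - c) * ee (- t)) ->
  clim (@icusp R) g c.
Proof.
move=> B; apply/clim_sub0.
apply: (@clim_ext _ _ _ _ (fun t => ee (1%:C * t) * ((g t - c) * ee (- t)))).
  apply: filterE => t /=; rewrite mul1r eeN; field; exact: ee_neq0.
by apply: clim0M B; apply: clim_ee_cusp; exact: ltr01.
Qed.

Lemma mform12_step n h : mform (12 * n.+1%:Z) h ->
  exists c h', mform (12 * n%:Z) h' /\
    forall tau, 0 < Im tau -> h tau = c * E4 tau ^+ (3 * n.+1) + Dl tau * h' tau.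
Proof.
move=> mh; have mE : mform (12 * n.+1%:Z) (fun t => E4 t ^+ (3 * n.+1)).
  by apply: mform_wt (mformX _ E4_mform); lia.
have [[hD hT _ hB] [eD eT _ eB]] := (mh, mE).
have [c0 B0] := cusp_expansion hD hT hB; have [e0 B1] := cusp_expansion eD eT eB.
have [[l l0 El] _ [d d0 Ll]] := level_one_cusp.
have ne0 : e0 != 0.
  have El' : clim (@icusp R) (fun t => E4 t ^+ (3 * n.+1)) (l ^+ (3 * n.+1)) by exact: climX.
  by rewrite (clim_unique (cusp_value B1) El') expf_neq0.
pose u t := h t + - (c0 / e0) * E4 t ^+ (3 * n.+1).
have mu : mform (12 * n.+1%:Z) u by exact: mformD mh (mformZ _ mE).
have Bu : bounded_along (@icusp R) (fun t => u t * ee (- t)).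
  apply: (@bounded_ext _ _ _ _ (fun t => (h t - c0) * ee (- t) +
      - (c0 / e0) * ((E4 t ^+ (3 * n.+1) - e0) * ee (- t)))).
    by apply: filterE => t /=; rewrite /u; field.
  apply: boundedD => //; apply: boundedM => //; exact: clim_bounded (clim_cst _).
exists (c0 / e0), (fun t => u t / Dl t); split; last first.
  by move=> tau yt; rewrite /u; field; rewrite ne0 Dl_neq0.
have [uD uT uS _] := mu; have [dD dT dS _] := Dl_mform.
split=> [tau yt|tau yt|tau yt|].
- by apply: cdiffM; [exact: uD|apply: cdiffV; [exact: dD|exact: Dl_neq0]].
- by rewrite uT// dT.
- rewrite uS// dS//; have t0 := H_neq0 yt.
  have -> : 12 * n.+1%:Z = 12 * n%:Z + 12 by lia.
  by rewrite expfzDr//; field; rewrite Dl_neq0//= expfz_neq0.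
- apply: (@bounded_ext _ _ _ _ (fun t => (u t * ee (- t)) * (Dl t * ee (- t))^-1)).
    exists 0 => t yt /=; field; by rewrite Dl_neq0// ee_neq0.
  by apply: boundedM => //; exact: clim_bounded (climV Ll d0).
Qed.

Lemma mform0_const h : mform 0 h -> exists c, forall tau, 0 < Im tau -> h tau = c.
Proof.
move=> mh; have [hD hT _ hB] := mh; have [c B] := cusp_expansion hD hT hB.
exists c => tau yt; apply/eqP; rewrite -subr_eq0; apply/eqP.
exact: (mform0_vanish (mformD mh (mform_cst (- c))) B yt).
Qed.

End Discriminant.
End Weierstrass.


(** Multiplying by the n-th powers of [E4] and [E6] raises the weight by 10 n. Taking n = m for m >=
    0 and n = -5 m for m < 0 gives the nonnegative weights 12 m and -48 m. *)
Lemma weight_multiple (m : int) : exists n l : nat, 2 * m + (4 * n%:Z + 6 * n%:Z) = 12 * l%:Z.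
Proof.
case: m => p; first by exists p, p; lia.
by exists (5 * p.+1)%N, (4 * p.+1)%N; rewrite NegzE; lia.
Qed.

(** * Rational functions in the theta generators *)

Section RationalFunctions.
Variable R : realType.
Local Notation C := R[i].
Local Notation Im := complex.Im.
Local Notation V := 'cV[C]_2.
Implicit Types (tau : C) (v : V) (h : C -> V -> C).

(** The linear forms 0, z, w, z + w, z - w are numbered by [q]. The form 0 supplies theta'(0) and
    theta'''(0), the last two forms absorb the off-diagonal entry of [M], and z, w, z + w are the
    interpolation points. In [gens] the index [i] encodes the form [i %/ 4] and the derivative
    [i %% 4]. *)
Definition slope1 (q : nat) : int := nth 0 [:: 0; 1; 0; 1; 1] q.
Definition slope2 (q : nat) : int := nth 0 [:: 0; 0; 1; 1; -1] q.
Definition lin (q : nat) v : C := (slope1 q)%:~R * v 0 0 + (slope2 q)%:~R * v 1 0.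
Definition gens (i : 'I_20) : C -> V -> C :=
  theta_pullback (i %% 4) (slope1 (i %/ 4)) (slope2 (i %/ 4)).

Lemma linE v : [/\ lin 0 v = 0, lin 1 v = v 0 0, lin 2 v = v 1 0,
  lin 3 v = v 0 0 + v 1 0 & lin 4 v = v 0 0 - v 1 0].
Proof. by split; rewrite /lin /slope1 /slope2 /= ?mulrN1z; ring. Qed.

Definition Pol h := exists P : mpoly.mpoly 20 C, forall tau v, 0 < Im tau ->
  h tau v = mpoly.meval (fun i => gens i tau v) P.

Lemma Pol_cst (c : C) : Pol (fun _ _ => c).
Proof. by exists (mpoly.mpolyC 20 c) => tau v _; rewrite mpoly.mevalC. Qed.

Lemma PolD h1 h2 : Pol h1 -> Pol h2 -> Pol (fun t v => h1 t v + h2 t v).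
Proof.
move=> [P HP] [Q HQ]; eexists => tau v yt; rewrite HP// HQ//.
exact: (esym (mpoly.mevalD _ P Q)).
Qed.

Lemma PolM h1 h2 : Pol h1 -> Pol h2 -> Pol (fun t v => h1 t v * h2 t v).
Proof.
move=> [P HP] [Q HQ]; eexists => tau v yt; rewrite HP// HQ//.
exact: (esym (mpoly.mevalM _ P Q)).
Qed.

Lemma Pol_TH j q : (j < 4)%N -> (q < 5)%N -> Pol (fun t v => TH j t (lin q v)).
Proof.
move=> j4 q5; have H : (q * 4 + j < 20)%N by lia.
exists (mpoly.mpolyX _ (mpoly.mnm1 (Ordinal H))) => tau v yt.
rewrite mpoly.mevalXU /gens /theta_pullback derive1n_theta//=.
by rewrite modnMDl modn_small// divnMDl// divn_small// addn0.
Qed.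

Variables (tau0 : C) (v0 : V).

(** Asking every denominator to be nonzero at the one point [(tau0, v0)] makes this stable under
    products, so [Rat] is closed under the field operations. The relation is stated without division
    and therefore holds also where [d] vanishes. *)
Definition Rat h := exists u d, [/\ Pol u, Pol d, d tau0 v0 != 0 &
  forall tau v, 0 < Im tau -> h tau v * d tau v = u tau v].

Lemma Rat_ext h1 h2 : (forall tau v, 0 < Im tau -> h1 tau v = h2 tau v) -> Rat h1 -> Rat h2.
Proof. by move=> E [u [d [H1 H2 H3 H4]]]; exists u, d; split=> // t v yt; rewrite -E// H4. Qed.

Lemma Rat_Pol h : Pol h -> Rat h.
Proof.
by exists h, (fun _ _ => 1); split=> // *; [exact: Pol_cst|rewrite mulr1].
Qed.

Lemma Rat_cst (c : C) : Rat (fun _ _ => c). Proof. exact: Rat_Pol (Pol_cst c). Qed.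

Lemma RatD h1 h2 : Rat h1 -> Rat h2 -> Rat (fun t v => h1 t v + h2 t v).
Proof.
move=> [u1 [d1 [a1 b1 c1 e1]]] [u2 [d2 [a2 b2 c2 e2]]].
exists (fun t v => u1 t v * d2 t v + u2 t v * d1 t v), (fun t v => d1 t v * d2 t v); split.
- by apply: PolD; exact: PolM.
- exact: PolM.
- exact: mulf_neq0.
- by move=> t v yt; rewrite -e1// -e2//; ring.
Qed.

Lemma RatM h1 h2 : Rat h1 -> Rat h2 -> Rat (fun t v => h1 t v * h2 t v).
Proof.
move=> [u1 [d1 [a1 b1 c1 e1]]] [u2 [d2 [a2 b2 c2 e2]]].
exists (fun t v => u1 t v * u2 t v), (fun t v => d1 t v * d2 t v); split.
- exact: PolM.
- exact: PolM.
- exact: mulf_neq0.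
- by move=> t v yt; rewrite -e1// -e2//; ring.
Qed.

Lemma RatZ (c : C) h : Rat h -> Rat (fun t v => c * h t v).
Proof. exact: RatM (Rat_cst c). Qed.

Lemma RatB h1 h2 : Rat h1 -> Rat h2 -> Rat (fun t v => h1 t v - h2 t v).
Proof.
by move=> H1 H2; apply: Rat_ext (RatD H1 (RatZ (-1) H2)) => t v _; rewrite mulN1r.
Qed.

Lemma RatX h n : Rat h -> Rat (fun t v => h t v ^+ n).
Proof.
move=> H; elim: n => [|n IH]; first exact: Rat_cst.
by apply: Rat_ext (RatM H IH) => t v _; rewrite exprS.
Qed.

Lemma Rat_sum (I : Type) (r : seq I) (F : I -> C -> V -> C) :
  (forall i, Rat (F i)) -> Rat (fun t v => \sum_(i <- r) F i t v).
Proof.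
move=> H; elim: r => [|i r IH].
  by apply: Rat_ext (Rat_cst 0) => t v _; rewrite big_nil.
by apply: Rat_ext (RatD (H i) IH) => t v _; rewrite big_cons.
Qed.

Lemma Rat_div h u w : Rat u -> Rat w -> u tau0 v0 != 0 -> 0 < Im tau0 ->
  (forall tau v, 0 < Im tau -> h tau v * u tau v = w tau v) -> Rat h.
Proof.
move=> [u1 [d1 [a1 b1 c1 e1]]] [u2 [d2 [a2 b2 c2 e2]]] u0 y0 E.
exists (fun t v => u2 t v * d1 t v), (fun t v => u1 t v * d2 t v); split.
- exact: PolM.
- exact: PolM.
- by rewrite -e1// !mulf_neq0.
- by move=> t v yt; rewrite -e1// -e2// -E//; ring.
Qed.

Lemma Rat_rational h : 0 < Im tau0 -> Rat h -> rational_function_in (@theta_generators R) h.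
Proof.
move=> y0 [u [d [[P HP] [D HD] d0 E]]]; exists 20, gens, P, D; split.
- move=> i; exists (i %% 4)%N, (slope1 (i %/ 4)), (slope2 (i %/ 4)); split=> //.
  by have := ltn_pmod i (isT : (0 < 4)%N); lia.
- by exists tau0, v0; split=> //; rewrite -HD.
- move=> tau v yt; rewrite -HD// -HP// => dn; rewrite -E//; by field.
Qed.

Hypothesis y0 : 0 < Im tau0.

Lemma Rat_TH j q : (j < 4)%N -> (q < 5)%N -> Rat (fun t v => TH j t (lin q v)).
Proof. by move=> j4 q5; apply: Rat_Pol; exact: Pol_TH. Qed.

Lemma Rat_TH0 j : (j < 4)%N -> Rat (fun t v => TH j t 0).
Proof.
move=> j4; apply: Rat_ext (Rat_TH j4 (isT : (0 < 5)%N)) => t v _.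
by have [-> _ _ _ _] := linE v.
Qed.

Lemma Rat_ph q : (q < 5)%N -> Rat (fun t v => ph t (lin q v)).
Proof.
move=> q5; apply: (Rat_div (Rat_TH0 (isT : (1 < 4)%N)) (Rat_TH (isT : (0 < 4)%N) q5)) => //.
  exact: D0_neq0.
by move=> t v yt; rewrite /ph /phG; field; exact: D0_neq0.
Qed.

Lemma Rat_xx q : (q < 5)%N -> Rat (fun t v => xx t (lin q v)).
Proof.
move=> q5; have T1 := Rat_TH0 (isT : (1 < 4)%N).
have T j (j4 : (j < 4)%N) := Rat_TH j4 q5.
have W := RatD (RatM (RatZ 3 T1) (RatB (RatX 2 (T 1%N isT)) (RatM (T 0%N isT) (T 2%N isT))))
  (RatM (Rat_TH0 (isT : (3 < 4)%N)) (RatX 2 (T 0%N isT))).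
apply: (Rat_div (RatZ 3 (RatX 3 T1)) W) => // [|t v yt].
  by rewrite mulf_neq0// expf_neq0// D0_neq0.
by rewrite /xx /xxG; field; exact: D0_neq0.
Qed.

Lemma Rat_yy q : (q < 5)%N -> Rat (fun t v => yy t (lin q v)).
Proof.
move=> q5; have T1 := Rat_TH0 (isT : (1 < 4)%N).
have T j (j4 : (j < 4)%N) := Rat_TH j4 q5.
have W := RatB (RatB (RatM (RatM (RatZ 3 (T 0%N isT)) (T 1%N isT)) (T 2%N isT))
  (RatM (RatX 2 (T 0%N isT)) (T 3%N isT))) (RatZ 2 (RatX 3 (T 1%N isT))).
apply: (Rat_div (RatX 3 T1) W) => // [|t v yt].
  by rewrite expf_neq0// D0_neq0.
by rewrite /yy /yyG; field; exact: D0_neq0.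
Qed.

Lemma Rat_psi a (i : 'I_a) q : (q < 5)%N -> Rat (fun t v => psi i t (lin q v)).
Proof.
move=> q5; apply: RatM; first by apply: RatX; exact: Rat_ph.
rewrite /PfG; case: odd; first by apply: RatM; [apply: RatX; exact: Rat_xx|exact: Rat_yy].
by apply: RatX; exact: Rat_xx.
Qed.

Section Coefficients.
Variables al0 al1 al2 : C -> C.
Hypothesis m0 : mform 6 al0.
Hypothesis m1 : mform 4 al1.
Hypothesis m2 : mform 2 al2.
Hypothesis rel : forall tau z, 0 < Im tau ->
    yy tau z ^+ 2 = 4 * xx tau z ^+ 3 + al2 tau * ph tau z ^+ 2 * xx tau z ^+ 2 +
      al1 tau * ph tau z ^+ 4 * xx tau z + al0 tau * ph tau z ^+ 6.
Let dd (q r : nat) tau v :=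
  xx tau (lin q v) * ph tau (lin r v) ^+ 2 - xx tau (lin r v) * ph tau (lin q v) ^+ 2.
Hypothesis phn0 : forall q, (0 < q < 5)%N -> ph tau0 (lin q v0) != 0.
Hypothesis d12 : dd 1 2 tau0 v0 != 0.
Hypothesis d13 : dd 1 3 tau0 v0 != 0.
Hypothesis d23 : dd 2 3 tau0 v0 != 0.
Hypothesis E4n0 : E4 al1 al2 tau0 != 0.
Hypothesis E6n0 : E6 al0 al1 al2 tau0 != 0.

(** With X = xx / ph^2 at the form [q], [NN] over ph^6 is al2 X^2 + al1 X + al0. [AA], [dd] and [pp]
    are the cleared difference of two such values, the cleared difference of two X, and a common
    denominator. *)
Let NN q tau v := yy tau (lin q v) ^+ 2 - 4 * xx tau (lin q v) ^+ 3.
Let AA q r tau v := NN q tau v * ph tau (lin r v) ^+ 6 - NN r tau v * ph tau (lin q v) ^+ 6.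
Let pp q r tau v := ph tau (lin q v) ^+ 2 * ph tau (lin r v) ^+ 2.

Lemma Rat_dd q r : (q < 5)%N -> (r < 5)%N -> Rat (dd q r).
Proof.
by move=> q5 r5; apply: RatB; apply: RatM; by [exact: Rat_xx|apply: RatX; exact: Rat_ph].
Qed.

Lemma Rat_pp q r : (q < 5)%N -> (r < 5)%N -> Rat (pp q r).
Proof. by move=> q5 r5; apply: RatM; apply: RatX; exact: Rat_ph. Qed.

Lemma Rat_NN q : (q < 5)%N -> Rat (NN q).
Proof.
move=> q5; apply: RatB; first by apply: RatX; exact: Rat_yy.
by apply: RatZ; apply: RatX; exact: Rat_xx.
Qed.

Lemma Rat_AA q r : (q < 5)%N -> (r < 5)%N -> Rat (AA q r).
Proof.
by move=> q5 r5; apply: RatB; apply: RatM; by [exact: Rat_NN|apply: RatX; exact: Rat_ph].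
Qed.

Lemma NNE q tau v : 0 < Im tau -> NN q tau v =
  al2 tau * ph tau (lin q v) ^+ 2 * xx tau (lin q v) ^+ 2 +
      al1 tau * ph tau (lin q v) ^+ 4 * xx tau (lin q v) + al0 tau * ph tau (lin q v) ^+ 6.
Proof. by move=> yt; rewrite /NN rel//; ring. Qed.

Lemma pp_neq0 q r : (0 < q < 5)%N -> (0 < r < 5)%N -> pp q r tau0 v0 != 0.
Proof. by move=> q5 r5; rewrite mulf_neq0// expf_neq0// phn0. Qed.

(* Lagrange interpolation of the cubic at the points z, w and z + w. *)
Lemma Rat_al2 : Rat (fun t _ => al2 t).
Proof.
have D q r q5 r5 := @Rat_dd q r q5 r5; have P q r q5 r5 := @Rat_pp q r q5 r5.
have U := RatM (RatM (RatM (RatM (D 1%N 2%N isT isT) (P 1%N 2%N isT isT))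
  (RatM (D 1%N 3%N isT isT) (P 1%N 3%N isT isT))) (P 1%N 1%N isT isT)) (D 2%N 3%N isT isT).
have W := RatB (RatM (RatM (@Rat_AA 1 2 isT isT) (RatM (D 1%N 3%N isT isT) (P 1%N 3%N isT isT)))
    (P 1%N 3%N isT isT))
  (RatM (RatM (@Rat_AA 1 3 isT isT) (RatM (D 1%N 2%N isT isT) (P 1%N 2%N isT isT)))
    (P 1%N 2%N isT isT)).
apply: (Rat_div U W) => // [|t v yt].
  exact: (mulf_neq0 (mulf_neq0 (mulf_neq0 (mulf_neq0 d12 (@pp_neq0 1 2 isT isT))
    (mulf_neq0 d13 (@pp_neq0 1 3 isT isT))) (@pp_neq0 1 1 isT isT)) d23).
pose s q r := xx t (lin q v) * ph t (lin r v) ^+ 2 + xx t (lin r v) * ph t (lin q v) ^+ 2.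
have AE q r : AA q r t v = dd q r t v * pp q r t v * (al2 t * s q r + al1 t * pp q r t v).
  by rewrite /AA !NNE// /dd /pp /s; ring.
(* The cleared form of X2 - X3 = (X1 + X2) - (X1 + X3). *)
have K : pp 1 1 t v * dd 2 3 t v = s 1%N 2%N * pp 1 3 t v - s 1%N 3%N * pp 1 2 t v.
  rewrite /dd /pp /s; move: (xx t (lin 1 v)) (xx t (lin 2 v)) (xx t (lin 3 v)).
  by move: (ph t (lin 1 v)) (ph t (lin 2 v)) (ph t (lin 3 v)) => *; ring.
rewrite /= !AE; move: K.
move: (s 1%N 2%N) (s 1%N 3%N) (dd 1 2 t v) (dd 1 3 t v) (dd 2 3 t v) (pp 1 2 t v) (pp 1 3 t v)
  (pp 1 1 t v) => s2 s3 D2 D3 D23 P2 P3 P1 K.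
transitivity (al2 t * (D2 * P2 * (D3 * P3)) * (P1 * D23)); first by ring.
by rewrite K; ring.
Qed.

Lemma Rat_al1 : Rat (fun t _ => al1 t).
Proof.
have U := RatM (RatX 2 (@Rat_pp 1 2 isT isT)) (@Rat_dd 1 2 isT isT).
have W := RatB (@Rat_AA 1 2 isT isT) (RatM (RatM Rat_al2 (@Rat_pp 1 2 isT isT))
  (RatB (RatM (RatX 2 (@Rat_xx 1 isT)) (RatX 4 (@Rat_ph 2 isT)))
        (RatM (RatX 2 (@Rat_xx 2 isT)) (RatX 4 (@Rat_ph 1 isT))))).
apply: (Rat_div U W) => // [|t v yt].
  exact: (mulf_neq0 (expf_neq0 2 (@pp_neq0 1 2 isT isT)) d12).
rewrite /= /AA /dd /pp !NNE//.
by move: (xx t _) (xx t _) (ph t _) (ph t _) => *; ring.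
Qed.

Lemma Rat_al0 : Rat (fun t _ => al0 t).
Proof.
have U := RatX 6 (@Rat_ph 1 isT).
have W := RatB (RatB (@Rat_NN 1 isT) (RatM (RatM Rat_al2 (RatX 2 (@Rat_ph 1 isT)))
   (RatX 2 (@Rat_xx 1 isT)))) (RatM (RatM Rat_al1 (RatX 4 (@Rat_ph 1 isT))) (@Rat_xx 1 isT)).
apply: (Rat_div U W) => // [|t v yt].
  by rewrite expf_neq0// phn0.
rewrite NNE//; ring.
Qed.

Lemma Rat_E4 : Rat (fun t _ => E4 al1 al2 t).
Proof.
apply: RatD; last by apply: RatZ; exact: Rat_al1.
by apply: RatM; [apply: RatM; exact: Rat_al2|exact: Rat_cst].
Qed.

Lemma Rat_E6 : Rat (fun t _ => E6 al0 al1 al2 t).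
Proof.
apply: RatD; last apply: RatD.
- by apply: RatZ; apply: RatM; [apply: RatM|]; exact: Rat_al2.
- by apply: RatZ; apply: RatM; [exact: Rat_al2|exact: Rat_al1].
- by apply: RatZ; exact: Rat_al0.
Qed.

Lemma Rat_Dl : Rat (fun t _ => Dl al0 al1 al2 t).
Proof.
by apply: RatD; apply: RatZ; apply: RatX; [exact: Rat_E4|exact: Rat_E6].
Qed.

Lemma Rat_mform12 n g : mform (12 * n%:Z) g -> Rat (fun t _ => g t).
Proof.
elim: n g => [|n IH] g mg.
  have [c gc] := mform0_const mg.
  by apply: Rat_ext (Rat_cst c) => t v yt; rewrite gc.
have [c [h [mh gE]]] := mform12_step m0 m1 m2 rel mg.
apply: Rat_ext (RatD (RatZ c (RatX (3 * n.+1) Rat_E4)) (RatM Rat_Dl (IH _ mh))) => t v yt.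
by rewrite gE.
Qed.

Lemma Rat_mform k g : mform k g -> Rat (fun t _ => g t).
Proof.
move=> mg; have [m [km|km]] : exists m : int, k = 2 * m \/ k = 2 * m + 1.
  by exists (k %/ 2)%Z; have := divz_eq k 2; have := modz_ge0 k (isT : 2 != 0 :> int);
     have := ltz_mod k (isT : 2 != 0 :> int); lia.
  have [n [l wt]] := weight_multiple m.
  have mh := mformM mg (mformM (mformX n (E4_mform m1 m2)) (mformX n (E6_mform m0 m1 m2))).
  rewrite -km in wt.
  apply: (Rat_div (RatM (RatX n Rat_E4) (RatX n Rat_E6)) (Rat_mform12 (mform_wt wt mh))) => //.
  by rewrite mulf_neq0// expf_neq0.
rewrite km in mg; apply: Rat_ext (Rat_cst 0) => t v yt.
by rewrite (mform_odd mg).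
Qed.

End Coefficients.
End RationalFunctions.

(** * The base point *)

Section BasePoint.
Variable R : realType.
Local Notation C := R[i].
Local Notation Im := complex.Im.
Implicit Types (tau z w : C).

(** 0 is a simple zero of [ph], hence isolated. Multiples up to 5 are wanted because at (e, 2 e) the
    points z, w, z + w are e, 2 e, 3 e, whose pairwise sums reach 5 e. *)
Lemma ph_small tau : 0 < Im tau -> exists e : C,
  forall n, (0 < n < 6)%N -> ph tau (n%:R * e) != 0.
Proof.
move=> yt; have [u uL [d1 d1p H1]] := cderiv_TH 0 0 yt.
have d0 := D0_neq0 yt.
have [d2 d2p H2] : cnear 0 [set w | u w != 0] by exact: (clim_neq0 uL d0).
pose d := Num.min d1 d2; have dp : 0 < d by rewrite lt_min d1p.
exists (d / 6)%:C => n /andP[n0 n6].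
have nn : n%:R * (d / 6)%:C != 0 :> C.
  by rewrite mulf_neq0 ?pnatr_eq0 -?lt0n// -cnorm_gt0 cnorm_real normr_gt0 gt_eqF// divr_gt0.
have nd : cnorm (n%:R * (d / 6)%:C - 0) < d.
  have -> : n%:R * (d / 6)%:C - 0 = (n%:R * (d / 6))%:C :> C.
    by rewrite subr0 [RHS]rmorphM rmorph_nat.
  rewrite cnorm_real ger0_norm ?mulr_ge0 ?ler0n ?divr_ge0 ?(ltW dp)//.
  have n5 : n%:R <= 5 :> R by rewrite (ler_nat R n 5).
  have d6 : 0 <= d / 6 by rewrite divr_ge0 ?(ltW dp).
  by have := ler_wpM2r d6 n5; lra.
have [n1 n2] : cnorm (n%:R * (d / 6)%:C - 0) < d1 /\ cnorm (n%:R * (d / 6)%:C - 0) < d2.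
  by move: nd; rewrite /d lt_min => /andP.
rewrite /ph /phG mulf_neq0 ?invr_neq0//.
by rewrite (H1 _ n1) TH00 add0r subr0 mulf_neq0//; exact: H2.
Qed.

Definition vec z w : 'cV[C]_2 := \col_i (if i == 0 then z else w).

Lemma vecE z w : vec z w 0 0 = z /\ vec z w 1 0 = w.
Proof. by split; rewrite mxE. Qed.

Lemma vec_eta (v : 'cV[C]_2) : vec (v 0 0) (v 1 0) = v.
Proof.
apply/colP => i; rewrite mxE; case: i => -[|[|//]] hi.
  by congr (v _ 0); apply/val_inj.
by congr (v _ 0); apply/val_inj.
Qed.

End BasePoint.


(** * Weak Jacobi forms of rank two *)

Section JacobiForms.
Variable R : realType.
Local Notation C := R[i].
Local Notation Im := complex.Im.
Implicit Types (tau z w : C).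

(** Convergence at height 1 bounds the terms there; at height at least 2 they shrink by powers of
    1/2, so the partial sums are bounded uniformly in [tau]. *)
Lemma fourier_bounded (c : nat -> C) (f : C -> C) :
  (forall tau, 0 < Im tau -> series (fun m : nat => c m * ee (m%:R * tau)) @ \oo --> f tau) ->
  bounded_along (@icusp R) f.
Proof.
move=> H; pose t1 : C := 0 +i* 1; pose u m := c m * ee (m%:R * t1).
have y1 : 0 < Im t1 by rewrite /= ltr01.
have /cvg_clim c1 := H t1 y1; have [M [N _ HN]] := clim_bounded c1.
have HN' n : (N <= n)%N -> cnorm (series u n) <= M by move=> h; exact: (HN n h).
have M0 : 0 <= M := le_trans (cnorm_ge0 _) (HN' N (leqnn _)).
(* [2 * M] bounds the terms from N on, as differences of partial sums, and the finite sum bounds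
   those before. *)
pose K := 2 * M + \sum_(i < N) cnorm (u i).
have s0 (P : pred 'I_N) : 0 <= \sum_(i < N | P i) cnorm (u i).
  by apply: sumr_ge0 => i _; exact: cnorm_ge0.
have uK m : cnorm (u m) <= K.
  case: (ltnP m N) => mN.
    rewrite /K (bigD1 (Ordinal mN))//=; have := s0 (fun i => i != Ordinal mN); lra.
  have -> : u m = series u m.+1 - series u m.
    by rewrite /series /= big_nat_recr//= [_ + u m]addrC addrK.
  apply: le_trans (cnormB _ _) _; have := HN' m mN; have := HN' m.+1 (leqW mN).
  by have := s0 xpredT; rewrite /K; lra.
have K0 : 0 <= K := le_trans (cnorm_ge0 _) (uK 0%N).
exists (2 * K + 1); exists 2 => tau yt /=.
have y0 : 0 < Im tau by lra.
have x2 : cnorm (ee (tau - t1)) <= 2^-1.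
  rewrite cnorm_ee cImD cImN /=.
  have := @expRN_nat_le R 1 (2 * pi * (Im tau - 1)); rewrite expr1 => h.
  have p2 := pi_ge2 R.
  have : 1%:R <= 2 * pi * (Im tau - 1) by have : 4 * 1 <= 2 * pi * (Im tau - 1); [apply: ler_pM; lra|lra].
  by move/h; lra.
pose W m := c m * ee (m%:R * tau).
have B n : cnorm (series W n) <= K * (2 - 2 * 2^-1 ^+ n).
  elim: n => [|n IH].
    by rewrite /series /= big_geq// cnorm0 expr0 mulr1 subrr mulr0.
  rewrite /series /= big_nat_recr//=; apply: le_trans (cnormD _ _) _.
  have tW : cnorm (W n) <= K * 2^-1 ^+ n.
    have -> : W n = u n * ee (tau - t1) ^+ n.
      by rewrite /W /u -eeMn -mulrA -eeD; congr (_ * ee _); ring.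
    rewrite cnormM cnormX; apply: ler_pM; rewrite ?cnorm_ge0 ?exprn_ge0 ?cnorm_ge0//.
    by apply: lerXn2r; rewrite ?nnegrE ?cnorm_ge0// invr_ge0.
  by move: IH tW; rewrite /series /= exprS; lra.
have /cvg_clim ct := H tau y0; have [N' _ HM] := ct 1 ltr01.
have /= h1 := HM N' (leqnn _).
have h2 : cnorm (f tau) <= cnorm (series W N') + cnorm (series W N' - f tau).
  rewrite [X in X <= _](_ : _ = cnorm (series W N' - (series W N' - f tau))); first exact: cnormB.
  by congr cnorm; ring.
have x0 : 0 <= 2^-1 ^+ N' :> R by rewrite exprn_ge0// invr_ge0.
have h3 : cnorm (series W N') <= 2 * K.
  by apply: le_trans (B N') _; have := mulr_ge0 K0 x0; lra.
by apply: le_trans h2 _; rewrite -/W in h1; lra.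
Qed.

Lemma differentiable_slices (f : C -> 'cV[C]_2 -> C) tau z w :
  differentiable (fun p : C * 'cV[C]_2 => f p.1 p.2) (tau, vec z w) ->
  [/\ cdiff (fun t => f t (vec z w)) tau, cdiff (fun t => f tau (vec t w)) z &
      cdiff (fun t => f tau (vec z t)) w].
Proof.
move=> H; have L d : cdiff (fun t => f (t *: d + (tau, vec z w)).1 (t *: d + (tau, vec z w)).2) 0.
  exact: derivable_cderiv (diff_derivable H).
split.
- have [d Hd] := L (1, 0); exists d; apply: cderiv_at0; apply: cderiv_ext Hd.
  apply: filterE => t /=; congr f; last by rewrite scaler0 add0r.
  by rewrite /GRing.scale /= mulr1 addrC.
- have [d Hd] := L (0, vec 1 0); exists d; apply: cderiv_at0; apply: cderiv_ext Hd.
  apply: filterE => t /=; congr f; first by rewrite scaler0 add0r.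
  by apply/colP => i; rewrite !mxE; case: ifP => _; ring.
- have [d Hd] := L (0, vec 0 1); exists d; apply: cderiv_at0; apply: cderiv_ext Hd.
  apply: filterE => t /=; congr f; first by rewrite scaler0 add0r.
  by apply/colP => i; rewrite !mxE; case: ifP => _; ring.
Qed.

Lemma bformE (A : comNzRingType) (M : 'M[int]_2) (x y : 'cV[A]_2) : M^T = M ->
  bform M x y = (M 0 0)%:~R * x 0 0 * y 0 0 + (M 0 1)%:~R * x 0 0 * y 1 0 +
    (M 0 1)%:~R * x 1 0 * y 0 0 + (M 1 1)%:~R * x 1 0 * y 1 0.
Proof.
move=> symM; have M10 : M 1 0 = M 0 1 by rewrite -{1}symM mxE.
have o1 : lift ord0 ord0 = 1 :> 'I_2 by apply/val_inj.
have o0 : ord0 = 0 :> 'I_2 by [].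
rewrite /bform !mxE !big_ord_recl !big_ord0 !mxE !big_ord_recl !big_ord0 !mxE !o1 !o0 M10.
by ring.
Qed.

Definition ivec (l0 l1 : int) : 'cV[int]_2 := \col_i (if i == 0 then l0 else l1).

Lemma psi_ph tau z : psi (@Ordinal 1 0 isT) tau z = ph tau z.
Proof.
have -> : psi (@Ordinal 1 0 isT) tau z = ph tau z ^+ 1 * 1 by [].
by rewrite expr1 mulr1.
Qed.

Lemma ph_cdiff z tau : 0 < Im tau -> cdiff (fun t => ph t z) tau.
Proof.
move=> yt; apply: cdiff_ext (cdiff_psi (@Ordinal 1 0 isT) z yt).
by apply: filterE => t; rewrite /= psi_ph.
Qed.

Lemma ph_bounded z : bounded_along (@icusp R) (fun t => ph t z).
Proof.
apply: bounded_ext (clim_bounded (psi_cusp (@Ordinal 1 0 isT) z)).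
by apply: filterE => t; rewrite /= psi_ph.
Qed.

(** * Reduction to a diagonal index and conclusion *)

Section Reduction.
Variables (M : 'M[int]_2) (k : int) (f : C -> 'cV[C]_2 -> C).
Hypothesis symM : M^T = M.
Hypothesis psdM : possemidef R M.
Hypothesis hf : weak_jacobi_form M k f.

Let A := absz (M 0 0).
Let B := absz (M 0 1).
Let D := absz (M 1 1).
(** The sign for which M_01 = - B eps: the off-diagonal entry B eps contributed by the B-th power of
    phi(z + eps w) cancels that of [M]. *)
Let eps : int := if 0 <= M 0 1 then -1 else 1.
Let e : C := eps%:~R.

(** Semidefiniteness on the two unit vectors makes the diagonal entries nonnegative, so they can
    serve as indices of the spaces [Vsp]. *)
Lemma diag_nat : (M 0 0)%:~R = A%:R :> C /\ (M 1 1)%:~R = D%:R :> C.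
Proof.
split.
- have := psdM (\col_i (if i == 0 then 1 else 0)); rewrite bformE// !mxE /= !mulr1 !mulr0 !addr0.
  by rewrite ler0z => h; rewrite pmulrn /A gez0_abs.
- have := psdM (\col_i (if i == 0 then 0 else 1)); rewrite bformE// !mxE /= !mulr1 !mulr0 !add0r.
  by rewrite ler0z => h; rewrite pmulrn /D gez0_abs.
Qed.

Lemma diag_sign : (-1) ^ (M 0 0) = (-1) ^+ A :> C /\ (-1) ^ (M 1 1) = (-1) ^+ D :> C.
Proof.
have [hA hD] := diag_nat.
have E (n : int) : n%:~R = (absz n)%:R :> C -> n = (absz n)%:Z.
  by rewrite pmulrn => /intr_inj.
by rewrite {1}(E _ hA) {1}(E _ hD).
Qed.

Lemma off_diag : (M 0 1)%:~R = - (B%:R * e) :> C.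
Proof.
rewrite /e /eps pmulrn -intrM -mulrNz; congr (_%:~R).
by rewrite /B; case: ifP; lia.
Qed.

Lemma e_sq : e * e = 1.
Proof. by rewrite /e -intrM /eps; case: ifP. Qed.

(** The index of [F] is diagonal with entries A + B + 1 and D + B + 1; the last two factors supply
    the 1, so both are positive. *)
Let F tau z w := f tau (vec z w) * ph tau (z + e * w) ^+ B * ph tau z * ph tau w.

Lemma f_elliptic (l0 l1 n0 n1 : int) tau z w : 0 < Im tau ->
  f tau (vec (z + tau * l0%:~R + n0%:~R) (w + tau * l1%:~R + n1%:~R)) =
  (-1) ^ (bform M (ivec l0 l1) (ivec l0 l1) + bform M (ivec n0 n1) (ivec n0 n1)) *
  ee (- tau * (((M 0 0)%:~R * l0%:~R * l0%:~R + 2 * (M 0 1)%:~R * l0%:~R * l1%:~R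
    + (M 1 1)%:~R * l1%:~R * l1%:~R) / 2) -
    ((M 0 0)%:~R * l0%:~R * z + (M 0 1)%:~R * l0%:~R * w +
    (M 0 1)%:~R * l1%:~R * z + (M 1 1)%:~R * l1%:~R * w)) * f tau (vec z w).
Proof.
move=> yt; have := jacobi_elliptic hf (ivec l0 l1) (ivec n0 n1) (vec z w) yt.
rewrite /= /quad [bform M (map_mx _ _) (map_mx _ _)]bformE//.
rewrite [bform M (map_mx _ _) (vec _ _)]bformE// !mxE /= => E.
have -> : vec (z + tau * l0%:~R + n0%:~R) (w + tau * l1%:~R + n1%:~R) =
    vec z w + tau *: map_mx intr (ivec l0 l1) + map_mx intr (ivec n0 n1).
  by apply/colP => i; rewrite !mxE; case: ifP.
rewrite E; congr (_ * ee _ * _); by ring.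
Qed.

Lemma bform_unit : [/\ bform M (ivec 1 0) (ivec 1 0) = M 0 0,
  bform M (ivec 0 1) (ivec 0 1) = M 1 1 & bform M (ivec 0 0) (ivec 0 0) = 0].
Proof. by split; rewrite bformE// !mxE /= !intz; ring. Qed.

Lemma f_period tau z w : 0 < Im tau ->
  [/\ f tau (vec (z + 1) w) = (-1) ^+ A * f tau (vec z w),
      f tau (vec z (w + 1)) = (-1) ^+ D * f tau (vec z w),
      f tau (vec (z + tau) w) = (-1) ^+ A *
        ee (- (A%:R / 2 * tau) - A%:R * z + B%:R * e * w) * f tau (vec z w) &
      f tau (vec z (w + tau)) = (-1) ^+ D *
        ee (- (D%:R / 2 * tau) - D%:R * w + B%:R * e * z) * f tau (vec z w)].
Proof.
move=> yt; have [hA hD] := diag_nat; have [sA sD] := diag_sign; have hB := off_diag.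
have [u1 u2 u3] := bform_unit; split.
- have := f_elliptic 0 0 1 0 z w yt; rewrite u1 u3 add0r sA => E.
  rewrite (_ : vec (z + 1) w = vec (z + tau * 0%:~R + 1%:~R) (w + tau * 0%:~R + 0%:~R)).
    by rewrite E [X in ee X](_ : _ = 0) ?ee0 ?mulr1//; ring.
  by congr vec; ring.
- have := f_elliptic 0 0 0 1 z w yt; rewrite u2 u3 add0r sD => E.
  rewrite (_ : vec z (w + 1) = vec (z + tau * 0%:~R + 0%:~R) (w + tau * 0%:~R + 1%:~R)).
    by rewrite E [X in ee X](_ : _ = 0) ?ee0 ?mulr1//; ring.
  by congr vec; ring.
- have := f_elliptic 1 0 0 0 z w yt; rewrite u1 u3 (addr0 (M 0 0)) sA hA hB => E.
  rewrite (_ : vec (z + tau) w = vec (z + tau * 1%:~R + 0%:~R) (w + tau * 0%:~R + 0%:~R)).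
    by rewrite E; congr (_ * ee _ * _); field.
  by congr vec; ring.
- have := f_elliptic 0 1 0 0 z w yt; rewrite u2 u3 (addr0 (M 1 1)) sD hD hB => E.
  rewrite (_ : vec z (w + tau) = vec (z + tau * 0%:~R + 0%:~R) (w + tau * 1%:~R + 0%:~R)).
    by rewrite E; congr (_ * ee _ * _); field.
  by congr vec; ring.
Qed.

Lemma ph_period tau y : 0 < Im tau -> [/\ ph tau (y + 1) = - ph tau y,
  ph tau (y + tau) = - ee (- (tau / 2) - y) * ph tau y,
  ph tau (y + e) = - ph tau y & ph tau (y + e * tau) = - ee (- (tau / 2) - e * y) * ph tau y].
Proof.
move=> yt; have [_ p1 pt] := Vsp_ph yt.
have q1 x : ph tau (x + 1) = - ph tau x by rewrite p1 expr1 mulN1r.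
have qt x : ph tau (x + tau) = - ee (- (tau / 2) - x) * ph tau x.
  by rewrite pt expr1 mulN1r; congr (- ee _ * _); field.
split=> //; rewrite /e /eps; case: ifP => _; rewrite ?mulr1z ?mulrN1z ?mulN1r ?mul1r//.
- by rewrite -[in RHS](subrK 1 y) q1 opprK.
- have := qt (y - tau); rewrite subrK => ->; rewrite opprK mulrA mulrNN -eeD.
  by rewrite [X in ee X](_ : _ = 0) ?ee0 ?mul1r//; field.
Qed.

Lemma F_Vsp1 tau w : 0 < Im tau -> Vsp (A + B + 1) tau (fun z => F tau z w).
Proof.
move=> yt; have [d p1 pt] := Vsp_ph yt; split=> z.
- have [_ d1 _] := differentiable_slices (jacobi_holomorphic hf (vec z w) yt).
  apply: cdiffM; last exact: cdiff_cst.
  apply: cdiffM; last exact: d.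
  apply: cdiffM => //; apply: cdiffX.
  apply: (@cdiff_comp _ (ph tau) (fun z => z + e * w)); first exact: d.
  by apply: cdiffD; [exact: cdiff_id|exact: cdiff_cst].
- have [h _ _ _] := f_period z w yt.
  have [q1 _ _ _] := ph_period (z + e * w) yt; have [q2 _ _ _] := ph_period z yt.
  rewrite /F h (addrAC z 1) q1 q2 (exprNn (ph _ _)) !exprD expr1.
  by ring.
- have [_ _ h _] := f_period z w yt.
  have [_ q1 _ _] := ph_period (z + e * w) yt; have [_ q2 _ _] := ph_period z yt.
  rewrite /F h (addrAC z tau) q1 q2 (exprMn B (- ee _)) (exprNn (ee _)) -eeMn !exprD expr1.
  have -> : ee (- ((A + B + 1)%:R / 2 * tau) - (A + B + 1)%:R * z) =
      ee (- (A%:R / 2 * tau) - A%:R * z + B%:R * e * w) *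
      ee (B%:R * (- (tau / 2) - (z + e * w))) * ee (- (tau / 2) - z).
    by rewrite -!eeD; congr ee; rewrite !natrD; field.
  by ring.
Qed.

Lemma F_Vsp2 tau z : 0 < Im tau -> Vsp (D + B + 1) tau (F tau z).
Proof.
move=> yt; have [d p1 pt] := Vsp_ph yt; split=> w.
- have [_ _ d1] := differentiable_slices (jacobi_holomorphic hf (vec z w) yt).
  apply: cdiffM; last exact: d.
  apply: cdiffM; last exact: cdiff_cst.
  apply: cdiffM => //; apply: cdiffX.
  apply: (@cdiff_comp _ (ph tau) (fun w => z + e * w)); first exact: d.
  apply: cdiffD; first exact: cdiff_cst.
  by apply: cdiffM; [exact: cdiff_cst|exact: cdiff_id].
- have [_ h _ _] := f_period z w yt.
  have [_ _ q1 _] := ph_period (z + e * w) yt; have [q2 _ _ _] := ph_period w yt.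
  rewrite /F h (_ : z + e * (w + 1) = z + e * w + e); last by ring.
  by rewrite q1 q2 (exprNn (ph _ _)) !exprD expr1; ring.
- have [_ _ _ h] := f_period z w yt.
  have [_ _ _ q1] := ph_period (z + e * w) yt; have [_ q2 _ _] := ph_period w yt.
  rewrite /F h (_ : z + e * (w + tau) = z + e * w + e * tau); last by ring.
  rewrite q1 q2 (_ : e * (z + e * w) = e * z + w); last by rewrite mulrDr mulrA e_sq mul1r.
  rewrite (exprMn B (- ee _)) (exprNn (ee _)) -eeMn !exprD expr1.
  have -> : ee (- ((D + B + 1)%:R / 2 * tau) - (D + B + 1)%:R * w) =
      ee (- (D%:R / 2 * tau) - D%:R * w + B%:R * e * z) *
      ee (B%:R * (- (tau / 2) - (e * z + w))) * ee (- (tau / 2) - w).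
    by rewrite -!eeD; congr ee; rewrite !natrD; field.
  by ring.
Qed.

(** Each of the B + 2 factors [ph] has weight -1. As e^2 = 1, expanding (z + e w)^2 leaves a cross
    term that cancels the one of [f]. *)
Lemma F_S tau z w : 0 < Im tau -> F (- tau^-1) (z / tau) (w / tau) =
  tau ^ (k + - B%:Z + - 2%:Z) * ee (w ^+ 2 / (2 * tau)) ^+ (D + B + 1) *
  ee (z ^+ 2 / (2 * tau)) ^+ (A + B + 1) * F tau z w.
Proof.
move=> yt; have t0 := H_neq0 yt; have [hA hD] := diag_nat; have hB := off_diag.
have h : f (- tau^-1) (vec (z / tau) (w / tau)) = tau ^ k *
    ee ((A%:R * z ^+ 2 + D%:R * w ^+ 2 - 2 * B%:R * e * z * w) / (2 * tau)) * f tau (vec z w).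
  have := @jacobi_modular _ _ _ _ _ hf 0 (-1) 1 0 tau (vec z w) (erefl _) yt.
  rewrite /= mul0r add0r mulrN1z mulr1z mul1r addr0 mulN1r mul1r.
  rewrite (_ : tau^-1 *: vec z w = vec (z / tau) (w / tau)); last first.
    by apply/colP => i; rewrite !mxE; case: ifP => _; exact: mulrC.
  move=> ->; congr (_ * ee _ * _); rewrite /quad bformE// !mxE /= hA hD hB.
  by field.
have [q1 _ _] := quot_S (z + e * w) yt; have [q2 _ _] := quot_S z yt.
have [q3 _ _] := quot_S w yt.
have -> : tau ^ (k + - B%:Z + - 2%:Z) = tau ^ k * (tau^-1) ^+ B * tau^-1 ^+ 2.
  by rewrite !expfzDr// -!exprnN !exprVn.
rewrite /F h (_ : z / tau + e * (w / tau) = (z + e * w) / tau); last by ring.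
rewrite q1 q2 q3 (exprMn B (tau^-1 * _)) (exprMn B tau^-1) -!eeMn.
have -> : (z + e * w) ^+ 2 = z ^+ 2 + 2 * e * z * w + w ^+ 2.
  transitivity (z ^+ 2 + 2 * e * z * w + (e * e) * w ^+ 2); first by ring.
  by rewrite e_sq mul1r.
have E : ee ((D + B + 1)%:R * (w ^+ 2 / (2 * tau))) * ee ((A + B + 1)%:R * (z ^+ 2 / (2 * tau))) =
    ee ((A%:R * z ^+ 2 + D%:R * w ^+ 2 - 2 * B%:R * e * z * w) / (2 * tau)) *
    ee (B%:R * ((z ^+ 2 + 2 * e * z * w + w ^+ 2) / (2 * tau))) *
    ee (z ^+ 2 / (2 * tau)) * ee (w ^+ 2 / (2 * tau)).
  by rewrite -!eeD; congr ee; rewrite !natrD; field.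
move: E; move: (ee (_ * (w ^+ 2 / _))) (ee (_ * (z ^+ 2 / _))) => x y E.
transitivity (tau ^ k * tau^-1 ^+ B * tau^-1 ^+ 2 * (x * y) * (f tau (vec z w) *
  ph tau (z + e * w) ^+ B * ph tau z * ph tau w)); last by ring.
by rewrite E; ring.
Qed.

Lemma reduction : exists g : 'I_(A + B + 1) -> 'I_(D + B + 1) -> C -> C,
  (forall i j, exists l, mform l (g i j)) /\
  forall tau z w, 0 < Im tau -> F tau z w = \sum_i \sum_j g i j tau * (psi i tau z * psi j tau w).
Proof.
apply: (two_variable_coefficients (k := k + - B%:Z + - 2%:Z)).
- by rewrite addn1.
- by rewrite addn1.
- exact: F_Vsp1.
- exact: F_Vsp2.
- move=> tau z w yt.
  have [d1 _ _] := differentiable_slices (jacobi_holomorphic hf (vec z w) yt).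
  apply: cdiffM; last exact: ph_cdiff.
  apply: cdiffM; last exact: ph_cdiff.
  by apply: cdiffM => //; apply: cdiffX; exact: ph_cdiff.
- move=> tau z w yt.
  have := @jacobi_modular _ _ _ _ _ hf 1 1 0 1 tau (vec z w) (erefl _) yt.
  rewrite /= mulr1z mul0r add0r mul1r divr1 invr1 scale1r exp1rz !mul0r ee0 !mul1r => h.
  have [q1 _ _] := quot_T (z + e * w) yt; have [q2 _ _] := quot_T z yt.
  by have [q3 _ _] := quot_T w yt; rewrite /F h q1 q2 q3.
- exact: F_S.
- move=> z w; have [c hc] := jacobi_fourier hf.
  apply: boundedM; last exact: ph_bounded.
  apply: boundedM; last exact: ph_bounded.
  apply: boundedM.
    by apply: (@fourier_bounded (c^~ (vec z w))) => tau yt; exact: hc.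
  have H n : bounded_along (@icusp R) (fun t => ph t (z + e * w) ^+ n).
    elim: n => [|n IH]; first exact: clim_bounded (clim_cst 1).
    by apply: bounded_ext (boundedM (ph_bounded _) IH); apply: filterE => t; rewrite /= exprS.
  exact: H.
Qed.

Lemma jacobi_rational : rational_function_in (@theta_generators R) f.
Proof.
have [al0 [al1 [al2 [m0 m1 m2 rel]]]] := weierstrass R.
have [[c4 c40 L4] [c6 c60 L6] _] := level_one_cusp rel.
(* Both forms have nonzero limits at the cusp, so any point high enough works. *)
have [tau0 [[y0 E4n0] E6n0]] : exists t : C, (0 < Im t /\ E4 al1 al2 t != 0) /\ E6 al0 al1 al2 t != 0.
  have n1 : icusp [set t | E4 al1 al2 t != 0] by exact: (clim_neq0 L4 c40).
  have n2 : icusp [set t | E6 al0 al1 al2 t != 0] by exact: (clim_neq0 L6 c60).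
  have n3 : icusp [set t : C | 0 < Im t] by exists 0.
  have [t [[h1 h2] h3]] := filter_ex (filterI (filterI n3 n1) n2).
  by exists t.
have [x Hx] := ph_small y0.
(* The nonzero linear forms take the values x, 2 x, 3 x and -x. By [ph_addition] the [dd] are
   products of values of [ph] at small multiples of x. *)
pose v0 := vec x (2%:R * x); have [v00 v01] := vecE x (2%:R * x).
have [_ l1 l2 l3 l4] := linE v0; rewrite /v0 v00 v01 -/v0 in l1 l2 l3 l4.
have x1 := Hx 1%N isT; rewrite mul1r in x1.
have x2 := Hx 2%N isT; have x3 := Hx 3%N isT; have x4 := Hx 4%N isT; have x5 := Hx 5%N isT.
have l3' : lin 3 v0 = 3%:R * x by rewrite l3; ring.
have l4' : lin 4 v0 = - x by rewrite l4; ring.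
have phn0 q : (0 < q < 5)%N -> ph tau0 (lin q v0) != 0.
  case: q => [|[|[|[|[|]]]]] // _; rewrite ?l1 ?l2 ?l3' ?l4'//.
  by have [-> _ _] := quot_opp tau0 x; rewrite oppr_eq0.
have dd q r (q5 : (0 < q < 5)%N) (n1 : ph tau0 (lin r v0 + lin q v0) != 0)
    (n2 : ph tau0 (lin r v0 - lin q v0) != 0) : xx tau0 (lin q v0) * ph tau0 (lin r v0) ^+ 2 -
    xx tau0 (lin r v0) * ph tau0 (lin q v0) ^+ 2 != 0.
  rewrite [X in _ - X]mulrC -ph_addition//; first exact: mulf_neq0.
  exact: phn0.
have d12 := dd 1%N 2%N isT; have d13 := dd 1%N 3%N isT; have d23 := dd 2%N 3%N isT.
rewrite l1 l2 (_ : 2%:R * x + x = 3%:R * x) in d12; last by ring.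
rewrite (_ : 2%:R * x - x = x) in d12; last by ring.
rewrite l1 l3' (_ : 3%:R * x + x = 4%:R * x) in d13; last by ring.
rewrite (_ : 3%:R * x - x = 2%:R * x) in d13; last by ring.
rewrite l2 l3' (_ : 3%:R * x + 2%:R * x = 5%:R * x) in d23; last by ring.
rewrite (_ : 3%:R * x - 2%:R * x = x) in d23; last by ring.
have RM l g (mg : mform l g) : Rat tau0 v0 (fun t _ => g t).
  apply: (Rat_mform y0 m0 m1 m2 rel phn0 _ _ _ E4n0 E6n0 mg).
  - by rewrite l1 l2; exact: d12.
  - by rewrite l1 l3'; exact: d13.
  - by rewrite l2 l3'; exact: d23.
have [g [mg gE]] := reduction.
apply: (Rat_rational y0).
(* The number of the form z + e w: z - w for [4], z + w for [3]. *)
pose q := if 0 <= M 0 1 then 4%N else 3%N.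
have q5 : (0 < q < 5)%N by rewrite /q; case: ifP.
have lq v : lin q v = v 0 0 + e * v 1 0.
  have [_ _ _ a3 a4] := linE v; rewrite /q /e /eps; case: ifP => _; rewrite ?a3 ?a4.
    by rewrite mulrN1z mulN1r.
  by rewrite mulr1z mul1r.
have q5' : (q < 5)%N by case/andP: q5.
have U := RatM (RatM (RatX B (Rat_ph v0 y0 q5')) (Rat_ph v0 y0 (isT : (1 < 5)%N)))
  (Rat_ph v0 y0 (isT : (2 < 5)%N)).
have W : Rat tau0 v0 (fun t v => \sum_i \sum_j g i j t * (psi i t (lin 1 v) * psi j t (lin 2 v))).
  apply: Rat_sum => i; apply: Rat_sum => j; have [l ml] := mg i j.
  apply: RatM; first exact: RM ml.
  by apply: RatM; apply: Rat_psi.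
apply: (Rat_div U W) => // [|t v yt].
  by apply: mulf_neq0; [apply: mulf_neq0|]; rewrite ?expf_neq0// phn0.
have [_ a1 a2 _ _] := linE v; rewrite lq a1 a2 -gE// /F vec_eta; by ring.
Qed.

End Reduction.
End JacobiForms.

Theorem theorem1p2 (R : realType) (M : 'M[int]_2) (symM : M^T = M)
    (psdM : possemidef R M) (k : int) (f : R[i] -> 'cV[R[i]]_2 -> R[i])
    (hf : weak_jacobi_form M k f) :
  rational_function_in (@theta_generators R) f.
Proof. exact: (jacobi_rational symM psdM hf). Qed.
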